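(* Let $k\ge 2$ be an integer and $\sigma\in\{+,-\}$. Let $f:(\mathbb{R}^2,\mathbf{0})\to(\mathbb{R}^3,\mathbf{0})$ be a frontal and fix a representative $\nu$ of the normal vector of $f$. The map-germ $f$ at $\mathbf{0}$ is $\mathcal{A}$-equivalent to the cuspidal $S^{\sigma}_{k-1}$ singularity if and only if the following (a)–(d) hold: (a) $\mathbf{0}$ is a non-degenerate singular point of $f$ and the null vector is transverse to $S(f)$ at $\mathbf{0}$. (b) There exists a curve $c:((-\varepsilon,\varepsilon),0)\to(\mathbb{R}^2,\mathbf{0})$ such that $c'(0)$ is parallel to $\eta(\mathbf{0})$ and, writing $\hat c=f\circ c$ and $\hat\gamma=f\circ\gamma$, one has $\hat c'(0)=\mathbf{0}$, $\hat c''(0)\neq\mathbf{0}$, and there exists $\ell\in\mathbb{R}$ satisfying $\hat c'''(0)=\ell\,\hat c''(0)$ and $$a:=\det\big(\hat\gamma',\ \hat c'',\ 3\hat c^{(5)}-10\ell\,\hat c^{(4)}\big)(0)\neq 0.$$ (c) $\psi(0)=\psi'(0)=\cdots=\psi^{(k-1)}(0)=0$ and $b:=\psi^{(k)}(0)\neq 0$, where $$\psi(t)=\det\Big(\frac{d(f\circ\gamma)}{dt}(t),\ \nu\circ\gamma(t),\ d\nu_{\gamma(t)}(\eta(t))\Big).$$ (d) If $k$ is even, the sign $\sigma$ coincides with the sign of the product $$ab=\det\big(\hat\gamma',\ \hat c'',\ 3\hat c^{(5)}-10\ell\,\hat c^{(4)}\big)(0)\cdot\psi^{(k)}(0),$$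 where $\eta$ and the parameter $t$ are chosen so that $c'(0)$ points in the same direction as the null vector $\eta(0)$ and $(\gamma',\eta)(0)$ is positively oriented.
   Context: All maps are of class $C^\infty$. Cuspidal $S_k^\pm$ singularities: for $k=0,1,2,\dots$, the cuspidal $S_k^{\pm}$ singularity is the map-germ $(x,y)\mapsto\big(x,y^2,y^3(x^{k+1}\pm y^2)\big)$ at the origin. (If $k$ is even, the cuspidal $S_k^+$ and $S_k^-$ singularities are $\mathcal{A}$-equivalent.) $\mathcal{A}$-equivalence: two map-germs $f_1,f_2:(\mathbb{R}^2,\mathbf{0})\to(\mathbb{R}^3,\mathbf{0})$ are $\mathcal{A}$-equivalent if there exist germs of $C^\infty$-diffeomorphisms $d_s$ of $(\mathbb{R}^2,\mathbf{0})$ and $d_t$ of $(\mathbb{R}^3,\mathbf{0})$ such that $d_t\circ f_1=f_2\circ d_s$. Frontals: a $C^\infty$ map-germ $f:(\mathbb{R}^2,\mathbf{0})\to(\mathbb{R}^3,\mathbf{0})$ is a frontal if there exists a never-vanishing smooth vector field $\nu$ of $\mathbb{R}^3$ along $f$ such that $\langle df(X_p),\nu(p)\rangle=0$ for all $p\in\mathbb{R}^2$ near $\mathbf{0}$ and all $X_p\in T_p\mathbb{R}^2$, where $\langle\ ,\ \rangle$ is the canonical inner product of $\mathbb{R}^3$ (equivalently, $(f,[\nu])$ is an isotropic map into the projective tangent bundle of $\mathbb{R}^3$ with its canonical contact structure). Such a $\nu$ is called (a representative of) the normal vector of $f$; it is regarded as an $\mathbb{R}^3$-valued function on $(\mathbb{R}^2,\mathbf{0})$,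 so $d\nu$ makes sense. Non-degenerate singular points: let $\lambda(u,v)=\det(f_u,f_v,\nu)$, where $(u,v)$ are coordinates of $\mathbb{R}^2$ (the signed area density function). When $\mathbf{0}$ is a singular point of the frontal $f$, the set $S(f)$ of singular points of $f$ coincides near $\mathbf{0}$ with the zero set of $\lambda$; $\mathbf{0}$ is non-degenerate if $d\lambda(\mathbf{0})\neq 0$. In that case there is a regular curve $\gamma(t):((-\varepsilon,\varepsilon),0)\to(\mathbb{R}^2,\mathbf{0})$ whose image is $S(f)$, $\ker df_{\gamma(t)}$ is one-dimensional, and there is a smooth never-vanishing vector field $\eta(t)$ along $\gamma$ spanning $\ker df_{\gamma(t)}$, called the null vector field; $\eta(0)=\eta(\mathbf{0})$ denotes its value at $\gamma(0)=\mathbf{0}$ (the null vector at $\mathbf{0}$). Conditions (b)–(d) are understood with such $\gamma$ and $\eta$, which exist under (a). *)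

(* Defs.v *)
From HB Require Import structures.
From mathcomp Require Import all_boot all_order all_algebra.
From mathcomp Require Import all_classical all_reals all_analysis.

Set Implicit Arguments.
Unset Strict Implicit.
Unset Printing Implicit Defensive.

Import Order.TTheory GRing.Theory Num.Theory numFieldNormedType.Exports.

Local Open Scope classical_set_scope.
Local Open Scope ring_scope.

(* Map-germs are represented by total functions; every notion below only
   depends on the values of these functions near the base point. *)

Section Smooth.
Context {R : realType} {V W : normedModType R}.

(* f is of class C^n on U (meant for U open and V finite-dimensional, in which
   case differentiating along constant vectors is enough). *)
Fixpoint Cn_on (n : nat) (U : set V) (f : V -> W) : Prop :=
  if n is m.+1 then
    (forall x, U x -> differentiable f x) /\
    (forall v, Cn_on m U (fun x => 'd f x v))
  else forall x, U x -> {for x, continuous f}.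

Definition smooth_on (U : set V) (f : V -> W) : Prop :=
  forall n, Cn_on n U f.

Definition smooth_at (x : V) (f : V -> W) : Prop :=
  exists U : set V, [/\ open U, U x & smooth_on U f].

End Smooth.

Section AEquivalence.
Context {R : realType}.

Definition diffeo_germ n (d : 'rV[R]_n -> 'rV[R]_n) : Prop :=
  exists e : 'rV[R]_n -> 'rV[R]_n,
    [/\ smooth_at 0 d, smooth_at 0 e, d 0 = 0, e 0 = 0 &
        (\forall p \near (0 : 'rV[R]_n), e (d p) = p) /\
        (\forall p \near (0 : 'rV[R]_n), d (e p) = p)].

Definition A_equivalent (f1 f2 : 'rV[R]_2 -> 'rV[R]_3) : Prop :=
  exists (ds : 'rV[R]_2 -> 'rV[R]_2) (dt : 'rV[R]_3 -> 'rV[R]_3),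
    [/\ diffeo_germ ds, diffeo_germ dt &
        \forall p \near (0 : 'rV[R]_2), dt (f1 p) = f2 (ds p)].

(* Signs are booleans: true is +, false is -. *)
Definition signR (sigma : bool) : R := if sigma then 1 else -1.

Definition cuspidal_S (k : nat) (sigma : bool) (p : 'rV[R]_2) : 'rV[R]_3 :=
  let x := p 0 0 in
  let y := p 0 1 in
  \row_(i < 3)
    [:: x; y ^+ 2; y ^+ 3 * (x ^+ k.+1 + signR sigma * y ^+ 2)]`_i.

End AEquivalence.

Section Frontal.
Context {R : realType}.
Implicit Types (f nu : 'rV[R]_2 -> 'rV[R]_3) (gamma eta c : R -> 'rV[R]_2).

Definition dot n (v w : 'rV[R]_n) : R := \sum_i v 0 i * w 0 i.

Definition det2 (v w : 'rV[R]_2) : R :=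
  \det (\matrix_(i < 2) [:: v; w]`_i).

Definition det3 (u v w : 'rV[R]_3) : R :=
  \det (\matrix_(i < 3) [:: u; v; w]`_i).

Definition normal_vector f nu : Prop :=
  [/\ smooth_at 0 nu,
      (\forall p \near (0 : 'rV[R]_2), nu p != 0) &
      \forall p \near (0 : 'rV[R]_2), forall X, dot ('d f p X) (nu p) = 0].

Definition frontal f : Prop :=
  [/\ smooth_at 0 f, f 0 = 0 & exists nu, normal_vector f nu].

Definition singular_set f : set 'rV[R]_2 :=
  [set p | (\rank ('J f p) < 2)%N].

Definition signed_area_density f nu (p : 'rV[R]_2) : R :=
  det3 ('d f p (delta_mx 0 0)) ('d f p (delta_mx 0 1)) (nu p).

Definition nondegenerate_singular f nu : Prop :=
  singular_set f 0 /\ exists X, 'd (signed_area_density f nu) 0 X != 0.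

Definition singular_curve f gamma : Prop :=
  exists2 e : R, 0 < e &
    [/\ smooth_on `]-e, e[ gamma, gamma 0 = 0,
        (forall t, `]-e, e[%classic t -> derive1 gamma t != 0) &
        exists2 U : set 'rV[R]_2, nbhs (0 : 'rV[R]_2) U &
          gamma @` `]-e, e[ = singular_set f `&` U].

Definition null_vector_field f gamma eta : Prop :=
  [/\ smooth_at 0 eta,
      (\forall t \near (0 : R), eta t != 0) &
      \forall t \near (0 : R), forall X,
        'd f (gamma t) X = 0 <-> exists r, X = r *: eta t].

Definition singular_data f gamma eta : Prop :=
  singular_curve f gamma /\ null_vector_field f gamma eta.

(* The tangent line of S(f) at 0, spanned by gamma'(0), and the null vector
   together span the plane. *)
Definition null_transverse gamma eta : Prop :=
  row_full (col_mx (derive1 gamma 0) (eta 0)).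

Definition condition_a f nu gamma eta : Prop :=
  nondegenerate_singular f nu /\ null_transverse gamma eta.

Definition det_a f gamma c (l : R) : R :=
  let hc := f \o c in
  let hgamma := f \o gamma in
  det3 (derive1 hgamma 0) (derive1n 2 hc 0)
    (3 *: derive1n 5 hc 0 - (10 * l) *: derive1n 4 hc 0).

Definition condition_b f gamma eta c (l : R) : Prop :=
  let hc := f \o c in
  [/\ smooth_at 0 c /\ c 0 = 0,
      exists2 r : R, r != 0 & derive1 c 0 = r *: eta 0,
      derive1 hc 0 = 0 /\ derive1n 2 hc 0 != 0,
      derive1n 3 hc 0 = l *: derive1n 2 hc 0 &
      det_a f gamma c l != 0].

Definition psi f nu gamma eta (t : R) : R :=
  det3 (derive1 (f \o gamma) t) (nu (gamma t)) ('d nu (gamma t) (eta t)).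

Definition condition_c (k : nat) f nu gamma eta : Prop :=
  (forall j, (j < k)%N -> derive1n j (psi f nu gamma eta) 0 = 0) /\
  derive1n k (psi f nu gamma eta) 0 != 0.

(* Here gamma and eta are chosen anew according to the orientation
   conventions, c and l being those of condition_b. *)
Definition condition_d (k : nat) (sigma : bool) f nu c (l : R) : Prop :=
  ~~ odd k ->
  forall gamma eta, singular_data f gamma eta ->
    (exists2 r : R, 0 < r & derive1 c 0 = r *: eta 0) ->
    0 < det2 (derive1 gamma 0) (eta 0) ->
    Num.sg (det_a f gamma c l * derive1n k (psi f nu gamma eta) 0) = signR sigma.

End Frontal.

(* Main.v *)
(* Under (a), straightening the singular curve and the null field, dividing by
   y ^ 2 (Hadamard) and splitting the last component into its even and odd parts
   in y, an even smooth function being a smooth function of y ^ 2 (Whitney), puts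
   f in the form (x, y ^ 2, y ^ 3 B(x, y ^ 2)) up to diffeomorphisms.
   For such a germ psi(t) is a unit times B(x(t), 0), where x(t) is the first
   coordinate of gamma(t), so (c) says that B(x, 0) vanishes to order exactly k.
   If B(x, 0) vanishes to order at least two, then a is 720 dB/dw(0, 0) times
   nonzero factors, so (b) says that dB/dw(0, 0) is nonzero.  Then
   B(x, w) = x ^ k b(x) + w B1(x, w) with b(0) and B1(0, 0) nonzero; absorbing
   |b / B1| ^ (1/k) into x and B1 into the last target coordinate turns y ^ 3 B
   into y ^ 3 (x ^ k + sigma y ^ 2), where sigma is the sign of ab if k is even
   and can be chosen at will if k is odd.  Conversely the
   cuspidal S germ has this form with B = x ^ k + sigma w, and the curve
   c(s) = (0, s) satisfies (b) with l = 0. *)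
Require Import Defs.
From HB Require Import structures.
From mathcomp Require Import all_boot all_order all_algebra.
From mathcomp Require Import all_classical all_reals all_analysis.
From mathcomp Require Import ring lra.

Set Implicit Arguments.
Unset Strict Implicit.
Unset Printing Implicit Defensive.

Import Order.TTheory GRing.Theory Num.Theory numFieldNormedType.Exports.

Local Open Scope classical_set_scope.
Local Open Scope ring_scope.

(** * Calculus of smooth maps *)

(** Smoothness means iterated differentiability, so a function given by an integral or a series is
    shown smooth by placing it in a class of bounded functions closed under partial derivatives. For
    Hadamard's lemma the class consists of weighted averages, for Whitney's theorem of series of
    reflected values. Whitney's theorem is the main obstacle: an even function determines a function
    of w = y ^ 2 only for w >= 0, and its extension to w < 0 must match all derivatives at w = 0,
    smoothly in the parameter x. The coefficients 3 and -10 l in (b) are those for which the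
    nonlinear terms of a target diffeomorphism cancel, so that the combination transforms linearly.
    The bound k >= 2 gives B(x, 0) order at least two; as x has order s ^ 2 along the curve, B(x, 0)
    then contributes only beyond s ^ 5. In the product ab the Jacobian of the target diffeomorphism
    cancels, and for even k the source factors enter in even powers, up to positive constants; hence
    its sign is that of the product of the leading coefficients of B. *)

Section DiffExtra.
Context {R : realType} {V W : normedModType R}.

(** Explicit increments, rather than little-o terms, are what the mean value and Lipschitz estimates
    below produce. *)
Lemma is_diff_eps (f : V -> W) (L : {linear V -> W}) x :
  continuous L ->
  (forall e, 0 < e -> \forall h \near (0 : V),
     `|f (h + x) - f x - L h| <= e * `|h|) ->
  is_diff x f L.
Proof.
move=> cL fL.
have H : f \o shift x = cst (f x) + L +o_ 0 id.
  apply/eqaddoP => e e0; near=> h.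
  rewrite /= !fctE opprD addrA /=; near: h; exact: fL.
have dE := diff_unique cL H.
apply: DiffDef => //; apply/diff_locallyP; rewrite dE; split => //.
Unshelve. all: by end_near. Qed.

Lemma differentiable_eps (f : V -> W) x e : 0 < e -> differentiable f x ->
  \forall h \near (0 : V), `|f (h + x) - f x - 'd f x h| <= e * `|h|.
Proof.
move=> e0 /diff_locally/eqaddoP/(_ _ e0).
apply: filterS => h; rewrite /= !fctE opprD addrA; exact.
Qed.

Lemma near_eq_differentiable (f g : V -> W) x :
  (\forall y \near x, f y = g y) -> differentiable f x ->
  differentiable g x /\ ('d g x = 'd f x :> (V -> W)).
Proof.
move=> fg df.
have [] : is_diff x g ('d f x); last by [].
apply: is_diff_eps => [|e e0]; first exact: diff_continuous.
rewrite -(nbhs_singleton fg); near=> h.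
have <- : f (h + x) = g (h + x).
  near: h; move: fg; rewrite (near_shift 0 x) /= => fg.
  by apply: filterS fg => y /=; rewrite subr0.
near: h; exact: differentiable_eps.
Unshelve. all: by end_near. Qed.

End DiffExtra.

Section CnOn.
Context {R : realType}.
Implicit Types V W : normedModType R.

Lemma Cn_on_sub V W n (U U' : set V) (f : V -> W) :
  U' `<=` U -> Cn_on n U f -> Cn_on n U' f.
Proof.
move=> UU'; elim: n f => [|n IH] f /=; first by move=> H x /UU'; exact: H.
by case=> H1 H2; split => [x /UU'|v]; [exact: H1|exact: IH].
Qed.

Lemma eq_Cn_on V W n (U : set V) (f g : V -> W) :
  open U -> (forall x, U x -> f x = g x) -> Cn_on n U f -> Cn_on n U g.
Proof.
move=> oU; elim: n f g => [|n IH] f g fg /=.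
  move=> H x Ux; have := H x Ux; rewrite /prop_for /continuous_at -(fg _ Ux).
  move=> ct; apply: cvg_trans ct; apply: near_eq_cvg.
  by apply: filterS (open_nbhs_nbhs (conj oU Ux)) => y; exact: fg.
have near_fg x : U x -> \forall y \near x, f y = g y.
  by move=> Ux; apply: filterS (open_nbhs_nbhs (conj oU Ux)) => y; exact: fg.
case=> H1 H2; split=> [x Ux|v].
  by have [] := near_eq_differentiable (near_fg _ Ux) (H1 _ Ux).
apply: IH (H2 v) => x Ux.
by have [_ ->] := near_eq_differentiable (near_fg _ Ux) (H1 _ Ux).
Qed.

Lemma Cn_onW V W n (U : set V) (f : V -> W) : Cn_on n.+1 U f -> Cn_on n U f.
Proof.
elim: n f => [|n IH] f /=.
  by case=> H _ x Ux; apply/differentiable_continuous/H.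
by case=> H1 H2; split => // v; apply: IH; apply: H2.
Qed.

Lemma Cn_on_cst V W n (U : set V) (c : W) : Cn_on n U (cst c : V -> W).
Proof.
elim: n c => [|n IH] c /=; first by move=> x _; exact: cvg_cst.
split=> // v.
rewrite (_ : (fun x => _) = cst 0) //.
by apply/funext => x; rewrite diff_cst.
Qed.

Lemma Cn_on_linear V W n (U : set V) (L : {linear V -> W}) :
  continuous L -> Cn_on n U L.
Proof.
case: n => [|n] cL /=; first by move=> x _; exact: cL.
split=> [x _|v]; first exact: linear_differentiable.
rewrite (_ : (fun x => _) = cst (L v)); first exact: Cn_on_cst.
by apply/funext => x; rewrite diff_lin.
Qed.

Lemma Cn_onD V W n (U : set V) (f g : V -> W) : open U ->
  Cn_on n U f -> Cn_on n U g -> Cn_on n U (fun x => f x + g x).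
Proof.
move=> oU; elim: n f g => [|n IH] f g /=.
  by move=> Hf Hg x Ux; apply: cvgD; [exact: Hf|exact: Hg].
move=> [f1 f2] [g1 g2]; split=> [x Ux|v].
  by apply: (differentiableD (f1 _ Ux) (g1 _ Ux)).
apply: eq_Cn_on (IH _ _ (f2 v) (g2 v)) => // x Ux.
by apply/esym; exact: (congr1 (fun h => h v) (diffD (f1 _ Ux) (g1 _ Ux))).
Qed.

Lemma Cn_on_linear_comp V W W' n (U : set V) (f : V -> W)
    (L : {linear W -> W'}) : open U ->
  continuous L -> Cn_on n U f -> Cn_on n U (fun x => L (f x)).
Proof.
move=> oU cL; elim: n f => [|n IH] f /=.
  move=> Hf x Ux; apply: (@continuous_comp _ _ _ f L); first exact: Hf.
  exact: cL.
move=> [f1 f2].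
have dL y : differentiable L y by exact: linear_differentiable.
split=> [x Ux|v]; first exact: (differentiable_comp (f1 _ Ux) (dL _)).
apply: eq_Cn_on (IH _ (f2 v)) => // x Ux.
apply/esym; transitivity ('d L (f x) ('d f x v)); last by rewrite diff_lin.
exact: (congr1 (fun h => h v) (diff_comp (f1 _ Ux) (dL _))).
Qed.

Lemma Cn_onZl V W n (U : set V) (a : V -> R) (w : W) : open U ->
  Cn_on n U a -> Cn_on n U (fun x => a x *: w).
Proof.
move=> oU; elim: n a => [|n IH] a /=.
  by move=> Hf x Ux; apply: cvgZr_tmp; exact: Hf.
move=> [f1 f2]; split=> [x Ux|v]; first exact: differentiableZl (f1 _ Ux).
apply: eq_Cn_on (IH _ (f2 v)) => // x Ux.
by apply/esym; exact: (congr1 (fun h => h v) (diffZl w (f1 _ Ux))).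
Qed.

Lemma Cn_onM V n (U : set V) (f g : V -> R) : open U ->
  Cn_on n U f -> Cn_on n U g -> Cn_on n U (fun x => f x * g x).
Proof.
move=> oU; elim: n f g => [|n IH] f g.
  by move=> Hf Hg x Ux; apply: cvgM; [exact: Hf|exact: Hg].
move=> Hf Hg; case: (Hf) (Hg) => [f1 f2] [g1 g2]; split=> [x Ux|v].
  by apply: (differentiableM (f1 _ Ux) (g1 _ Ux)).
(* The product rule multiplies an undifferentiated factor, lowered from class [n.+1] to class [n],
   by a derivative of class [n]. *)
have := Cn_onD oU (IH _ _ (Cn_onW Hf) (g2 v)) (IH _ _ (Cn_onW Hg) (f2 v)).
apply: eq_Cn_on => // x Ux.
by apply/esym; exact: (congr1 (fun h => h v) (diffM (f1 _ Ux) (g1 _ Ux))).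
Qed.

Lemma Cn_on_sum V W n (U : set V) I (r : seq I) (P : pred I) (F : I -> V -> W) :
  open U -> (forall i, P i -> Cn_on n U (F i)) ->
  Cn_on n U (fun x => \sum_(i <- r | P i) F i x).
Proof.
move=> oU FP; elim: r => [|i r IH].
  rewrite (_ : (fun x => _) = cst 0); first exact: Cn_on_cst.
  by apply/funext => x; rewrite big_nil.
case: (boolP (P i)) => Pi.
  apply: eq_Cn_on (Cn_onD oU (FP _ Pi) IH) => // x _.
  by rewrite big_cons Pi.
by apply: eq_Cn_on IH => // x _; rewrite big_cons (negbTE Pi).
Qed.

Lemma Cn_on_prod V n (U : set V) I (r : seq I) (F : I -> V -> R) :
  open U -> (forall i, Cn_on n U (F i)) ->
  Cn_on n U (fun x => \prod_(i <- r) F i x).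
Proof.
move=> oU FP; elim: r => [|i r IH].
  rewrite (_ : (fun x => _) = cst 1); first exact: Cn_on_cst.
  by apply/funext => x; rewrite big_nil.
by apply: eq_Cn_on (Cn_onM oU (FP i) IH) => // x _; rewrite big_cons.
Qed.

(** In the derivative ['d g (f x) ('d f x v)] both the base point and the direction depend on [x].
    Expanding the direction in a finite basis leaves the functions ['d g y (b i)] with fixed
    directions, to which the induction hypothesis applies. *)
Lemma Cn_on_comp_coord V V' n m (U : set V) (U' : set V') (f : V -> V')
    (g : V' -> R) (b : 'I_m -> V') (l : 'I_m -> {linear V' -> R}) :
  (forall i, continuous (l i)) -> (forall v, v = \sum_i l i v *: b i) ->
  open U -> open U' -> (forall x, U x -> U' (f x)) ->
  Cn_on n U f -> Cn_on n U' g -> Cn_on n U (fun x => g (f x)).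
Proof.
move=> cl bl oU oU' UU'; elim: n f g UU' => [|n IH] f g UU'.
  move=> Hf Hg x Ux; apply: (@continuous_comp _ _ _ f g); first exact: Hf.
  by apply: Hg; apply: UU'.
move=> Hf Hg; case: (Hf) (Hg) => [f1 f2] [g1 g2]; split=> [x Ux|v].
  exact: (differentiable_comp (f1 _ Ux) (g1 _ (UU' _ Ux))).
have H : Cn_on n U
    (fun x => \sum_i l i ('d f x v) * 'd g (f x) (b i)).
  apply: Cn_on_sum => // i _; apply: Cn_onM => //.
    exact: (Cn_on_linear_comp oU (cl i) (f2 v)).
  exact: (IH f (fun y => 'd g y (b i)) UU' (Cn_onW Hf) (g2 (b i))).
apply: eq_Cn_on H => // x Ux.
apply/esym; transitivity ('d g (f x) ('d f x v)).
  exact: (congr1 (fun h => h v) (diff_comp (f1 _ Ux) (g1 _ (UU' _ Ux)))).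
rewrite [in LHS](bl ('d f x v)) linear_sum; apply: eq_bigr => i _.
by rewrite linearZ.
Qed.

Lemma Cn_onV V n (U : set V) (f : V -> R) : open U ->
  (forall x, U x -> f x != 0) ->
  Cn_on n U f -> Cn_on n U (fun x => (f x)^-1).
Proof.
move=> oU f0; elim: n => [|n IH].
  by move=> Hf x Ux; apply: cvgV; [exact: f0|exact: Hf].
move=> Hf; case: (Hf) => [f1 f2]; split=> [x Ux|v].
  by apply: differentiableV; [exact: f1|exact: f0].
have H := IH (Cn_onW Hf).
have := Cn_onM oU (Cn_on_cst n U (-1 : R)) (Cn_onM oU (Cn_onM oU H H) (f2 v)).
apply: eq_Cn_on => // x Ux.
apply/esym; transitivity ((- (f x) ^- 2 \*: 'd f x) v).
  exact: (congr1 (fun h => h v) (diffV (f1 _ Ux) (f0 _ Ux))).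
by rewrite -[LHS]/(- f x ^- 2 * 'd f x v) mulN1r -invfM -expr2 -mulNr.
Qed.

(** The induction is over all exponents at once, since each derivative lowers the exponent by
    one. *)
Lemma Cn_on_powR V n (U : set V) (f : V -> R) (a : R) : open U ->
  (forall x, U x -> 0 < f x) ->
  Cn_on n U f -> Cn_on n U (fun x => powR (f x) a).
Proof.
move=> oU f0; elim: n a => [|n IH] a.
  move=> Hf x Ux.
  apply: (@continuous_comp V R R f (fun y : R => powR y a) x (Hf x Ux)).
  apply/differentiable_continuous/derivable1_diffP.
  by have [] := is_derive1_powR a (f0 _ Ux).
move=> Hf; case: (Hf) => [f1 f2].
have dp x : U x -> is_diff (f x) (fun y => powR y a)
    (fun h => h * (a * powR (f x) (a - 1))).
  move=> Ux; have dd := is_derive1_powR a (f0 _ Ux).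
  apply: DiffDef; first by apply/derivable1_diffP; case: dd.
  apply/funext => h; rewrite deriv1E; last by case: dd.
  by rewrite derive1E; have -> := @derive_val _ _ _ _ _ _ _ dd.
split=> [x Ux|v].
  apply: (@differentiable_comp _ _ _ _ f (fun y => powR y a)) => //.
  exact: f1.
  by have [] := dp x Ux.
have := Cn_onM oU (f2 v) (Cn_onM oU (Cn_on_cst n U a) (IH (a - 1) (Cn_onW Hf))).
apply: eq_Cn_on => // x Ux; have [d1 d2] := dp x Ux.
apply/esym; transitivity ('d (fun y => powR y a) (f x) ('d f x v)).
  exact: (congr1 (fun h => h v) (diff_comp (f1 _ Ux) d1)).
by rewrite d2.
Qed.

End CnOn.

Section SmoothAt.
Context {R : realType}.
Implicit Types V W : normedModType R.

Lemma nbhs_open_sub V (x : V) (P : set V) : nbhs x P ->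
  exists U, [/\ open U, U x & U `<=` P].
Proof.
by move=> nP; exists P°; split; [exact: open_interior|exact: nP|exact: interior_subset].
Qed.

Lemma smooth_at_near V W (x : V) (f : V -> W) : smooth_at x f ->
  \forall y \near x, smooth_at y f.
Proof.
move=> [U [oU Ux sU]]; apply: filterS (open_nbhs_nbhs (conj oU Ux)) => y Uy.
by exists U.
Qed.

Lemma smooth_at_eq V W (x : V) (f g : V -> W) :
  (\forall y \near x, f y = g y) -> smooth_at x f -> smooth_at x g.
Proof.
move=> fg [U [oU Ux sU]].
have [U' [oU' U'x H]] := nbhs_open_sub fg.
exists (U `&` U'); split => //; first exact: openI.
move=> n; apply: (@eq_Cn_on _ _ _ n _ f); first exact: openI.
  by move=> y [_ /H].
by apply: Cn_on_sub (sU n) => y [].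
Qed.

Lemma smooth_at_diff V W (x : V) (f : V -> W) :
  smooth_at x f -> differentiable f x.
Proof. by move=> [U [oU Ux /(_ 1%N) [H _]]]; exact: H. Qed.

Lemma smooth_at_cont V W (x : V) (f : V -> W) :
  smooth_at x f -> {for x, continuous f}.
Proof. by move=> /smooth_at_diff/differentiable_continuous. Qed.

Lemma smooth_at_d V W (x : V) (f : V -> W) v :
  smooth_at x f -> smooth_at x (fun y => 'd f y v).
Proof. by move=> [U [oU Ux H]]; exists U; split => // n; have [_] := H n.+1; exact. Qed.

Lemma smooth_at_cst V W (x : V) (c : W) : smooth_at x (fun _ : V => c).
Proof. by exists setT; split=> //; [exact: openT|move=> n; exact: Cn_on_cst]. Qed.

Lemma smooth_at_linear V W (L : {linear V -> W}) x : continuous L -> smooth_at x L.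
Proof.
by move=> cL; exists setT; split=> //; [exact: openT|move=> n; exact: Cn_on_linear].
Qed.

Lemma smooth_at_id V x : smooth_at x (fun y : V => y).
Proof.
apply: (@smooth_at_linear V V idfun x) => y; exact: cvg_id.
Qed.

Lemma smooth_at2 V W1 W2 W3 x (f : V -> W1) (g : V -> W2) (h : V -> W3) :
  (forall n U, open U -> Cn_on n U f -> Cn_on n U g -> Cn_on n U h) ->
  smooth_at x f -> smooth_at x g -> smooth_at x h.
Proof.
move=> H [U [oU Ux sU]] [U' [oU' U'x sU']]; exists (U `&` U').
split=> //; first exact: openI.
move=> n; apply: H; first exact: openI.
  by apply: Cn_on_sub (sU n) => y [].
by apply: Cn_on_sub (sU' n) => y [].
Qed.

Lemma smooth_atD V W x (f g : V -> W) : smooth_at x f -> smooth_at x g ->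
  smooth_at x (fun y => f y + g y).
Proof. by apply: smooth_at2 => n U oU; exact: Cn_onD. Qed.

Lemma smooth_atM V x (f g : V -> R) : smooth_at x f -> smooth_at x g ->
  smooth_at x (fun y => f y * g y).
Proof. by apply: smooth_at2 => n U oU; exact: Cn_onM. Qed.

Lemma smooth_atZl V W x (a : V -> R) (w : W) : smooth_at x a ->
  smooth_at x (fun y => a y *: w).
Proof. by move=> ha; apply: (smooth_at2 _ ha ha) => n U oU h _; exact: Cn_onZl. Qed.

Lemma smooth_at_linear_comp V W W' (L : {linear W -> W'}) x (f : V -> W) :
  continuous L -> smooth_at x f -> smooth_at x (fun y => L (f y)).
Proof.
move=> cL hf; apply: (smooth_at2 _ hf hf) => n U oU h _.
exact: Cn_on_linear_comp.
Qed.

Lemma smooth_atN V W x (f : V -> W) : smooth_at x f ->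
  smooth_at x (fun y => - f y).
Proof.
apply: (@smooth_at_linear_comp V W W (-%R : {linear W -> W})).
by move=> y; apply: opp_continuous.
Qed.

Lemma smooth_atB V W x (f g : V -> W) : smooth_at x f -> smooth_at x g ->
  smooth_at x (fun y => f y - g y).
Proof. by move=> hf hg; apply: smooth_atD => //; exact: smooth_atN. Qed.

Lemma smooth_atX V x (f : V -> R) n : smooth_at x f ->
  smooth_at x (fun y => f y ^+ n).
Proof.
move=> hf; elim: n => [|n IH]; first exact: smooth_at_cst.
by apply: smooth_at_eq (smooth_atM hf IH); apply: nearW => y; rewrite exprS.
Qed.

Lemma smooth_at_sum V W x I (r : seq I) (F : I -> V -> W) :
  (forall i, smooth_at x (F i)) -> smooth_at x (fun y => \sum_(i <- r) F i y).
Proof.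
move=> H; elim: r => [|i r IH].
  by apply: smooth_at_eq (smooth_at_cst x 0); apply: nearW => y; rewrite big_nil.
by apply: smooth_at_eq (smooth_atD (H i) IH); apply: nearW => y; rewrite big_cons.
Qed.

Lemma smooth_at_prod V x I (r : seq I) (F : I -> V -> R) :
  (forall i, smooth_at x (F i)) -> smooth_at x (fun y => \prod_(i <- r) F i y).
Proof.
move=> H; elim: r => [|i r IH].
  by apply: smooth_at_eq (smooth_at_cst x (1 : R)); apply: nearW => y; rewrite big_nil.
by apply: smooth_at_eq (smooth_atM (H i) IH); apply: nearW => y; rewrite big_cons.
Qed.

Lemma smooth_atV V x (f : V -> R) : smooth_at x f -> f x != 0 ->
  smooth_at x (fun y => (f y)^-1).
Proof.
move=> hf f0; have cf := smooth_at_cont hf.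
have [U [oU Ux sU]] := hf.
have [U' [oU' U'x H]] := nbhs_open_sub (cvgr_neq0 _ cf f0).
exists (U `&` U'); split=> //; first exact: openI.
move=> n; apply: Cn_onV; first exact: openI.
  by move=> y [_ /H].
by apply: Cn_on_sub (sU n) => y [].
Qed.

Lemma smooth_at_powR V x (f : V -> R) a : smooth_at x f -> 0 < f x ->
  smooth_at x (fun y => powR (f y) a).
Proof.
move=> hf f0; have cf := smooth_at_cont hf.
have [U [oU Ux sU]] := hf.
have [U' [oU' U'x H]] := nbhs_open_sub (cvgr_gt _ cf _ f0).
exists (U `&` U'); split=> //; first exact: openI.
move=> n; apply: Cn_on_powR; first exact: openI.
  by move=> y [_ /H].
by apply: Cn_on_sub (sU n) => y [].
Qed.

Lemma smooth_at_comp_coord V V' m (x : V) (f : V -> V')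
    (g : V' -> R) (b : 'I_m -> V') (l : 'I_m -> {linear V' -> R}) :
  (forall i, continuous (l i)) -> (forall v, v = \sum_i l i v *: b i) ->
  smooth_at x f -> smooth_at (f x) g -> smooth_at x (fun y => g (f y)).
Proof.
move=> cl bl hf [U' [oU' U'x sU']].
have cf := smooth_at_cont hf.
have [U [oU Ux sU]] := hf.
have [U2 [oU2 U2x H]] := nbhs_open_sub (cf _ (open_nbhs_nbhs (conj oU' U'x))).
exists (U `&` U2); split=> //; first exact: openI.
move=> n; apply: (Cn_on_comp_coord cl bl _ oU' _ _ (sU' n)).
- exact: openI.
- by move=> y [_ /H].
- by apply: Cn_on_sub (sU n) => y [].
Qed.

Lemma smooth_at_compR V (x : V) (f : V -> R) (g : R -> R) :
  smooth_at x f -> smooth_at (f x) g -> smooth_at x (fun y => g (f y)).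
Proof.
apply: (@smooth_at_comp_coord V R 1 x f g (fun=> 1) (fun=> idfun : {linear R -> R})).
  by move=> _ y; exact: cvg_id.
by move=> v; rewrite big_ord1 /= [RHS]mulr1.
Qed.

Section Coord.
Context {m : nat} (i : 'I_m).
(** Coordinates are bundled as linear maps so that the rules for linear maps and for basis
    expansions apply to them. *)
Definition coord_fun (v : 'rV[R]_m) : R := v 0 i.
Lemma coord_fun_is_linear : linear coord_fun.
Proof. by move=> a u v; rewrite /coord_fun !mxE. Qed.
HB.instance Definition _ := GRing.isLinear.Build R 'rV[R]_m R _ coord_fun
  coord_fun_is_linear.
End Coord.

Lemma smooth_at_rowP V m (x : V) (f : V -> 'rV[R]_m.+1) :
  smooth_at x f <-> forall i, smooth_at x (fun y => f y 0 i).
Proof.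
split=> [hf i|hf].
  apply: (smooth_at_linear_comp (L := coord_fun i : {linear _ -> _}) _ hf).
  by move=> y; exact: coord_continuous.
have H i := smooth_atZl (delta_mx 0 i : 'rV[R]_m.+1) (hf i).
apply: smooth_at_eq (smooth_at_sum (index_enum _) H); apply: nearW => y.
by rewrite -row_sum_delta.
Qed.

Lemma smooth_at_comp_scalar V m (x : V) (f : V -> 'rV[R]_m.+1) (g : 'rV[R]_m.+1 -> R) :
  smooth_at x f -> smooth_at (f x) g -> smooth_at x (fun y => g (f y)).
Proof.
apply: (@smooth_at_comp_coord V _ m.+1 x f g (fun i => delta_mx 0 i)
   (fun i => coord_fun i : {linear _ -> _})).
  by move=> i y; exact: coord_continuous.
by move=> v; rewrite {1}(row_sum_delta v).
Qed.

Lemma smooth_at_comp V m k (x : V) (f : V -> 'rV[R]_m.+1)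
    (g : 'rV[R]_m.+1 -> 'rV[R]_k.+1) :
  smooth_at x f -> smooth_at (f x) g -> smooth_at x (fun y => g (f y)).
Proof.
move=> hf /smooth_at_rowP hg; apply/smooth_at_rowP => i.
exact: (smooth_at_comp_scalar (g := fun z => g z 0 i)).
Qed.

Lemma smooth_at_comp_curve V k (x : V) (f : V -> R) (g : R -> 'rV[R]_k.+1) :
  smooth_at x f -> smooth_at (f x) g -> smooth_at x (fun y => g (f y)).
Proof.
move=> hf /smooth_at_rowP hg; apply/smooth_at_rowP => i.
exact: (smooth_at_compR (g := fun z => g z 0 i)).
Qed.

Lemma smooth_at_coord m (i : 'I_m.+1) (x : 'rV[R]_m.+1) : smooth_at x (fun v => v 0 i).
Proof. by have /smooth_at_rowP := smooth_at_id x. Qed.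

Lemma smooth_at_det V m (x : V) (A : V -> 'M[R]_m) :
  (forall i j, smooth_at x (fun y => A y i j)) -> smooth_at x (fun y => \det (A y)).
Proof.
move=> H; apply: smooth_at_sum => s; apply: smooth_atM.
  exact: smooth_at_cst.
by apply: smooth_at_prod => i.
Qed.

Lemma d_comp V V' W (f : V -> V') (g : V' -> W) x v :
  differentiable f x -> differentiable g (f x) ->
  'd (fun y => g (f y)) x v = 'd g (f x) ('d f x v).
Proof. by move=> df dg; exact: (congr1 (fun h => h v) (diff_comp df dg)). Qed.

Lemma d_add V W (f g : V -> W) x v : differentiable f x -> differentiable g x ->
  'd (fun y => f y + g y) x v = 'd f x v + 'd g x v.
Proof. by move=> df dg; exact: (congr1 (fun h => h v) (diffD df dg)). Qed.

Lemma d_opp V W (f : V -> W) x v : differentiable f x ->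
  'd (fun y => - f y) x v = - 'd f x v.
Proof. by move=> df; exact: (congr1 (fun h => h v) (diffN df)). Qed.

Lemma d_mul V (f g : V -> R) x v : differentiable f x -> differentiable g x ->
  'd (fun y => f y * g y) x v = f x * 'd g x v + g x * 'd f x v.
Proof. by move=> df dg; exact: (congr1 (fun h => h v) (diffM df dg)). Qed.

Lemma d_cst V W (c : W) (x v : V) : 'd (fun _ : V => c) x v = 0.
Proof. by have /= := congr1 (fun h => h v) (@diff_cst _ V W c x). Qed.

Lemma d_id V (x v : V) : 'd (fun y : V => y) x v = v.
Proof.
by have [_ /(congr1 (fun h => h v))] := @is_diff_id _ V x.
Qed.

Lemma d_near V W (f g : V -> W) x v : (\forall y \near x, f y = g y) ->
  differentiable f x -> 'd f x v = 'd g x v.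
Proof. by move=> fg df; have [_ ->] := near_eq_differentiable fg df. Qed.

Lemma d_row V m (f : V -> 'rV[R]_m.+1) x v i : differentiable f x ->
  ('d f x v) 0 i = 'd (fun y => f y 0 i) x v.
Proof.
move=> df; have cl : continuous (coord_fun i : {linear 'rV[R]_m.+1 -> R}).
  by move=> y; exact: coord_continuous.
apply/esym; rewrite (@d_comp _ _ _ f (coord_fun i)) //.
  by rewrite diff_lin.
exact: linear_differentiable.
Qed.

Lemma d_coord m (i : 'I_m.+1) (x v : 'rV[R]_m.+1) : 'd (fun y => y 0 i) x v = v 0 i.
Proof. by rewrite -d_row ?d_id //; exact: (smooth_at_diff (smooth_at_id x)). Qed.

Lemma d_sum_basis m W (f : 'rV[R]_m.+1 -> W) x v :
  'd f x v = \sum_i v 0 i *: 'd f x (delta_mx 0 i).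
Proof.
rewrite {1}(row_sum_delta v) linear_sum; apply: eq_bigr => i _.
by rewrite linearZ.
Qed.

Lemma derive1_d W (f : R -> W) x : differentiable f x -> derive1 f x = 'd f x 1.
Proof. by move=> df; rewrite derive1E'. Qed.

Lemma d_derive1 W (f : R -> W) x v : differentiable f x -> 'd f x v = v *: derive1 f x.
Proof.
move=> df; rewrite derive1_d // -linearZ /=; congr ('d f x _).
by rewrite -[RHS]/(v * 1) mulr1.
Qed.

Lemma smooth_at_derive1 W (x : R) (f : R -> W) : smooth_at x f -> smooth_at x (derive1 f).
Proof.
move=> hf; apply: smooth_at_eq (smooth_at_d (1 : R) hf).
by apply: filterS (smooth_at_near hf) => y /smooth_at_diff h; rewrite derive1_d.
Qed.

End SmoothAt.

(** * Row vectors of length two and three, and boxes in the plane *)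

Section Rows.
Context {R : realType}.

Definition row2 (x y : R) : 'rV[R]_2 := \row_i [:: x; y]`_i.
Definition row3 (x y z : R) : 'rV[R]_3 := \row_i [:: x; y; z]`_i.
Definition uncur (F : R -> R -> R) (p : 'rV[R]_2) : R := F (p 0 0) (p 0 1).
Definition box (r : R) : set 'rV[R]_2 := [set p | `|p 0 0| < r /\ `|p 0 1| < r].

Lemma row2_0 x y : row2 x y 0 0 = x. Proof. by rewrite mxE. Qed.
Lemma row2_1 x y : row2 x y 0 1 = y. Proof. by rewrite mxE. Qed.
Lemma row3_0 x y z : row3 x y z 0 0 = x. Proof. by rewrite mxE. Qed.
Lemma row3_1 x y z : row3 x y z 0 1 = y. Proof. by rewrite mxE. Qed.
Lemma row3_2 x y z : row3 x y z 0 2 = z. Proof. by rewrite mxE. Qed.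
Definition rcE := (row2_0, row2_1, row3_0, row3_1, row3_2).

Lemma ord2P (P : 'I_2 -> Prop) : P 0 -> P 1 -> forall i, P i.
Proof.
by move=> P0 P1 [[|[|//]] Hi]; [have -> : Ordinal Hi = 0|have -> : Ordinal Hi = 1];
  by [apply/val_inj|].
Qed.

Lemma ord3P (P : 'I_3 -> Prop) : P 0 -> P 1 -> P 2 -> forall i, P i.
Proof.
move=> P0 P1 P2 [[|[|[|//]]] Hi];
  [have -> : Ordinal Hi = 0|have -> : Ordinal Hi = 1|have -> : Ordinal Hi = 2];
  by [apply/val_inj|].
Qed.

Lemma row2K (p : 'rV[R]_2) : row2 (p 0 0) (p 0 1) = p.
Proof. by apply/rowP; apply: ord2P; rewrite !rcE. Qed.

Lemma row20 : row2 0 0 = 0.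
Proof. by apply/rowP; apply: ord2P; rewrite !rcE mxE. Qed.

Lemma row30 : row3 0 0 0 = 0.
Proof. by apply/rowP; apply: ord3P; rewrite !rcE mxE. Qed.

Lemma delta2_0 : delta_mx 0 0 = row2 1 0.
Proof. by apply/rowP; apply: ord2P; rewrite !rcE mxE. Qed.

Lemma delta2_1 : delta_mx 0 1 = row2 0 1.
Proof. by apply/rowP; apply: ord2P; rewrite !rcE mxE. Qed.

Lemma norm_row_le m (v : 'rV[R]_m) (r : R) : 0 <= r ->
  `|v| <= r <-> forall i, `|v 0 i| <= r.
Proof.
move=> r0; rewrite [X in X <= r]mx_normrE; split=> [/bigmax_leP[_ H] i|H].
  exact: (H (0, i)).
by apply/bigmax_leP; split=> // -[j i] _ /=; rewrite ord1.
Qed.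

Lemma near0_norm_le (V : normedModType R) (e : R) : 0 < e ->
  \forall h \near (0 : V), `|h| <= e.
Proof.
move=> e0; apply/nbhs_ballP; exists e => // h.
by rewrite -ball_normE /= sub0r normrN => /ltW.
Qed.

Lemma norm_coord_le m (v : 'rV[R]_m) i : `|v 0 i| <= `|v|.
Proof. by move: i; apply/(norm_row_le v (normr_ge0 v)). Qed.

Lemma norm_row2_le (x y r : R) : `|x| <= r -> `|y| <= r -> `|row2 x y| <= r.
Proof.
move=> hx hy; have r0 : 0 <= r by apply: le_trans hx.
by apply/(norm_row_le _ r0); apply: ord2P; rewrite rcE.
Qed.

Lemma ball0_box (r : R) : ball (0 : 'rV[R]_2) r = box r.
Proof.
rewrite -ball_normE; apply/seteqP; split=> p /=; rewrite sub0r normrN.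
  by move=> H; split; apply: le_lt_trans H; exact: norm_coord_le.
move=> [h0 h1]; pose s := Num.max `|p 0 0| `|p 0 1|.
have sr : s < r by rewrite /s gt_max h0.
apply: le_lt_trans sr; rewrite -(row2K p).
by apply: norm_row2_le; rewrite ?rcE /s le_max lexx ?orbT.
Qed.

Lemma open_box (r : R) : open (box r).
Proof.
have [r0|r0] := ltP 0 r; last first.
  rewrite (_ : box r = set0); first exact: open0.
  apply/seteqP; split=> // p [h _].
  by have := le_lt_trans (normr_ge0 _) h; rewrite ltNge r0.
by rewrite -ball0_box; apply: ball_open.
Qed.

Lemma nbhs0_box (P : set 'rV[R]_2) : nbhs (0 : 'rV[R]_2) P ->
  exists2 r, 0 < r & box r `<=` P.
Proof. by move=> /nbhs_ballP [r r0 H]; exists r => //; rewrite -ball0_box. Qed.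

Lemma box_nbhs0 (r : R) : 0 < r -> nbhs (0 : 'rV[R]_2) (box r).
Proof. by move=> r0; rewrite -ball0_box; exact: nbhsx_ballx. Qed.

Lemma smooth_at_row2 (V : normedModType R) x (a b : V -> R) :
  smooth_at x a -> smooth_at x b -> smooth_at x (fun y => row2 (a y) (b y)).
Proof.
move=> ha hb; apply/smooth_at_rowP; apply: ord2P.
  by apply: smooth_at_eq ha; apply: nearW => y; rewrite rcE.
by apply: smooth_at_eq hb; apply: nearW => y; rewrite rcE.
Qed.

Lemma smooth_at_row3 (V : normedModType R) x (a b c : V -> R) :
  smooth_at x a -> smooth_at x b -> smooth_at x c ->
  smooth_at x (fun y => row3 (a y) (b y) (c y)).
Proof.
move=> ha hb hc; apply/smooth_at_rowP; apply: ord3P.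
- by apply: smooth_at_eq ha; apply: nearW => y; rewrite rcE.
- by apply: smooth_at_eq hb; apply: nearW => y; rewrite rcE.
- by apply: smooth_at_eq hc; apply: nearW => y; rewrite rcE.
Qed.

Lemma d_row2 (V : normedModType R) x v (a b : V -> R) :
  smooth_at x a -> smooth_at x b ->
  'd (fun y => row2 (a y) (b y)) x v = row2 ('d a x v) ('d b x v).
Proof.
move=> ha hb; have dd := smooth_at_diff (smooth_at_row2 ha hb).
apply/rowP; apply: ord2P; rewrite (d_row _ _ dd) rcE;
  by congr ('d _ x v); apply/funext => y; rewrite rcE.
Qed.

Lemma d_row3 (V : normedModType R) x v (a b c : V -> R) :
  smooth_at x a -> smooth_at x b -> smooth_at x c ->
  'd (fun y => row3 (a y) (b y) (c y)) x v =
    row3 ('d a x v) ('d b x v) ('d c x v).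
Proof.
move=> ha hb hc; have dd := smooth_at_diff (smooth_at_row3 ha hb hc).
apply/rowP; apply: ord3P; rewrite (d_row _ _ dd) rcE;
  by congr ('d _ x v); apply/funext => y; rewrite rcE.
Qed.

Lemma is_derive_d (W : normedModType R) (f : R -> W) x :
  differentiable f x -> is_derive x 1 f ('d f x 1).
Proof.
move=> df; apply: DeriveDef; first exact: diff_derivable.
by rewrite deriveE.
Qed.

Lemma is_derive_curve (f : 'rV[R]_2 -> R) (a b : R -> R) t :
  differentiable f (row2 (a t) (b t)) -> smooth_at t a -> smooth_at t b ->
  is_derive t 1 (fun s => f (row2 (a s) (b s)))
    ('d f (row2 (a t) (b t)) (row2 ('d a t 1) ('d b t 1))).
Proof.
move=> df ha hb; have dd := smooth_at_diff (smooth_at_row2 ha hb).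
rewrite -d_row2 // -(d_comp _ dd df).
by apply: is_derive_d; exact: (differentiable_comp dd df).
Qed.

End Rows.

(** * Smoothness from closure under partial derivatives *)

Section BoxCoinduction.
Context {R : realType}.
Implicit Types F G : R -> R -> R.

Lemma norm_lt_between (r x y t : R) :
  `|x| < r -> `|y| < r -> x <= t <= y -> `|t| < r.
Proof. rewrite !ltr_norml => /andP[? ?] /andP[? ?] /andP[? ?]; lra. Qed.

(** The endpoints are not ordered, and the intermediate point is kept within [|y - x|] of [x], which
    is the form that the Lipschitz estimates use. *)
Lemma MVT_box (r : R) (f df : R -> R) (x y : R) :
  (forall t : R, `|t| < r -> is_derive t 1 f (df t)) -> `|x| < r -> `|y| < r ->
  exists t, [/\ `|t| < r, `|t - x| <= `|y - x| & f y - f x = df t * (y - x)].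
Proof.
move=> fdf hx hy.
have aux a b : `|a| < r -> `|b| < r -> a <= b ->
    exists2 t, t \in `[a, b]%R & f b - f a = df t * (b - a).
  move=> ha hb ab; apply: MVT_segment => // [t|].
    rewrite in_itv /= => /andP[/ltW h1 /ltW h2]; apply: fdf.
    by apply: (norm_lt_between ha hb); rewrite h1.
  apply: continuous_in_subspaceT => t; rewrite inE /= in_itv /= => h.
  have [dt _] := fdf t (norm_lt_between ha hb h).
  exact/differentiable_continuous/derivable1_diffP.
have [xy|/ltW yx] := leP x y.
  have [t tab E] := aux _ _ hx hy xy; move: tab; rewrite in_itv /= => tab.
  exists t; split => //; first exact: (norm_lt_between hx hy).
  case/andP: tab => h1 h2.
  by rewrite !ger0_norm ?subr_ge0 // lerD2r.
have [t tab E] := aux _ _ hy hx yx; move: tab; rewrite in_itv /= => tab.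
exists t; split => //; first exact: (norm_lt_between hy hx).
  case/andP: tab => h1 h2.
  by rewrite !ler0_norm ?subr_le0 // lerN2 lerD2r.
by rewrite -opprB E -mulrN opprB.
Qed.

Definition partials (r : R) F F1 F2 :=
  forall x y : R, `|x| < r -> `|y| < r ->
    is_derive x 1 (F ^~ y) (F1 x y) /\ is_derive y 1 (F x) (F2 x y).

Definition bounded_box (r : R) F :=
  exists M : R, forall x y : R, `|x| < r -> `|y| < r -> `|F x y| <= M.

(** The mean value theorem is applied along a staircase path, one coordinate at a time; the corner
    [(x, y')] stays in the box. *)
Lemma Lipschitz_box r F F1 F2 : partials r F F1 F2 ->
  bounded_box r F1 -> bounded_box r F2 ->
  exists2 M, 0 <= M & forall x y x' y' : R, `|x| < r -> `|y| < r ->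
    `|x'| < r -> `|y'| < r ->
    `|F x' y' - F x y| <= M * (`|x' - x| + `|y' - y|).
Proof.
move=> FP [M1 b1] [M2 b2]; exists (Num.max 0 (Num.max M1 M2)); first by rewrite le_max lexx.
set M := Num.max _ _ => x y x' y' hx hy hx' hy'.
have [t [t1 _ tE]] := @MVT_box r (F ^~ y') (F1 ^~ y') x x'
  (fun t ht => (FP t y' ht hy').1) hx hx'.
have [s [s1 _ sE]] := @MVT_box r (F x) (F2 x) y y'
  (fun t ht => (FP x t hx ht).2) hy hy'.
have -> : F x' y' - F x y = (F x' y' - F x y') + (F x y' - F x y) by ring.
rewrite tE sE (le_trans (ler_normD _ _)) // !normrM mulrDr.
apply: lerD; apply: ler_wpM2r => //.
  by rewrite (le_trans (b1 _ _ t1 hy')) // /M !le_max lexx orbT.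
by rewrite (le_trans (b2 _ _ hx s1)) // /M !le_max lexx !orbT.
Qed.

Definition lin2 (a b : R) (v : 'rV[R]_2) : R := v 0 0 * a + v 0 1 * b.
Lemma lin2_is_linear a b : linear (lin2 a b).
Proof. by move=> k u v; rewrite /lin2 !mxE -[k *: (_ : R)]/(k * _); ring. Qed.
HB.instance Definition _ a b := GRing.isLinear.Build R 'rV[R]_2 R _ (lin2 a b)
  (lin2_is_linear a b).

Lemma lin2_continuous a b : continuous (lin2 a b).
Proof.
move=> v; exact: (smooth_at_cont (smooth_atD
  (smooth_atM (smooth_at_coord 0 v) (smooth_at_cst v a))
  (smooth_atM (smooth_at_coord 1 v) (smooth_at_cst v b)))).
Qed.

(** Along a staircase path the increment of [F] differs from its linear part by increments of the
    partial derivatives times the step. With Lipschitz partials this error is quadratic in the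
    step. *)
Lemma box_is_diff r F F1 F2 p : partials r F F1 F2 ->
  (exists2 M, 0 <= M & forall x y x' y' : R, `|x| < r -> `|y| < r ->
    `|x'| < r -> `|y'| < r ->
    `|F1 x' y' - F1 x y| <= M * (`|x' - x| + `|y' - y|)) ->
  (exists2 M, 0 <= M & forall x y x' y' : R, `|x| < r -> `|y| < r ->
    `|x'| < r -> `|y'| < r ->
    `|F2 x' y' - F2 x y| <= M * (`|x' - x| + `|y' - y|)) ->
  box r p -> is_diff p (uncur F) (lin2 (uncur F1 p) (uncur F2 p)).
Proof.
move=> FP [M1 M10 L1] [M2 M20 L2] [hx hy].
apply: is_diff_eps => [|e e0]; first exact: lin2_continuous.
set x := p 0 0 in hx *; set y := p 0 1 in hy *.
(* [M - 1] is the coefficient of the quadratic error; the extra 1 makes [M] positive, so that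
   [e / M] is a valid radius. *)
pose M := M1 + M1 + M2 + 1.
have M0 : 0 < M by rewrite /M; lra.
have nh : \forall h \near (0 : 'rV[R]_2), box r (h + p).
  have : \forall h \near p, box r h.
    by apply: open_nbhs_nbhs; split=> //; exact: open_box.
  rewrite (near_shift 0 p) /= => H.
  by apply: filterS H => h /=; rewrite subr0.
near=> h.
have hb : `|h| <= e / M.
  by near: h; exact: (@near0_norm_le R 'rV[R]_2 _ (divr_gt0 e0 M0)).
have [] : box r (h + p) by near: h.
rewrite /uncur /lin2 !mxE -/x -/y; set a := h 0 0; set b := h 0 1 => hx' hy'.
have ha : `|a| <= `|h| by exact: norm_coord_le.
have hbb : `|b| <= `|h| by exact: norm_coord_le.
have [t [t1 t2 tE]] := @MVT_box r (F ^~ (b + y)) (F1 ^~ (b + y)) x (a + x)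
  (fun t ht => (FP t _ ht hy').1) hx hx'.
have [s [s1 s2 sE]] := @MVT_box r (F x) (F2 x) y (b + y)
  (fun t ht => (FP x t hx ht).2) hy hy'.
have -> : F (a + x) (b + y) - F x y - (a * F1 x y + b * F2 x y) =
  a * (F1 t (b + y) - F1 x y) + b * (F2 x s - F2 x y).
  have -> : F (a + x) (b + y) - F x y =
     (F (a + x) (b + y) - F x (b + y)) + (F x (b + y) - F x y) by ring.
  by rewrite tE sE; ring.
rewrite addrK in t2; rewrite addrK in s2.
have k1 : `|F1 t (b + y) - F1 x y| <= M1 * (`|h| + `|h|).
  apply: le_trans (L1 _ _ _ _ hx hy t1 hy') _; apply: ler_wpM2l => //.
  by rewrite addrK; apply: lerD => //; exact: le_trans t2 ha.
have k2 : `|F2 x s - F2 x y| <= M2 * `|h|.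
  apply: le_trans (L2 _ _ _ _ hx hy hx s1) _; apply: ler_wpM2l => //.
  by rewrite subrr normr0 add0r; exact: le_trans s2 hbb.
apply: le_trans (ler_normD _ _) _; rewrite !normrM.
have l1 := ler_pM (normr_ge0 _) (normr_ge0 _) ha k1.
have l2 := ler_pM (normr_ge0 _) (normr_ge0 _) hbb k2.
apply: le_trans (lerD l1 l2) _.
have -> : `|h| * (M1 * (`|h| + `|h|)) + `|h| * (M2 * `|h|) = (M - 1) * `|h| * `|h|.
  by rewrite /M; ring.
apply: ler_wpM2r => //; apply: (@le_trans _ _ (M * `|h|)).
  by apply: ler_wpM2r => //; lra.
by rewrite -ler_pdivlMl // mulrC.
Unshelve. all: by end_near. Qed.

Context (P : (R -> R -> R) -> Prop) (r : R).
Context (PB : forall F, P F -> bounded_box r F).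
Context (PD : forall F, P F -> exists F1 F2, [/\ P F1, P F2 & partials r F F1 F2]).

(** The partials of [F] lie in [P], so their own partials are bounded; hence they are Lipschitz and
    [box_is_diff] applies. *)
Lemma coind_is_diff F : P F -> exists F1 F2, [/\ P F1, P F2 &
  forall p, box r p -> is_diff p (uncur F) (lin2 (uncur F1 p) (uncur F2 p))].
Proof.
move=> PF; have [F1 [F2 [P1 P2 H]]] := PD PF; exists F1, F2; split=> // p bp.
have L G : P G -> exists2 M, 0 <= M & forall x y x' y' : R, `|x| < r -> `|y| < r ->
    `|x'| < r -> `|y'| < r -> `|G x' y' - G x y| <= M * (`|x' - x| + `|y' - y|).
  move=> PG; have [G1 [G2 [Q1 Q2 Q]]] := PD PG.
  by apply: Lipschitz_box Q _ _; exact: PB.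
by apply: box_is_diff H _ _ bp; exact: L.
Qed.

(** The derivative in a fixed direction is a combination of two members of [P] with constant
    coefficients, so induction on the class of differentiability runs inside [P]. *)
Lemma smooth_coind F : P F -> smooth_on (box r) (uncur F).
Proof.
move=> PF n; elim: n F PF => [|n IH] F PF.
  have [F1 [F2 [_ _ H]]] := coind_is_diff PF.
  by move=> p /H[dp _]; exact: differentiable_continuous.
have [F1 [F2 [P1 P2 H]]] := coind_is_diff PF.
split=> [p /H[]//|v]; have ob := @open_box R r.
have C c := @Cn_on_cst R 'rV[R]_2 R n (box r) c.
have := Cn_onD ob (Cn_onM ob (C (v 0 0)) (IH _ P1)) (Cn_onM ob (C (v 0 1)) (IH _ P2)).
by apply: eq_Cn_on => // p /H[_ ->].
Qed.

End BoxCoinduction.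

(** * Hadamard's lemma *)

Section Hadamard.
Context {R : realType}.
Local Notation mu := (@lebesgue_measure R).
Implicit Types phi : 'rV[R]_2 -> R.

Lemma bounded_on_box (r r' : R) phi : r < r' ->
  (forall p, box r' p -> {for p, continuous phi}) ->
  exists2 M, 0 <= M & forall x y : R, `|x| <= r -> `|y| <= r ->
    `|phi (row2 x y)| <= M.
Proof.
move=> rr' cphi; have [r0|r0] := ltP r 0.
  exists 0 => // x y hx; have := le_lt_trans hx r0.
  by rewrite ltNge normr_ge0.
pose A := [set p : 'rV[R]_2 | forall i, `[- r, r]%classic (p 0 i)].
have inA p : A p <-> `|p 0 0| <= r /\ `|p 0 1| <= r.
  split=> [H|[h0 h1]].
    by move: (H 0) (H 1); rewrite /= !in_itv /= -!ler_norml.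
  by apply: ord2P; rewrite /= in_itv /= -ler_norml.
have cA : compact A.
  exact: (@rV_compact R 2 (fun=> `[- r, r]%classic) (fun=> @segment_compact R (- r) r)).
have A0 : A !=set0.
  by exists 0; apply/inA; rewrite !mxE normr0.
have cf : {within A, continuous (fun p => `|phi p|)}.
  apply: continuous_in_subspaceT => p; rewrite inE => /inA[h0 h1].
  exact: (cvg_norm (cphi p (conj (le_lt_trans h0 rr') (le_lt_trans h1 rr')))).
have [c _ H] := EVT_max_rV A0 cA cf.
exists `|phi c| => // x y hx hy; apply: H.
by rewrite inE; apply/inA; rewrite !rcE.
Qed.

(** The weight [t ^+ m] makes this family closed under derivatives: each derivative in [y] brings
    out one more factor [t]. *)
Definition avg (m : nat) phi (x y : R) : R :=
  \int[mu]_(t in `[0%R, 1%R]) (t ^+ m * phi (row2 x (t * y))).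

Section Avg.
Context (r' : R).

Let itv01 (t : R) : `[0%R, 1%R]%classic t -> 0 <= t <= 1.
Proof. by rewrite /= in_itv. Qed.

Let tyr (t y s : R) : 0 <= t <= 1 -> `|y| < s -> `|t * y| < s.
Proof.
move=> /andP[t0 t1]; rewrite normrM (ger0_norm t0) => h; apply: le_lt_trans h.
by rewrite ler_piMl.
Qed.

Lemma avg_slice_smooth m phi (x y t : R) : smooth_on (box r') phi ->
  `|x| < r' -> `|y| < r' -> 0 <= t <= 1 ->
  smooth_at t (fun t => t ^+ m * phi (row2 x (t * y))).
Proof.
move=> sphi hx hy ht; apply: smooth_atM.
  exact: smooth_atX (smooth_at_id t).
apply: (@smooth_at_comp_scalar _ _ 1 t (fun t => row2 x (t * y)) phi).
  apply: smooth_at_row2; first exact: smooth_at_cst.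
  by apply: smooth_atM; [exact: smooth_at_id|exact: smooth_at_cst].
exists (box r'); split => //; first exact: open_box.
by split; rewrite rcE //; exact: tyr.
Qed.

Lemma avg_integrable m phi (x y : R) : smooth_on (box r') phi ->
  `|x| < r' -> `|y| < r' ->
  mu.-integrable `[0%R, 1%R] (EFin \o (fun t => t ^+ m * phi (row2 x (t * y)))).
Proof.
move=> sphi hx hy; apply: continuous_compact_integrable.
  exact: segment_compact.
apply: continuous_in_subspaceT => t; rewrite inE => /itv01 ht.
exact: smooth_at_cont (avg_slice_smooth m sphi hx hy ht).
Qed.

Lemma integrable_cst01 (M : R) : mu.-integrable `[0%R, 1%R] (EFin \o cst M).
Proof.
apply: continuous_compact_integrable; first exact: segment_compact.
by apply: continuous_subspaceT => t; exact: cvg_cst.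
Qed.

Lemma smooth_on_at (U : set 'rV[R]_2) phi p : open U -> U p -> smooth_on U phi ->
  smooth_at p phi.
Proof. by exists U. Qed.

Lemma avg_bounded r m phi : r < r' -> smooth_on (box r') phi ->
  bounded_box r (avg m phi).
Proof.
move=> rr' sphi.
have [p bp|M M0 HM] := @bounded_on_box r r' phi rr'.
  exact: smooth_at_cont (smooth_on_at (@open_box R r') bp sphi).
exists M => x y hx hy.
have hx' := lt_trans hx rr'; have hy' := lt_trans hy rr'.
have int := avg_integrable m sphi hx' hy'.
apply: le_trans (le_normr_Rintegral _ int) _ => //.
have -> : M = \int[mu]_(t in `[0%R, 1%R]) M.
  rewrite Rintegral_cst //.
  have H : mu `[0%R, 1%R]%classic = 1%E.
    rewrite (@lebesgue_measure_itv R `[0%R, 1%R]) /= lte_fin ltr01.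
    by rewrite -EFinD subr0.
  transitivity (M * fine (1%E : \bar R)); first by rewrite /= mulr1.
  by congr (M * fine _); exact: esym H.
apply: le_Rintegral => //; [|exact: integrable_cst01|].
  have := integrable_abse int; exact.
move=> t /itv01 ht; case/andP: (ht) => t0 t1.
rewrite normrM; apply: le_trans (HM x (t * y) (ltW hx) (ltW (tyr ht hy))).
rewrite ler_piMl // normrX (ger0_norm t0); exact: exprn_ile1.
Qed.

(** On the box of radius [r] the derivative of the integrand is bounded, the closed box being
    compact inside that of radius [r']. A constant therefore dominates it, and differentiation under
    the integral is allowed. *)
Lemma avg_derive_x r m phi (x y : R) : r < r' -> smooth_on (box r') phi ->
  `|x| < r -> `|y| < r ->
  is_derive x 1 (avg m phi ^~ y)
    (avg m (fun p => 'd phi p (delta_mx 0 0)) x y).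
Proof.
move=> rr' sphi hx hy; have hy' := lt_trans hy rr'.
pose psi p := 'd phi p (delta_mx 0 0).
have spsi : smooth_on (box r') psi by move=> n; have [_] := sphi n.+1; exact.
have [p bp|M M0 HM] := @bounded_on_box r r' psi rr'.
  exact: smooth_at_cont (smooth_on_at (@open_box R r') bp spsi).
pose f x t := t ^+ m * phi (row2 x (t * y)).
have int z : `]- r, r[%classic z -> mu.-integrable `[0%R, 1%R] (EFin \o f z).
  rewrite /= in_itv /= -ltr_norml => hz.
  by apply: avg_integrable => //; exact: lt_trans hz rr'.
have der z t : `]- r, r[%classic z -> `[0%R, 1%R]%classic t ->
    is_derive z 1 (f ^~ t) (t ^+ m * psi (row2 z (t * y))).
  rewrite /= in_itv /= -ltr_norml => hz /itv01 ht.
  have dphi : differentiable phi (row2 z (t * y)).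
    apply: smooth_at_diff; apply: (smooth_on_at (@open_box R r') _ sphi).
    by split; rewrite rcE ?(lt_trans hz) //; exact: tyr.
  have := is_derive_curve (a := fun s => s) (b := fun _ => t * y) dphi
    (smooth_at_id z) (smooth_at_cst z _).
  rewrite d_id d_cst -delta2_0 => /(is_deriveZ (t ^+ m)).
  exact.
have xI : `]- r, r[%classic x by rewrite /= in_itv /= -ltr_norml.
have d1E z t : `]- r, r[%classic z -> `[0%R, 1%R]%classic t ->
    partial1of2 f z t = t ^+ m * psi (row2 z (t * y)).
  move=> hz ht; have [_ <-] := der z t hz ht.
  by rewrite /partial1of2 derive1E.
have derf z t : `]- r, r[%classic z -> `[0%R, 1%R]%classic t ->
    derivable (f ^~ t) z 1 by move=> hz ht; have [] := der z t hz ht.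
have bd z t : `]- r, r[%classic z -> `[0%R, 1%R]%classic t ->
    `|partial1of2 f z t| <= cst M t.
  move=> hz ht; rewrite d1E //; move: hz => /=; rewrite in_itv /= -ltr_norml => hz.
  move/itv01: ht => ht; case/andP: (ht) => t0 t1.
  rewrite normrM; apply: le_trans (HM z (t * y) (ltW hz) (ltW (tyr ht hy))).
  rewrite ler_piMl // normrX (ger0_norm t0); exact: exprn_ile1.
have m01 : measurable (`[0%R, 1%R]%classic : set R) by [].
have HD := @derivable_under_integral R _ _ mu f _ m01 x (- r) r xI int derf
  (cst M) (fun=> M0) (integrable_cst01 M) bd.
have HE := @differentiation_under_integral R _ _ mu f _ m01 x (- r) r xI int derf
  (cst M) (fun=> M0) (integrable_cst01 M) bd.
apply: DeriveDef; first exact: HD.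
rewrite -derive1E HE; apply: eq_Rintegral => t; rewrite inE => ht.
by rewrite d1E.
Qed.

(** As for [x], with the chain rule for [z |-> t * z] raising the weight from [m] to [m.+1]. *)
Lemma avg_derive_y r m phi (x y : R) : r < r' -> smooth_on (box r') phi ->
  `|x| < r -> `|y| < r ->
  is_derive y 1 (avg m phi x)
    (avg m.+1 (fun p => 'd phi p (delta_mx 0 1)) x y).
Proof.
move=> rr' sphi hx hy; have hx' := lt_trans hx rr'.
pose psi p := 'd phi p (delta_mx 0 1).
have spsi : smooth_on (box r') psi by move=> n; have [_] := sphi n.+1; exact.
have [p bp|M M0 HM] := @bounded_on_box r r' psi rr'.
  exact: smooth_at_cont (smooth_on_at (@open_box R r') bp spsi).
pose f y t := t ^+ m * phi (row2 x (t * y)).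
have int z : `]- r, r[%classic z -> mu.-integrable `[0%R, 1%R] (EFin \o f z).
  rewrite /= in_itv /= -ltr_norml => hz.
  by apply: avg_integrable => //; exact: lt_trans hz rr'.
have der z t : `]- r, r[%classic z -> `[0%R, 1%R]%classic t ->
    is_derive z 1 (f ^~ t) (t ^+ m.+1 * psi (row2 x (t * z))).
  rewrite /= in_itv /= -ltr_norml => hz /itv01 ht.
  have dphi : differentiable phi (row2 x (t * z)).
    apply: smooth_at_diff; apply: (smooth_on_at (@open_box R r') _ sphi).
    by split; rewrite rcE //; apply: tyr => //; exact: lt_trans rr'.
  have st : smooth_at z (fun s : R => t * s).
    by apply: smooth_atM; [exact: smooth_at_cst|exact: smooth_at_id].
  have := is_derive_curve (a := fun=> x) (b := fun s => t * s) dphi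
    (smooth_at_cst z _) st.
  have -> : 'd (fun s : R => t * s) z 1 = t.
    rewrite d_mul; [|exact: smooth_at_diff (smooth_at_cst z t)|
      exact: smooth_at_diff (smooth_at_id z)].
    by rewrite d_id d_cst mulr0 addr0 mulr1.
  rewrite d_cst.
  have -> : row2 0 t = t *: delta_mx 0 1.
    by rewrite delta2_1; apply/rowP; apply: ord2P; rewrite [RHS]mxE !rcE ?mulr0 ?mulr1.
  rewrite linearZ => /(is_deriveZ (t ^+ m)) => H; apply: is_derive_eq H _.
  by rewrite exprSr -mulrA.
have yI : `]- r, r[%classic y by rewrite /= in_itv /= -ltr_norml.
have d1E z t : `]- r, r[%classic z -> `[0%R, 1%R]%classic t ->
    partial1of2 f z t = t ^+ m.+1 * psi (row2 x (t * z)).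
  move=> hz ht; have [_ <-] := der z t hz ht.
  by rewrite /partial1of2 derive1E.
have derf z t : `]- r, r[%classic z -> `[0%R, 1%R]%classic t ->
    derivable (f ^~ t) z 1 by move=> hz ht; have [] := der z t hz ht.
have bd z t : `]- r, r[%classic z -> `[0%R, 1%R]%classic t ->
    `|partial1of2 f z t| <= cst M t.
  move=> hz ht; rewrite d1E //; move: hz => /=; rewrite in_itv /= -ltr_norml => hz.
  move/itv01: ht => ht; case/andP: (ht) => t0 t1.
  rewrite normrM; apply: le_trans (HM x (t * z) (ltW hx) (ltW (tyr ht hz))).
  rewrite ler_piMl // normrX (ger0_norm t0); exact: exprn_ile1.
have m01 : measurable (`[0%R, 1%R]%classic : set R) by [].
have HD := @derivable_under_integral R _ _ mu f _ m01 y (- r) r yI int derf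
  (cst M) (fun=> M0) (integrable_cst01 M) bd.
have HE := @differentiation_under_integral R _ _ mu f _ m01 y (- r) r yI int derf
  (cst M) (fun=> M0) (integrable_cst01 M) bd.
apply: DeriveDef; first exact: HD.
rewrite -derive1E HE; apply: eq_Rintegral => t; rewrite inE => ht.
by rewrite d1E.
Qed.

(** The class for [smooth_coind] contains the averages of all weights and of all smooth integrands
    on the larger box. *)
Lemma avg_smooth r m phi : r < r' -> smooth_on (box r') phi ->
  smooth_on (box r) (uncur (avg m phi)).
Proof.
move=> rr' sphi.
pose P F := exists n psi, smooth_on (box r') psi /\ F = avg n psi.
apply: (@smooth_coind R P r) => [F [n [psi [spsi ->]]]|F [n [psi [spsi ->]]]|].
- exact: avg_bounded.
- exists (avg n (fun p => 'd psi p (delta_mx 0 0))).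
  exists (avg n.+1 (fun p => 'd psi p (delta_mx 0 1))).
  split.
  + by exists n, (fun p => 'd psi p (delta_mx 0 0)); split=> // k; have [_] := spsi k.+1; exact.
  + by exists n.+1, (fun p => 'd psi p (delta_mx 0 1)); split=> // k; have [_] := spsi k.+1; exact.
  + by move=> x y hx hy; split; [exact: (avg_derive_x (r := r))|exact: (avg_derive_y (r := r))].
- by exists m, phi.
Qed.

(** The fundamental theorem of calculus for [t |-> phi (x, t * y)] on the unit interval. *)
Lemma avg_FTC phi (x y : R) : smooth_on (box r') phi -> `|x| < r' -> `|y| < r' ->
  phi (row2 x y) = phi (row2 x 0) +
    y * avg 0 (fun p => 'd phi p (delta_mx 0 1)) x y.
Proof.
move=> sphi hx hy.
pose psi p := 'd phi p (delta_mx 0 1).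
have spsi : smooth_on (box r') psi by move=> n; have [_] := sphi n.+1; exact.
pose F (t : R) := phi (row2 x (t * y)).
have ss (t : R) : 0 <= t <= 1 -> smooth_at t F.
  move=> ht; have := avg_slice_smooth 0 sphi hx hy ht.
  by rewrite (_ : (fun t0 => _) = F) //; apply/funext => s; rewrite expr0 mul1r.
have sp (t : R) : 0 <= t <= 1 -> smooth_at t (fun t : R => y * (t ^+ 0 * psi (row2 x (t * y)))).
  move=> ht.
  exact: (smooth_atM (smooth_at_cst t y) (avg_slice_smooth 0 spsi hx hy ht)).
have dF (t : R) : 0 <= t <= 1 ->
    is_derive t 1 F (y * (t ^+ 0 * psi (row2 x (t * y)))).
  move=> ht.
  have dphi : differentiable phi (row2 x (t * y)).
    apply: smooth_at_diff; apply: (smooth_on_at (@open_box R r') _ sphi).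
    by split; rewrite rcE //; apply: tyr.
  have st : smooth_at t (fun s : R => s * y).
    by apply: smooth_atM; [exact: smooth_at_id|exact: smooth_at_cst].
  have := is_derive_curve (a := fun=> x) (b := fun s => s * y) dphi
    (smooth_at_cst t _) st.
  have -> : 'd (fun s : R => s * y) t 1 = y.
    rewrite d_mul; [|exact: smooth_at_diff (smooth_at_id t)|
      exact: smooth_at_diff (smooth_at_cst t y)].
    by rewrite d_id d_cst mulr0 add0r mulr1.
  rewrite d_cst.
  have -> : row2 0 y = y *: delta_mx 0 1.
    by rewrite delta2_1; apply/rowP; apply: ord2P; rewrite [RHS]mxE !rcE ?mulr0 ?mulr1.
  rewrite linearZ => H; apply: is_derive_eq H _.
  by rewrite expr0 mul1r.
have h0 : 0 <= (0 : R) <= 1 by rewrite lexx ler01.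
have h1 : 0 <= (1 : R) <= 1 by rewrite lexx ler01.
have oo (t : R) : t \in `]0, 1[%R -> 0 <= t <= 1.
  by rewrite in_itv /= => /andP[/ltW -> /ltW ->].
have E := @continuous_FTC2 R (fun t : R => y * (t ^+ 0 * psi (row2 x (t * y))))
  F 0 1 ltr01.
have {E}E : (\int[mu]_(t in `[0%R, 1%R]) (y * (t ^+ 0 * psi (row2 x (t * y))))%:E =
   (F 1)%:E - (F 0)%:E)%E.
  apply: E.
  - apply: continuous_in_subspaceT => t; rewrite inE => /itv01 ht.
    exact: smooth_at_cont (sp t ht).
  - split.
    + by move=> t /oo ht; have [] := dF t ht.
    + by apply: cvg_at_right_filter; exact: smooth_at_cont (ss 0 h0).
    + by apply: cvg_at_left_filter; exact: smooth_at_cont (ss 1 h1).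
  - by move=> t /oo ht; rewrite derive1E; have [_ ->] := dF t ht.
have m01 : measurable (`[0%R, 1%R]%classic : set R) by [].
have Z := @RintegralZl _ _ _ mu _ _ y m01 (avg_integrable 0 spsi hx hy).
rewrite /avg -Z.
rewrite /Rintegral E -EFinB /= /F mul1r mul0r.
by rewrite addrC subrK.
Qed.

End Avg.

Theorem Hadamard phi : smooth_at 0 phi -> exists2 g, smooth_at 0 g &
  \forall p \near (0 : 'rV[R]_2), phi p = phi (row2 (p 0 0) 0) + p 0 1 * g p.
Proof.
move=> [U [oU U0 sU]].
have [r r0 rU] := nbhs0_box (open_nbhs_nbhs (conj oU U0)).
have sphi : smooth_on (box r) phi by move=> n; exact: Cn_on_sub (sU n).
have spsi : smooth_on (box r) (fun p => 'd phi p (delta_mx 0 1)).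
  by move=> n; have [_] := sphi n.+1; exact.
(* Averages are known to be smooth only on boxes strictly smaller than that of the integrand. *)
have r2 : 0 < r / 2 by exact: divr_gt0.
have rr : r / 2 < r by rewrite ltr_pdivrMr // ltr_pMr // ltr1n.
exists (uncur (avg 0 (fun p => 'd phi p (delta_mx 0 1)))).
  exists (box (r / 2)); split; first exact: open_box.
    exact: nbhs_singleton (box_nbhs0 r2).
  exact: avg_smooth rr spsi.
apply: filterS (box_nbhs0 r0) => p [h0 h1].
by rewrite -{1}(row2K p) (avg_FTC sphi).
Qed.

End Hadamard.

(** * Inverse function theorem *)

Section InverseFunction.
Context {R : realType}.

Lemma smooth_at_near_val (V W : normedModType R) x y (f : V -> W) (P : set W) :
  smooth_at x f -> f x = y -> (\forall z \near y, P z) -> \forall z \near x, P (f z).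
Proof. by move=> hf <- nP; exact: (smooth_at_cont hf nP). Qed.

Lemma Cn_on_row (V : normedModType R) n (U : set V) m (f : V -> 'rV[R]_m.+1) :
  open U -> (forall i, Cn_on n U (fun y => f y 0 i)) -> Cn_on n U f.
Proof.
move=> oU H; have := @Cn_on_sum R V _ n U _ (index_enum _) predT
  (fun i y => f y 0 i *: (delta_mx 0 i : 'rV[R]_m.+1)) oU
  (fun i _ => Cn_onZl _ oU (H i)).
by apply: eq_Cn_on => // x _; rewrite -row_sum_delta.
Qed.

Lemma Cn_on_det (V : normedModType R) n (U : set V) m (A : V -> 'M[R]_m) :
  open U -> (forall i j, Cn_on n U (fun y => A y i j)) ->
  Cn_on n U (fun y => \det (A y)).
Proof.
move=> oU H; apply: Cn_on_sum => // s _; apply: Cn_onM => //.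
  exact: Cn_on_cst.
by apply: Cn_on_prod.
Qed.

Lemma Cn_on_comp_rV (V : normedModType R) n (U : set V) m (U' : set 'rV[R]_m.+1)
    (f : V -> 'rV[R]_m.+1) (g : 'rV[R]_m.+1 -> R) :
  open U -> open U' -> (forall x, U x -> U' (f x)) ->
  Cn_on n U f -> Cn_on n U' g -> Cn_on n U (fun x => g (f x)).
Proof.
apply: (@Cn_on_comp_coord R V _ n m.+1 U U' f g (fun i => delta_mx 0 i)
   (fun i => coord_fun i : {linear _ -> _})).
  by move=> i y; exact: coord_continuous.
by move=> v; rewrite {1}(row_sum_delta v).
Qed.

Lemma smooth_at_mulmx (V : normedModType R) m (x : V) (f : V -> 'rV[R]_m.+1)
    (M : 'M[R]_m.+1) :
  smooth_at x f -> smooth_at x (fun y => f y *m M).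
Proof.
move/smooth_at_rowP => hf; apply/smooth_at_rowP => i.
have := smooth_at_sum (index_enum _) (fun j => smooth_atM (hf j) (smooth_at_cst x (M j i))).
by congr (smooth_at _ _); apply/funext => y; rewrite mxE.
Qed.

Lemma mulmxr_continuous m (M : 'M[R]_m.+1) :
  continuous (mulmxr M : {linear 'rV[R]_m.+1 -> 'rV[R]_m.+1}).
Proof.
move=> x; exact: smooth_at_cont (smooth_at_mulmx M (smooth_at_id x)).
Qed.

Lemma d_jacobian m k (f : 'rV[R]_m.+1 -> 'rV[R]_k.+1) x v : 'd f x v = v *m 'J f x.
Proof. by rewrite /jacobian mul_rV_lin1. Qed.

Lemma d_mulmx (V : normedModType R) m (x : V) (f : V -> 'rV[R]_m.+1)
    (M : 'M[R]_m.+1) v : differentiable f x ->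
  'd (fun y => f y *m M) x v = 'd f x v *m M.
Proof.
move=> df; have cM := @mulmxr_continuous m M.
transitivity ('d (mulmxr M : {linear _ -> _}) (f x) ('d f x v)).
  exact: (d_comp v df (linear_differentiable (f x) cM)).
by rewrite diff_lin.
Qed.

Lemma near_d_id m (F : 'rV[R]_m.+1 -> 'rV[R]_m.+1) :
  smooth_at 0 F -> (forall v, 'd F 0 v = v) ->
  \forall x \near (0 : 'rV[R]_m.+1), forall v, `|'d F x v - v| <= 2^-1 * `|v|.
Proof.
(* Each of the [m.+1] basis directions contributes at most [e * |v|], which adds up to half of
   [|v|]. *)
move=> sF d0; pose e : R := (2 * m.+1%:R)^-1.
have e0 : 0 < e by rewrite invr_gt0 mulr_gt0 // ltr0n.
have H j : \forall x \near (0 : 'rV[R]_m.+1),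
    `|'d F x (delta_mx 0 j) - delta_mx 0 j| <= e.
  have := smooth_at_cont (smooth_at_d (delta_mx 0 j) sF).
  move=> /cvgrPdist_le /(_ e e0); apply: filterS => x hx.
  rewrite -normrN opprB; apply: le_trans hx.
  rewrite le_eqVlt; apply/orP; left; apply/eqP; congr (`|_ - _|).
  exact: esym (d0 _).
have : \forall x \near (0 : 'rV[R]_m.+1), forall j,
    `|'d F x (delta_mx 0 j) - delta_mx 0 j| <= e.
  exact: filter_forall H.
apply: filterS => x Hx v.
rewrite {1 2}(row_sum_delta v) linear_sum -sumrB.
apply: le_trans (ler_norm_sum _ _ _) _.
have -> : 2^-1 * `|v| = \sum_(i < m.+1) `|v| * e.
  rewrite sumr_const card_ord -[RHS]mulr_natl /e.
  have : (m.+1%:R : R) != 0 by rewrite pnatr_eq0.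
  by move=> N0; rewrite mulrC invfM mulrCA [m.+1%:R * _]mulrCA divff // mulr1.
apply: ler_sum => i _; rewrite linearZ -scalerBr normrZ.
by apply: ler_pM => //; exact: norm_coord_le.
Qed.

(** The norm is the maximum of the coordinates, so each coordinate of [F - id] may be treated
    separately by the mean value theorem on the segment from [y] to [x]. *)
Lemma almost_isometry m (F : 'rV[R]_m.+1 -> 'rV[R]_m.+1) r :
  (forall x, `|x| <= r -> smooth_at x F /\
     forall v, `|'d F x v - v| <= 2^-1 * `|v|) ->
  forall x y, `|x| <= r -> `|y| <= r ->
    `|F x - F y - (x - y)| <= 2^-1 * `|x - y|.
Proof.
move=> H x y hx hy; apply/(norm_row_le _ _) => [|i].
  by rewrite mulr_ge0.
pose p (t : R) := y + t *: (x - y).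
have hp (t : R) : 0 <= t <= 1 -> `|p t| <= r.
  move=> /andP[t0 t1].
  have -> : p t = (1 - t) *: y + t *: x.
    by rewrite /p scalerBr scalerBl scale1r addrCA -addrA addrC -!addrA; congr (_ + _); rewrite addrC.
  apply: le_trans (ler_normD _ _) _.
  rewrite !normrZ (ger0_norm t0) ger0_norm ?subr_ge0 //.
  have -> : r = (1 - t) * r + t * r by ring.
  by apply: lerD; apply: ler_wpM2l; rewrite ?subr_ge0.
have sp t : smooth_at t p.
  by apply: smooth_atD; [exact: smooth_at_cst|apply: smooth_atZl; exact: smooth_at_id].
have dp t : 'd p t 1 = x - y.
  have d2 : differentiable (fun t : R => t *: (x - y)) t.
    by apply: smooth_at_diff; apply: smooth_atZl; exact: smooth_at_id.
  have E1 : 'd p t 1 = 'd (fun _ : R => y) t 1 + 'd (fun t : R => t *: (x - y)) t 1.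
    apply: d_add => //; exact: differentiable_cst.
  have E2 : 'd (fun t : R => t *: (x - y)) t 1 = x - y.
    apply: etrans (congr1 (fun h => h 1) (diffZl (x - y) (smooth_at_diff (smooth_at_id t)))) _.
    by rewrite d_id scale1r.
  exact: (etrans E1 (etrans (f_equal2 +%R (d_cst y t 1) E2) (add0r _))).
pose g (t : R) := (F (p t) - t *: (x - y)) 0 i.
have dg (t : R) : 0 <= t <= 1 ->
    is_derive t 1 g (('d F (p t) (x - y) - (x - y)) 0 i).
  move=> ht; have [sF _] := H _ (hp _ ht).
  have s1 : smooth_at t (fun t => F (p t)) by exact: smooth_at_comp (sp t) sF.
  have s2 : smooth_at t (fun t : R => t *: (x - y)) by apply: smooth_atZl; exact: smooth_at_id.
  have s3 := smooth_atB s1 s2.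
  have s4 : smooth_at t g by have /smooth_at_rowP := s3; exact.
  have E : 'd g t 1 = ('d F (p t) (x - y) - (x - y)) 0 i.
    have E0 := d_row (1 : R) i (smooth_at_diff s3).
    transitivity (('d (fun t => F (p t) - t *: (x - y)) t 1) 0 i); first exact: esym E0.
    congr (fun_of_matrix _ 0 i).
    apply: etrans (d_add (1 : R) (smooth_at_diff s1) (smooth_at_diff (smooth_atN s2))) _.
    congr (_ + _).
      apply: etrans (d_comp (1 : R) (smooth_at_diff (sp t)) (smooth_at_diff sF)) _.
      by congr ('d F _ _); exact: dp.
    apply: etrans (d_opp (1 : R) (smooth_at_diff s2)) _; congr (- _).
    apply: etrans (congr1 (fun h => h 1) (diffZl (x - y) (smooth_at_diff (smooth_at_id t)))) _.
    by rewrite d_id scale1r.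
  by rewrite -E; exact: is_derive_d (smooth_at_diff s4).
have [t||t tI E] := @MVT_segment R g (fun t => ('d F (p t) (x - y) - (x - y)) 0 i) 0 1 ler01.
- rewrite in_itv /= => /andP[/ltW t0 /ltW t1]; apply: dg.
  by rewrite t0.
- apply: continuous_in_subspaceT => t; rewrite inE /= in_itv /= => ht.
  have [dt _] := dg t ht.
  exact/differentiable_continuous/derivable1_diffP.
move: tI; rewrite in_itv /= => ht.
have -> : (F x - F y - (x - y)) 0 i = g 1 - g 0.
  have p1 : p 1 = x by rewrite /p scale1r addrC subrK.
  have p0 : p 0 = y by rewrite /p scale0r addr0.
  by rewrite /g p1 p0 scale1r scale0r subr0 !mxE; ring.
rewrite E subr0 mulr1; apply: le_trans (norm_coord_le _ _) _.
by have [_] := H _ (hp _ ht); exact.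
Qed.

(** A solution of [F x = y] is a fixed point of [x |-> x - F x + y], a contraction of ratio 1/2. It
    preserves the closed ball of radius [r] because [|x - F x| <= r / 2] there. *)
Lemma local_inverse_exists m (F : 'rV[R]_m.+1 -> 'rV[R]_m.+1) r : 0 <= r ->
  F 0 = 0 ->
  (forall x y, `|x| <= r -> `|y| <= r ->
    `|F x - F y - (x - y)| <= 2^-1 * `|x - y|) ->
  forall y, `|y| <= r / 2 -> exists2 x, `|x| <= r & F x = y.
Proof.
move=> r0 F0 H y hy.
(* Banach's fixed point theorem is applied in the complete normed structure of row vectors. *)
pose X : completeNormedModType R :=
  HB.pack_for (completeNormedModType R) 'rV[R]_m.+1.
pose U : set X := [set x : X | `|x| <= r].
pose T (x : X) : X := (x - F x + y : 'rV[R]_m.+1).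
have TU : {homo T : x / U x >-> U x}.
  move=> x hx; rewrite /U /= /T.
  have n0 : `|0 : 'rV[R]_m.+1| <= r by rewrite normr0.
  have := H x 0 hx n0; rewrite F0 !subr0 -normrN opprB => h.
  apply: le_trans (ler_normD _ _) _.
  rewrite [r]splitr; apply: lerD => //; apply: le_trans h _.
  by rewrite mulrC ler_wpM2r.
have [T' TT'] := Pfun TU.
have ctr : is_contraction T'.
  have h2 : 0 <= 2^-1 :> R by rewrite invr_ge0.
  exists (NngNum h2); split; first by rewrite /= invf_lt1 // ltr1n.
  move=> [x x'] [hx hx']; rewrite -TT' /= /T.
  have := H x x' hx hx'; rewrite -normrN => h; apply: le_trans h.
  rewrite le_eqVlt; apply/orP; left; apply/eqP; congr (`|_|).
  by apply/rowP => i; rewrite !mxE; ring.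
have cU : closed U.
  have -> : U = (fun x : 'rV[R]_m.+1 => `|x|) @^-1` [set t : R | t <= r] by [].
  apply: closed_comp; last exact: closed_le.
  by move=> x _; exact: norm_continuous.
have U0 : U !=set0 by exists (0 : 'rV[R]_m.+1); rewrite /U /= normr0.
have [x Ux E] := banach_fixed_point ctr cU U0.
exists x => //; move: E; rewrite -TT' /T.
move/(congr1 (fun z : 'rV[R]_m.+1 => F x - x + z)).
rewrite subrK addrA -[F x - x]opprB => E.
by rewrite E addNr add0r.
Qed.

Lemma unitmx_jacobian m (F : 'rV[R]_m.+1 -> 'rV[R]_m.+1) x :
  (forall v, 'd F x v = 0 -> v = 0) -> 'J F x \in unitmx.
Proof.
move=> H; rewrite -row_free_unit; apply/row_freeP.
have : row_free ('J F x).
  rewrite -kermx_eq0; apply/eqP/row_matrixP => i; rewrite row0; apply: H.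
  by rewrite d_jacobian -row_mul mulmx_ker row0.
by move/row_freeP.
Qed.

(** The local inverse exists by contraction and is 2-Lipschitz. Its differential is the inverse
    matrix of the Jacobian along the inverse itself, so its class of differentiability can be raised
    one step at a time. *)
Lemma inverse_function_normalized m (F : 'rV[R]_m.+1 -> 'rV[R]_m.+1) :
  smooth_at 0 F -> F 0 = 0 -> (forall v, 'd F 0 v = v) -> diffeo_germ F.
Proof.
move=> sF F0 d0.
have [W [oW W0 sW]] := sF.
have : \forall x \near (0 : 'rV[R]_m.+1), W x /\
     forall v, `|'d F x v - v| <= 2^-1 * `|v|.
  have nW : \forall x \near (0 : 'rV[R]_m.+1), W x by exact: open_nbhs_nbhs.
  by apply: filterS2 nW (near_d_id sF d0).
move=> /nbhs_ballP [r2 r20 Hr2].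
pose r := r2 / 2; have r0 : 0 < r by exact: divr_gt0.
have rr2 : r < r2 by rewrite ltr_pdivrMr // ltr_pMr // ltr1n.
have Hr x : `|x| <= r -> smooth_at x F /\
     forall v, `|'d F x v - v| <= 2^-1 * `|v|.
  move=> hx; have [|Wx Hx] := Hr2 x.
    by rewrite -ball_normE /= sub0r normrN; exact: le_lt_trans hx rr2.
  by split=> //; exists W.
have Hiso := almost_isometry Hr.
have Hex := local_inverse_exists (ltW r0) F0 Hiso.
have r40 : 0 < r / 2 by exact: divr_gt0.
(* A preimage in the ball is chosen where there is one; the default 0 is taken only for [y] without
   a preimage there. *)
pose e (y : 'rV[R]_m.+1) := xget 0 [set x : 'rV[R]_m.+1 | `|x| <= r /\ F x = y].
have eP y : `|y| <= r / 2 -> `|e y| <= r /\ F (e y) = y.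
  move=> hy; have [x h1 h2] := Hex y hy.
  exact: (@xgetPex _ 0 [set x : 'rV[R]_m.+1 | `|x| <= r /\ F x = y]
    (ex_intro _ x (conj h1 h2))).
(* Since [F] is within half of [x - y] of the identity, it contracts distances by at most a factor
   2. This gives both uniqueness of preimages and the Lipschitz bound for [e]. *)
have Hlow x y : `|x| <= r -> `|y| <= r -> `|x - y| <= 2 * `|F x - F y|.
  move=> hx hy; have h := Hiso x y hx hy.
  have := ler_normD (x - y - (F x - F y)) (F x - F y).
  rewrite subrK -(normrN (x - y - _)) opprB => h2.
  have := le_trans h2 (lerD h (lexx _)); lra.
have eL y y' : `|y| <= r / 2 -> `|y'| <= r / 2 -> `|e y - e y'| <= 2 * `|y - y'|.
  move=> hy hy'; have [h1 h2] := eP y hy; have [h1' h2'] := eP y' hy'.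
  by rewrite -{2}h2 -{2}h2'; exact: Hlow.
have eF x : `|x| <= r -> `|F x| <= r / 2 -> e (F x) = x.
  move=> hx hFx; have [h1 h2] := eP _ hFx.
  have := Hlow _ _ h1 hx; rewrite h2 subrr normr0 mulr0 normr_le0 subr_eq0.
  by move/eqP.
have e0 : e 0 = 0 by rewrite -{1}F0; apply: eF; rewrite ?F0 normr0 ltW.
pose V : set 'rV[R]_m.+1 := ball 0 (r / 2).
have oV : open V by exact: ball_open.
have VP y : V y <-> `|y| < r / 2.
  by rewrite /V -ball_normE /= sub0r normrN.
have V0 : V 0 by apply/VP; rewrite normr0.
pose U : set 'rV[R]_m.+1 := ball 0 r.
have oU : open U by exact: ball_open.
have UP y : U y <-> `|y| < r.
  by rewrite /U -ball_normE /= sub0r normrN.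
have VU y : V y -> U (e y).
  move=> /VP hy; apply/UP; have := eL y 0 (ltW hy).
  rewrite normr0 e0 !subr0 => /(_ (ltW r40)) h.
  by apply: le_lt_trans h _; rewrite mulrC -ltr_pdivlMr.
have sUF : smooth_on U F.
  move=> n; apply: Cn_on_sub (sW n) => x /UP hx.
  have [] // := Hr2 x; rewrite -ball_normE /= sub0r normrN.
  exact: lt_trans hx rr2.
pose J x := 'J F x.
have uJ x : `|x| <= r -> J x \in unitmx.
  move=> hx; apply: unitmx_jacobian => v dv; have [_ /(_ v)] := Hr x hx.
  rewrite dv sub0r normrN => h; apply/eqP; rewrite -normr_le0; lra.
have de y : V y -> is_diff y e (mulmxr (invmx (J (e y))) : {linear _ -> _}).
  move=> Vy; have /VP/ltW hy := Vy.
  have [hx Fx] := eP y hy; set x := e y in hx Fx *.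
  have [sFx _] := Hr x hx; have dF := smooth_at_diff sFx.
  have cL : continuous (mulmxr (invmx (J x)) : {linear 'rV[R]_m.+1 -> 'rV[R]_m.+1}).
    exact: mulmxr_continuous.
  apply: is_diff_eps => // eps eps0.
  have [K K0 HK] := linear_lipschitz cL.
  (* [K] bounds the inverse differential and 2 is the Lipschitz constant of [e]; their product
     cancels the denominator. *)
  have d0' : 0 < eps / (2 * K) by rewrite divr_gt0 // mulr_gt0.
  have /nbhs_ballP[rho /= rho0 Hrho] := differentiable_eps d0' dF.
  have nV : \forall h \near (0 : 'rV[R]_m.+1), V (h + y).
    have : \forall h \near y, V h by exact: open_nbhs_nbhs.
    rewrite (near_shift 0 y) /= => H.
    by apply: filterS H => h /=; rewrite subr0.
  near=> h.
  have Vh : V (h + y) by near: h.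
  have hh : `|h| <= rho / 4.
    by near: h; apply: (@near0_norm_le R 'rV[R]_m.+1); exact: divr_gt0.
  have /VP/ltW hhy := Vh.
  have [hx' Fx'] := eP _ hhy; set x' := e (h + y) in hx' Fx' *.
  pose k := x' - x.
  have hk : `|k| <= 2 * `|h|.
    by have := eL _ _ hhy hy; rewrite addrK.
  have kr : ball (0 : 'rV[R]_m.+1) rho k.
    rewrite -ball_normE /= sub0r normrN; apply: le_lt_trans hk _; lra.
  have := Hrho k kr; rewrite /k subrK Fx Fx' addrK d_jacobian => hL.
  (* The linearization error of [e] is minus the inverse differential applied to that of [F] at the
     corresponding point. *)
  have -> : x' - x - (mulmxr (invmx (J x))) h =
      - mulmxr (invmx (J x)) (h - (x' - x) *m J x).
    by rewrite /= mulmxBl mulmxK ?uJ // opprB.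
  rewrite normrN; apply: le_trans (HK _) _.
  apply: (@le_trans _ _ (K * (eps / (2 * K) * (2 * `|h|)))).
    apply: ler_wpM2l; first exact: ltW.
    by apply: le_trans hL _; apply: ler_wpM2l hk; exact: ltW.
  by rewrite le_eqVlt; apply/orP; left; apply/eqP; field; rewrite gt_eqF.
(* If [e] is of class [n], so is the Jacobian of [F] along [e], hence its inverse, which is the
   differential of [e]; thus [e] is of class [n.+1]. *)
have Ce n : Cn_on n V e.
  elim: n => [|n IH].
    by move=> y /de[dy _]; exact: differentiable_continuous.
  split=> [y /de[]//|v].
  have CJ i j : Cn_on n V (fun y => J (e y) i j).
    have CU : Cn_on n U (fun x => J x i j).
      have h := sUF n.+1; case: h => _ /(_ (delta_mx 0 i)) h.
      have h2 : Cn_on n U (fun x => ('d F x (delta_mx 0 i)) 0 j).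
        apply: (Cn_on_linear_comp (L := coord_fun j : {linear _ -> _}) oU _ h).
        by move=> y; exact: coord_continuous.
      apply: eq_Cn_on h2 => // x _; rewrite d_jacobian -rowE mxE; exact: erefl.
    exact: Cn_on_comp_rV oV oU VU IH CU.
  have Cdet : Cn_on n V (fun y => (\det (J (e y)))^-1).
    apply: Cn_onV => //; last exact: Cn_on_det.
    move=> y Vy; rewrite -unitfE -unitmxE; apply: uJ.
    by have /VP/ltW/eP[] := Vy.
  (* By Cramer's formula the entries of the inverse matrix are polynomials in the entries divided by
     the determinant. *)
  have Ccof i j : Cn_on n V (fun y => cofactor (J (e y)) i j).
    apply: Cn_onM => //; first exact: Cn_on_cst.
    apply: Cn_on_det => // i' j'; have := CJ (lift i i') (lift j j').
    by apply: eq_Cn_on => // y _; rewrite !mxE.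
  have Cinv : Cn_on n V (fun y => v *m invmx (J (e y))).
    apply: Cn_on_row => // i.
    have := @Cn_on_sum R _ _ n V _ (index_enum _) predT _ oV (fun j _ =>
      Cn_onM oV (Cn_on_cst n V (v 0 j)) (Cn_onM oV Cdet (Ccof i j))).
    apply: eq_Cn_on => // y Vy; rewrite mxE; apply: eq_bigr => j _.
    rewrite /invmx uJ; last by have /VP/ltW/eP[] := Vy.
    apply: congr1; apply: esym.
    have -> : ((\det (J (e y)))^-1 *: \adj (J (e y))) j i =
      (\det (J (e y)))^-1 * (\adj (J (e y))) j i by exact: mxE.
    by congr (_ * _); exact: mxE.
  apply: (eq_Cn_on oV _ Cinv) => y Vy; have [_ E] := de y Vy.
  exact: (esym (congr1 (fun h => h v) E)).
exists e; split=> //; first by exists V.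
split; last first.
  have nV : \forall x \near (0 : 'rV[R]_m.+1), V x by exact: open_nbhs_nbhs.
  by apply: filterS nV => y /VP/ltW/eP[].
have nU : \forall x \near (0 : 'rV[R]_m.+1), U x.
  by apply: open_nbhs_nbhs; split=> //; apply/UP; rewrite normr0.
have nF : \forall x \near (0 : 'rV[R]_m.+1), V (F x).
  by apply: (smooth_at_near_val sF F0); exact: open_nbhs_nbhs.
by apply: filterS2 nU nF => x /UP/ltW h1 /VP/ltW h2; exact: eF.
Unshelve. all: by end_near. Qed.

(** Composing with the inverse of the Jacobian at 0 reduces to a map whose differential at 0 is the
    identity. *)
Theorem inverse_function m (F : 'rV[R]_m.+1 -> 'rV[R]_m.+1) :
  smooth_at 0 F -> F 0 = 0 -> (forall v, 'd F 0 v = 0 -> v = 0) -> diffeo_germ F.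
Proof.
move=> sF F0 inj; have uJ := unitmx_jacobian inj; set A := 'J F 0 in uJ.
pose G x := F x *m invmx A.
have sG : smooth_at 0 G by exact: smooth_at_mulmx.
have G0 : G 0 = 0 by rewrite /G F0 mul0mx.
have dG v : 'd G 0 v = v.
  by rewrite d_mulmx ?d_jacobian ?mulmxK //; exact: smooth_at_diff.
have [e [_ se _ e0 [eG Ge]]] := inverse_function_normalized sG G0 dG.
exists (fun y => e (y *m invmx A)).
split=> //; rewrite ?mul0mx //.
  apply: (@smooth_at_comp R _ m m 0 (fun y => y *m invmx A) e).
    exact: smooth_at_mulmx (smooth_at_id _).
  by rewrite mul0mx.
split; first by apply: filterS eG.
have := smooth_at_near_val (smooth_at_mulmx (invmx A) (smooth_at_id 0)) (mul0mx _ _) Ge.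
apply: filterS => y.
by rewrite /= /G => /(congr1 (mulmx ^~ A)); rewrite !mulmxKV.
Qed.

Lemma diffeo_germ_comp m (d1 d2 : 'rV[R]_m.+1 -> 'rV[R]_m.+1) :
  diffeo_germ d1 -> diffeo_germ d2 -> diffeo_germ (fun x => d2 (d1 x)).
Proof.
move=> [e1 [s1 t1 d10 e10 [ed1 de1]]] [e2 [s2 t2 d20 e20 [ed2 de2]]].
exists (fun x => e1 (e2 x)); split.
- by apply: (@smooth_at_comp R _ m m 0 d1 d2) => //; rewrite d10.
- by apply: (@smooth_at_comp R _ m m 0 e2 e1) => //; rewrite e20.
- by rewrite d10.
- by rewrite e20.
split.
  have h := smooth_at_near_val s1 d10 ed2.
  by apply: filterS2 ed1 h => x /= h1 ->.
have h := smooth_at_near_val t2 e20 de1.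
by apply: filterS2 de2 h => x /= h1 ->.
Qed.

(** Differentiating [e (d q) = q] at [p] gives a left inverse of the differential. This needs the
    identity in a neighbourhood of each [p], which is what [near_join] supplies. *)
Lemma diffeo_germ_d_inj m (d : 'rV[R]_m.+1 -> 'rV[R]_m.+1) : diffeo_germ d ->
  \forall p \near (0 : 'rV[R]_m.+1), forall v, 'd d p v = 0 -> v = 0.
Proof.
move=> [e [sd se d0 e0 [ed de]]].
have ne := smooth_at_near_val sd d0 (smooth_at_near se).
have ned : \forall p \near (0 : 'rV[R]_m.+1), \forall q \near p, e (d q) = q.
  exact: near_join.
have nd := smooth_at_near sd.
near=> p => v dv.
have h1 : smooth_at p d by near: p.
have h2 : smooth_at (d p) e by near: p.
have h3 : \forall q \near p, e (d q) = q by near: p.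
have s := smooth_at_comp h1 h2.
have E := d_near v h3 (smooth_at_diff s).
have E2 := d_comp v (smooth_at_diff h1) (smooth_at_diff h2).
apply: etrans (esym (d_id p v)) (etrans (esym E) (etrans E2 _)).
exact: (etrans (congr1 ('d e (d p)) dv) (linear0 _)).
Unshelve. all: by end_near. Qed.

End InverseFunction.

(** * Whitney's theorem on even functions *)

Section AbsSeries.
Context {R : realType}.
Implicit Types u v : nat -> R.

Variant abscv u : Prop := Abscv of cvgn (series (fun k => `|u k|)).
Definition tsum u : R := limn (series u).

Lemma abscv_cvg u : abscv u -> cvgn (series u).
Proof. by move=> [cu]; apply: (@normed_cvg R R u). Qed.

Lemma abscv_le u v M : abscv v -> (forall k, `|u k| <= M * `|v k|) -> abscv u.
Proof.
move=> [cv] uv; constructor; apply: (@series_le_cvg _ _ (fun k => `|M| * `|v k|)).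
- by move=> k; exact: normr_ge0.
- by move=> k; rewrite mulr_ge0.
- move=> k; apply: le_trans (uv k) _; apply: ler_wpM2r => //; exact: ler_norm.
- exact: (@is_cvg_seriesZ _ (fun k => `|v k|) `|M| cv).
Qed.

Lemma tsum_le u v M : abscv v -> (forall k, `|u k| <= M * `|v k|) ->
  `|tsum u| <= M * tsum (fun k => `|v k|).
Proof.
move=> cv uv; have [cu] := abscv_le cv uv; case: cv => cv.
apply: le_trans (lim_series_norm (V := R) cu) _.
have -> : M * tsum (fun k => `|v k|) = limn (series (M *: (fun k => `|v k|) : nat -> R)).
  by rewrite lim_seriesZ.
by apply: lim_series_le => //; exact: is_cvg_seriesZ.
Qed.

Lemma abscvZ u c : abscv u -> abscv (fun k => c * u k).
Proof. by move=> cu; apply: (@abscv_le _ _ `|c| cu) => k; rewrite normrM. Qed.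

Lemma abscvD u v : abscv u -> abscv v -> abscv (fun k => u k + v k).
Proof.
move=> [cu] [cv]; have := is_cvg_seriesD cu cv => cuv.
constructor; apply: series_le_cvg cuv => k; first exact: normr_ge0.
  by apply: addr_ge0; exact: normr_ge0.
exact: ler_normD.
Qed.

Lemma tsumZ u c : abscv u -> tsum (fun k => c * u k) = c * tsum u.
Proof. by move=> /abscv_cvg cu; exact: (@lim_seriesZ _ u c cu). Qed.

Lemma tsumD u v : abscv u -> abscv v ->
  tsum (fun k => u k + v k) = tsum u + tsum v.
Proof. by move=> /abscv_cvg cu /abscv_cvg cv; exact: (lim_seriesD cu cv). Qed.

Lemma abscv_shift u : abscv u -> abscv (fun k => u k.+1).
Proof.
move=> [cu]; constructor.
have -> : series (fun k => `|u k.+1|) =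
    [sequence series (fun k => `|u k|) n.+1 - `|u 0%N|]_n.
  apply/funext => n; rewrite /series /= !big_mkord big_ord_recl addrC addKr.
  by [].
apply: is_cvgB; last exact: is_cvg_cst.
by apply/cvg_ex; exists (limn (series (fun k => `|u k|))); rewrite cvg_shiftS.
Qed.

Lemma tsum_shift u : abscv u -> tsum u = u 0%N + tsum (fun k => u k.+1).
Proof.
move=> cu; have cs := abscv_cvg (abscv_shift cu); have c := abscv_cvg cu.
rewrite /tsum; apply: (@cvg_lim R) => //.
rewrite -cvg_shiftS.
have -> : [sequence series u n.+1]_n = (fun n => u 0%N + series (fun k => u k.+1) n).
  by apply/funext => n; rewrite /series /= !big_mkord big_ord_recl.
by apply: cvgD; [exact: cvg_cst|exact: cs].
Qed.

Lemma abscv_geometric_bound u K :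
  (forall k, `|u k| <= K * 2^-1 ^+ k) -> abscv u.
Proof.
move=> H; have c : abscv (fun k => 2^-1 ^+ k : R).
  constructor; apply: (@series_le_cvg _ _ (geometric 1 2^-1)).
  - by move=> k; exact: normr_ge0.
  - by move=> k; rewrite /geometric /= mul1r exprn_ge0.
  - by move=> k; rewrite /geometric /= mul1r ger0_norm // exprn_ge0.
  - by apply: is_cvg_geometric_series; rewrite ger0_norm // invf_lt1 // ltr1n.
by apply: (abscv_le c) => k; rewrite [`|_ ^+ _|]ger0_norm // exprn_ge0.
Qed.

Lemma abscv_ratio u N : (forall k, (N <= k)%N -> `|u k.+1| <= 2^-1 * `|u k|) ->
  abscv u.
Proof.
(* [K] is large enough to cover every term up to index [N]; beyond it the ratio hypothesis
   propagates the geometric bound. *)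
move=> H; pose K := \sum_(i < N.+1) `|u i| * 2 ^+ i.
have hK k : `|u k| <= K * 2^-1 ^+ k.
  elim: k => [|k IH].
    rewrite expr0 mulr1 /K big_ord_recl expr0 mulr1 lerDl.
    by apply: sumr_ge0 => i _; rewrite mulr_ge0 // exprn_ge0.
  have [Nk|kN] := leqP N k.
    apply: le_trans (H k Nk) _; rewrite exprS mulrCA; exact: ler_wpM2l.
  rewrite exprVn ler_pdivlMr ?exprn_gt0 // /K.
  rewrite (bigD1 (Ordinal (kN : k.+1 < N.+1)%N)) //= lerDl.
  by apply: sumr_ge0 => i _; rewrite mulr_ge0 // exprn_ge0.
exact: abscv_geometric_bound hK.
Qed.

End AbsSeries.

(** * Coefficients of Seeley's reflection formula *)

Section SeeleyCoefficients.
Context {R : realType}.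

(** The ratio of the dilations in the reflection formula. A value this large makes the tail of
    [acoef] smaller than its first term, as [tsum_acoef0] requires. *)
Definition lam : R := 16.

Lemma lam_ge1 n : 1 <= lam ^+ n.
Proof. by rewrite exprn_ege1 // /lam; lra. Qed.

(* Taylor coefficients of [\prod_j (1 - z / lam ^ j)], which vanishes at every
   [lam ^ n]; they are determined by [p (lam z) = (1 - lam z) p z]. *)
Fixpoint pcoef (k : nat) : R :=
  if k is j.+1 then pcoef j * (- lam / (lam ^+ k - 1)) else 1.

(* Coefficients of the solution of [A (lam z) + A z = p z]. *)
Definition acoef (k : nat) : R := pcoef k / (lam ^+ k + 1).

Lemma pcoefS k : pcoef k.+1 * (lam ^+ k.+1 - 1) = - lam * pcoef k.
Proof.
have := lam_ge1 k; rewrite /= exprS => h; have : 0 < lam * lam ^+ k - 1.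
  by rewrite subr_gt0 /lam; lra.
by move=> h2; field; rewrite gt_eqF.
Qed.

Lemma pcoef_ratio k : `|pcoef k.+1| <= (lam / (lam ^+ k.+1 - 1)) * `|pcoef k|.
Proof.
have h : 0 < lam ^+ k.+1 - 1 by have := lam_ge1 k; rewrite exprS /lam; lra.
rewrite /= normrM mulrC ler_wpM2r // mulNr normrN ger0_norm //.
by rewrite divr_ge0 // ?ltW // /lam; lra.
Qed.

(** The ratio of consecutive terms is in absolute value [lam ^+ m.+1 / (lam ^+ k.+1 - 1)], which is
    at most 1/2 from [k = m.+1] on. *)
Lemma abscv_pcoef m : abscv (fun k => (lam ^+ m) ^+ k * pcoef k).
Proof.
apply: (@abscv_ratio _ _ m.+1) => k mk.
rewrite (normrM _ (pcoef k.+1)) (normrM _ (pcoef k)) exprS normrM.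
have h : 0 < lam ^+ k.+1 - 1 by have := lam_ge1 k; rewrite exprS /lam; lra.
have hm := lam_ge1 m.
have h2 : lam ^+ m * (lam / (lam ^+ k.+1 - 1)) <= 2^-1.
  rewrite mulrA ler_pdivrMr //.
  have : lam ^+ m.+1 * lam <= lam ^+ k.+1.
    by rewrite -exprSr; apply: ler_weXn2l => //; rewrite /lam; lra.
  by rewrite [lam ^+ m.+1]exprS /lam; lra.
rewrite (ger0_norm (le_trans ler01 hm)) mulrA -!mulrA mulrCA [X in _ <= X]mulrCA.
apply: ler_wpM2l => //.
apply: (@le_trans _ _ (lam ^+ m * (lam / (lam ^+ k.+1 - 1)) * `|pcoef k|)).
  by rewrite -mulrA; apply: ler_wpM2l (pcoef_ratio k); lra.
exact: ler_wpM2r.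
Qed.

Lemma acoef_le k : `|acoef k| <= `|pcoef k|.
Proof.
have h := lam_ge1 k; have h2 : 1 <= lam ^+ k + 1 by lra.
rewrite /acoef normrM normfV (ger0_norm (le_trans ler01 h2)).
by rewrite ler_pdivrMr ?ler_peMr //; lra.
Qed.

Lemma abscv_acoef m : abscv (fun k => (lam ^+ m) ^+ k * acoef k).
Proof.
apply: (abscv_le (abscv_pcoef m) (M := 1)) => k.
by rewrite mul1r (normrM _ (acoef k)) (normrM _ (pcoef k)) ler_wpM2l // acoef_le.
Qed.

(** The functional equation [p (lam z) = (1 - lam z) p z] at [z = 1 / lam] gives [p 1 = 0], and then
    propagates the zero from [lam ^+ m] to [lam ^+ m.+1]. *)
Lemma tsum_pcoef m : tsum (fun k => (lam ^+ m) ^+ k * pcoef k) = 0.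
Proof.
have key z : abscv (fun k => z ^+ k * pcoef k) -> abscv (fun k => (lam * z) ^+ k * pcoef k) ->
    tsum (fun k => (lam * z) ^+ k * pcoef k) =
      (1 - lam * z) * tsum (fun k => z ^+ k * pcoef k).
  move=> cz clz.
  suff : tsum (fun k => (lam * z) ^+ k * pcoef k + (-1) * (z ^+ k * pcoef k)) =
      (- lam * z) * tsum (fun k => z ^+ k * pcoef k).
    rewrite tsumD //; last exact: abscvZ.
    rewrite tsumZ //; set u := tsum _; set v := tsum _ => E.
    have -> : u = (u + -1 * v) + v by ring.
    by rewrite E; ring.
  rewrite tsum_shift; last by apply: abscvD => //; exact: abscvZ.
  rewrite !expr0 mulN1r !mul1r subrr add0r -tsumZ //; congr tsum; apply/funext => k.
  have := pcoefS k; rewrite exprMn exprS => E.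
  transitivity (z ^+ k.+1 * (pcoef k.+1 * (lam * lam ^+ k - 1))); first by ring.
  by rewrite E exprS; ring.
have quarter : abscv (fun k => (lam^-1) ^+ k * pcoef k).
  apply: (abscv_le (abscv_pcoef 0) (M := 1)) => k.
  rewrite mul1r 2!(normrM _ (pcoef k)) ler_wpM2r // expr0 expr1n normr1 normrX exprn_ile1 //.
  by rewrite normfV ger0_norm ?invf_le1 /lam; lra.
have l0 : (lam : R) != 0 by rewrite /lam pnatr_eq0.
elim: m => [|m IH].
  have := key lam^-1 quarter; rewrite divff // subrr mul0r expr0; apply.
  exact: (abscv_pcoef 0).
have := key (lam ^+ m) (abscv_pcoef m); rewrite IH mulr0 -exprS; apply.
exact: abscv_pcoef.
Qed.

(** This is [A (lam z) + A z = p z] at [z = lam ^+ m], a zero of [p]. *)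
Lemma tsum_acoefS m : tsum (fun k => (lam ^+ m.+1) ^+ k * acoef k) =
  - tsum (fun k => (lam ^+ m) ^+ k * acoef k).
Proof.
apply/eqP; rewrite -addr_eq0 -tsumD; try exact: abscv_acoef.
apply/eqP; rewrite -(tsum_pcoef m); congr tsum; apply/funext => k.
have h := lam_ge1 k.
rewrite /acoef exprS exprMn; have : lam ^+ k + 1 != 0 by apply/eqP; lra.
by move=> h0; field.
Qed.

(** The first term is 1/2, and the others are bounded by [2^-1 ^+ k / 8], so they add up to at most
    1/4. *)
Lemma tsum_acoef0 : tsum acoef != 0.
Proof.
have c : abscv acoef.
  have := abscv_acoef 0; congr abscv; apply/funext => k.
  by rewrite expr0 expr1n mul1r.
have h2 k : `|acoef k.+1| <= 8^-1 * `|2^-1 ^+ k|.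
  have p2 j : 0 <= 2^-1 ^+ j :> R by rewrite exprn_ge0.
  rewrite (ger0_norm (p2 k)).
  have hp j : `|pcoef j.+1| <= 2 * 2^-1 ^+ j.
    elim: j => [|j IH].
      have -> : pcoef 1 = - (16 / 15) by rewrite /= /lam expr1; field.
      by rewrite normrN ger0_norm ?expr0; lra.
    apply: le_trans (pcoef_ratio j.+1) _.
    have hj := lam_ge1 j.
    have d : 0 < lam ^+ j.+2 - 1 by rewrite !exprS /lam; lra.
    have r2 : lam / (lam ^+ j.+2 - 1) <= 2^-1.
      by rewrite ler_pdivrMr // !exprS /lam; lra.
    have r0 : 0 <= lam / (lam ^+ j.+2 - 1) by rewrite divr_ge0 ?ltW // /lam; lra.
    rewrite [2^-1 ^+ _]exprS mulrCA; exact: ler_pM.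
  have hk := lam_ge1 k.
  rewrite /acoef normrM normfV (@ger0_norm _ (lam ^+ k.+1 + 1)); last by rewrite exprS /lam; lra.
  rewrite ler_pdivrMr; last by rewrite exprS /lam; lra.
  apply: le_trans (hp k) _; rewrite mulrAC; apply: ler_wpM2r => //.
  by rewrite exprS /lam; lra.
have c2 : abscv (fun k => 2^-1 ^+ k : R).
  by apply: (@abscv_geometric_bound _ _ 1) => k; rewrite mul1r ger0_norm ?exprn_ge0.
have h3 := tsum_le c2 h2.
have h4 : tsum (fun k => `|2^-1 ^+ k : R|) = 2.
  have -> : (fun k => `|2^-1 ^+ k : R|) = geometric 1 2^-1.
    by apply/funext => k; rewrite /geometric /= mul1r ger0_norm // exprn_ge0.
  have := @cvg_geometric_series R 1 2^-1 => H.
  transitivity (1 * (1 - 2^-1)^-1 : R); last by field.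
  apply: (@cvg_lim R) => //; apply: H.
  by rewrite ger0_norm // invf_lt1 // ltr1n.
rewrite h4 in h3; rewrite tsum_shift //.
have a0 : acoef 0 = 2^-1 by rewrite /acoef /= expr0 div1r.
rewrite a0; apply/eqP => E.
have E2 : tsum (fun k => acoef k.+1) = - 2^-1.
  by apply/eqP; rewrite -addr_eq0 addrC E.
by move: h3; rewrite E2 normrN ger0_norm //; lra.
Qed.

(** Reflecting with dilation [lam ^+ k] multiplies the m-th derivative at 0 by [(- lam ^+ k) ^+ m].
    The second condition says that these factors, weighted by [a k], add up to 1 for every [m], so
    all one-sided derivatives match. *)
Definition seeley (a : nat -> R) :=
  (forall m, abscv (fun k => (lam ^+ m) ^+ k * a k)) /\
  (forall m, tsum (fun k => (lam ^+ m) ^+ k * a k) = (-1) ^+ m).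

Lemma seeley_exists : exists a, seeley a.
Proof.
exists (fun k => (tsum acoef)^-1 * acoef k); split => m.
  have := abscvZ (tsum acoef)^-1 (abscv_acoef m).
  by congr abscv; apply/funext => k; rewrite mulrCA.
have -> : (fun k => (lam ^+ m) ^+ k * ((tsum acoef)^-1 * acoef k)) =
   (fun k => (tsum acoef)^-1 * ((lam ^+ m) ^+ k * acoef k)).
  by apply/funext => k; rewrite mulrCA.
rewrite tsumZ; last exact: abscv_acoef.
elim: m => [|m IH].
  have -> : (fun k => (lam ^+ 0) ^+ k * acoef k) = acoef.
    by apply/funext => k; rewrite expr0 expr1n mul1r.
  by rewrite mulVf ?tsum_acoef0.
by rewrite tsum_acoefS mulrN IH exprS mulN1r.
Qed.

(** The new coefficients are those of the reflected series after one derivative in [w]. That they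
    satisfy the same conditions makes the class of extensions closed under this derivative. *)
Lemma seeley_shift a : seeley a -> seeley (fun k => - lam ^+ k * a k).
Proof.
move=> [ca ta].
have E m : (fun k => (lam ^+ m) ^+ k * (- lam ^+ k * a k)) =
    (fun k => -1 * ((lam ^+ m.+1) ^+ k * a k)).
  by apply/funext => k; rewrite [lam ^+ m.+1]exprS exprMn; ring.
split=> m; rewrite E; first exact: abscvZ.
by rewrite tsumZ // ta exprS mulrA mulN1r opprK mul1r.
Qed.

Lemma seeley_abscv a m : seeley a -> abscv (fun k => (lam ^+ m) ^+ k * a k).
Proof. by case. Qed.

Lemma seeley_abscv0 a : seeley a -> abscv a.
Proof.
move=> [/(_ 0%N) ca _]; move: ca; congr abscv; apply/funext => k.
by rewrite expr0 expr1n mul1r.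
Qed.

Lemma seeley_sum a : seeley a -> tsum a = 1.
Proof.
move=> [_ /(_ 0%N) H].
transitivity (tsum (fun k => (lam ^+ 0) ^+ k * a k)); last by rewrite H expr0.
by congr tsum; apply/funext => k; rewrite expr0 expr1n mul1r.
Qed.

End SeeleyCoefficients.

(** * Even functions in the variable w *)

Section EvenFunctions.
Context {R : realType}.
Implicit Types E T : 'rV[R]_2 -> R.

Lemma Cn_on_local (V W : normedModType R) n (U : set V) (f : V -> W) :
  (forall x, U x -> exists U', [/\ open U', U' x & Cn_on n U' f]) -> Cn_on n U f.
Proof.
elim: n f => [|n IH] f H.
  by move=> x /H[U' [_ U'x]]; apply.
split=> [x /H[U' [_ U'x [h _]]]|v]; first exact: h.
by apply: IH => x /H[U' [oU' U'x [_ h]]]; exists U'; split=> //; exact: h.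
Qed.

Lemma smooth_on_local (V W : normedModType R) (U : set V) (f : V -> W) :
  (forall x, U x -> smooth_at x f) -> smooth_on U f.
Proof.
move=> H n; apply: Cn_on_local => x /H[U' [oU' U'x h]]; by exists U'.
Qed.

(** Radius 2 leaves room around the closed unit box, on which continuous functions are then
    uniformly bounded and where all slices take their values. *)
Record even_box E : Prop := EvenBox {
  even_smooth : forall p, box 2 p -> smooth_at p E;
  even_even : forall x y : R, `|x| < 2 -> `|y| < 2 ->
    E (row2 x (- y)) = E (row2 x y) }.

Lemma box2P (x y : R) : `|x| < 2 -> `|y| < 2 -> box 2 (row2 x y).
Proof. by move=> hx hy; split; rewrite rcE. Qed.

Lemma is_derive_fst E (x y : R) : differentiable E (row2 x y) ->
  is_derive x 1 (fun s => E (row2 s y)) ('d E (row2 x y) (delta_mx 0 0)).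
Proof.
move=> dE.
have := is_derive_curve (a := fun s => s) (b := fun _ => y) dE
  (smooth_at_id x) (smooth_at_cst x _).
by rewrite d_id d_cst -delta2_0.
Qed.

Lemma is_derive_snd E (x y : R) : differentiable E (row2 x y) ->
  is_derive y 1 (fun s => E (row2 x s)) ('d E (row2 x y) (delta_mx 0 1)).
Proof.
move=> dE.
have := is_derive_curve (a := fun _ => x) (b := fun s => s) dE
  (smooth_at_cst y _) (smooth_at_id y).
by rewrite d_id d_cst -delta2_1.
Qed.

Lemma near_norm_lt (x r : R) : `|x| < r -> \forall s \near x, `|s| < r.
Proof.
move=> hx; have : (fun s : R => `|s|) @ x --> `|x| by exact: norm_continuous.
by move/cvgr_lt; apply.
Qed.

Lemma even_box_dx E : even_box E -> even_box (fun p => 'd E p (delta_mx 0 0)).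
Proof.
move=> [sE eE]; split=> [p bp|x y hx hy]; first exact: smooth_at_d (sE p bp).
have hy' : `|- y| < 2 by rewrite normrN.
have H1 := is_derive_fst (smooth_at_diff (sE _ (box2P hx hy))).
have H2 := is_derive_fst (smooth_at_diff (sE _ (box2P hx hy'))).
apply: etrans (esym (@derive_val _ _ _ _ _ _ _ H2)) _.
apply: etrans (@derive_val _ _ _ _ _ _ _ H1).
apply: near_eq_derive; have := near_norm_lt hx.
by apply: filterS => s hs; exact: eE.
Qed.

Lemma even_box_dy E : even_box E ->
  forall x y : R, `|x| < 2 -> `|y| < 2 ->
    'd E (row2 x (- y)) (delta_mx 0 1) = - 'd E (row2 x y) (delta_mx 0 1).
Proof.
move=> [sE eE] x y hx hy; have hy' : `|- y| < 2 by rewrite normrN.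
have dE := smooth_at_diff (sE _ (box2P hx hy')).
have H1 := is_derive_snd (smooth_at_diff (sE _ (box2P hx hy))).
have sN : smooth_at y (fun s : R => - s) by apply: smooth_atN; exact: smooth_at_id.
have H2 := is_derive_curve (a := fun=> x) (b := fun s => - s) dE (smooth_at_cst y _) sN.
have E1 : 'd (fun s : R => - s) y 1 = -1.
  by rewrite d_opp ?d_id //; exact: smooth_at_diff (smooth_at_id y).
have E2 : row2 ('d (fun=> x) y 1) ('d (fun s : R => - s) y 1) = - delta_mx 0 1 :> 'rV[R]_2.
  by rewrite d_cst E1 delta2_1; apply/rowP; apply: ord2P; rewrite [RHS]mxE !rcE ?oppr0.
have E3 : 'd E (row2 x (- y)) (row2 ('d (fun=> x) y 1) ('d (fun s : R => - s) y 1)) =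
    - 'd E (row2 x (- y)) (delta_mx 0 1).
  exact: etrans (congr1 ('d E (row2 x (- y))) E2) (linearN _ _).
apply: oppr_inj; rewrite opprK; apply: etrans (esym E3) _.
apply: etrans (esym (@derive_val _ _ _ _ _ _ _ H2)) _.
apply: etrans (@derive_val _ _ _ _ _ _ _ H1).
apply: near_eq_derive; have := near_norm_lt hy.
by apply: filterS => s hs; exact: eE.
Qed.

(** [T] is the derivative of [E] with respect to [y ^+ 2]. The derivative in [y] is odd, hence zero
    on the axis, so Hadamard's formula divides it by [y]; the quotient of two odd functions is
    even. *)
Lemma even_box_T E : even_box E -> exists T, even_box T /\
  forall x y : R, `|x| < 2 -> `|y| < 2 ->
    'd E (row2 x y) (delta_mx 0 1) = 2 * y * T (row2 x y).
Proof.
move=> eE; have [sE _] := eE.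
pose E1 p := 'd E p (delta_mx 0 1).
pose E2 p := 'd E1 p (delta_mx 0 1).
have sE1 : smooth_on (box 2) E1.
  by apply: smooth_on_local => p bp; exact: smooth_at_d (sE p bp).
pose T (p : 'rV[R]_2) : R := 2^-1 * avg 0 E2 (p 0 0) (p 0 1).
have sE2 : smooth_on (box 2) E2.
  by move=> n; have [_] := sE1 n.+1; exact.
have TE (x y : R) : `|x| < 2 -> `|y| < 2 -> E1 (row2 x y) = 2 * y * T (row2 x y).
  move=> hx hy; have h0 : `|0 : R| < 2 by rewrite normr0.
  have E00 : row2 x (- 0) = row2 x 0 :> 'rV[R]_2 by rewrite oppr0.
  have E0 : E1 (row2 x 0) = - E1 (row2 x 0).
    exact: etrans (esym (congr1 E1 E00)) (even_box_dy eE hx h0).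
  have {}E0 : E1 (row2 x 0) = 0 by move: (E1 _) E0 => z hz; lra.
  apply: etrans (avg_FTC sE1 hx hy) _.
  have -> : T (row2 x y) = 2^-1 * avg 0 E2 x y by rewrite /T !rcE.
  by rewrite E0 add0r mulrACA divff ?pnatr_eq0 // mul1r.
exists T; split; last exact: TE.
split=> [p [h0 h1]|x y hx hy].
  apply: smooth_atM; first exact: smooth_at_cst.
  (* The radius [r] lies halfway between the size of [p] and 2, since an average is smooth only on
     strictly smaller boxes. *)
  pose s := Num.max `|p 0 0| `|p 0 1|; pose r := (s + 2) / 2.
  have s2 : s < 2 by rewrite /s gt_max h0.
  have r2 : r < 2 by rewrite /r; lra.
  exists (box r); split; first exact: open_box.
    have sr : s < r by rewrite /r; lra.
    by split; apply: le_lt_trans sr; rewrite /s le_max lexx ?orbT.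
  exact: avg_smooth r2 sE2.
have [->|y0] := eqVneq y 0; first by rewrite oppr0.
have hy' : `|- y| < 2 by rewrite normrN.
have H : 2 * (- y) * T (row2 x (- y)) = - (2 * y * T (row2 x y)).
  exact: etrans (esym (TE x (- y) hx hy')) (etrans (even_box_dy eE hx hy) (congr1 -%R (TE x y hx hy))).
apply: (@mulfI _ (2 * y)); first by rewrite mulf_neq0 // pnatr_eq0.
by move: (T (row2 x (- y))) (T (row2 x y)) H => A B H; lra.
Qed.

(** Here [T] is the derivative of [E] with respect to [w = y ^ 2 / (1 - y ^ 2)]: the derivative of
    [w] with respect to [y ^ 2] is [(1 - y ^ 2) ^ (-2)]. *)
Lemma even_box_D E : even_box E -> exists T, even_box T /\
  forall x y : R, `|x| < 2 -> `|y| < 2 ->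
    'd E (row2 x y) (delta_mx 0 1) * (1 - y ^+ 2) ^+ 2 = 2 * y * T (row2 x y).
Proof.
move=> /even_box_T[T [[sT eT] HT]].
exists (fun p : 'rV[R]_2 => (1 - p 0 1 ^+ 2) ^+ 2 * T p); split; last first.
  move=> x y hx hy; apply: etrans (congr1 ( *%R^~ _) (HT x y hx hy)) _.
  by rewrite !rcE; ring.
split=> [p bp|x y hx hy]; last by rewrite !rcE sqrrN eT.
apply: smooth_atM (sT p bp); apply: smooth_atX; apply: smooth_atB.
  exact: smooth_at_cst.
by apply: smooth_atX; exact: smooth_at_coord.
Qed.

Lemma even_box_bounded E : even_box E ->
  exists2 M, 0 <= M & forall x y : R, `|x| <= 1 -> `|y| <= 1 ->
    `|E (row2 x y)| <= M.
Proof.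
move=> [sE _]; apply: (@bounded_on_box R 1 2); first by rewrite ltr1n.
by move=> p bp; exact: smooth_at_cont (sE p bp).
Qed.

(* [w = y ^ 2 / (1 - y ^ 2)] maps [0, 1[ onto [0, +oo[, so that dilating [w]
   never leaves the domain of the even function. *)
Definition slice E (x w : R) := E (row2 x (Num.sqrt (w / (1 + w)))).

Lemma slice_arg (w : R) : 0 <= w -> 0 <= Num.sqrt (w / (1 + w)) < 1.
Proof.
move=> w0; rewrite sqrtr_ge0 /= -[X in _ < X]sqrtr1 ltr_sqrt //.
have h : 0 < 1 + w by lra.
by rewrite ltr_pdivrMr // mul1r; lra.
Qed.

Lemma slice_arg1 (w : R) : 0 <= w -> `|Num.sqrt (w / (1 + w))| <= 1.
Proof. by move=> /slice_arg/andP[h0 h1]; rewrite ger0_norm // ltW. Qed.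

Lemma slice_arg2 (w : R) : 0 <= w -> `|Num.sqrt (w / (1 + w))| < 2.
Proof. by move=> /slice_arg1 h; apply: le_lt_trans h _; rewrite ltr1n. Qed.

Lemma slice_bounded E : even_box E -> exists2 M, 0 <= M &
  forall x w : R, `|x| <= 1 -> 0 <= w -> `|slice E x w| <= M.
Proof.
move=> /even_box_bounded[M M0 H]; exists M => // x w hx w0.
by apply: H => //; exact: slice_arg1.
Qed.

Lemma slice_dx E : even_box E -> forall x w : R, `|x| < 2 -> 0 <= w ->
  is_derive x 1 (slice E ^~ w) (slice (fun p => 'd E p (delta_mx 0 0)) x w).
Proof.
move=> [sE _] x w hx w0; apply: is_derive_fst.
by apply: smooth_at_diff; apply: sE; apply: box2P => //; exact: slice_arg2.
Qed.

Lemma slice_continuous E : even_box E -> forall x w : R, `|x| < 2 -> 0 <= w ->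
  {for w, continuous (slice E x)}.
Proof.
move=> [sE _] x w hx w0.
have w1 : 1 + w != 0 by rewrite gt_eqF //; lra.
have s1 : smooth_at w (fun v : R => v / (1 + v)).
  apply: smooth_atM; first exact: smooth_at_id.
  apply: smooth_atV => //; apply: smooth_atD; [exact: smooth_at_cst|exact: smooth_at_id].
have c2 : {for w, continuous (fun v : R => Num.sqrt (v / (1 + v)))}.
  by apply: (@continuous_comp R R R (fun v : R => v / (1 + v)) Num.sqrt w
    (smooth_at_cont s1)); exact: sqrt_continuous.
have s3 : smooth_at (Num.sqrt (w / (1 + w))) (fun y => E (row2 x y)).
  apply: (@smooth_at_comp_scalar _ _ 1 _ (fun y => row2 x y) E).
    by apply: smooth_at_row2; [exact: smooth_at_cst|exact: smooth_at_id].
  by apply: sE; apply: box2P => //; exact: slice_arg2.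
exact: (@continuous_comp R R R (fun v : R => Num.sqrt (v / (1 + v)))
  (fun y => E (row2 x y)) w c2 (smooth_at_cont s3)).
Qed.

(** Only positive [w] is allowed, because the square root is not differentiable at 0. The point
    [w = 0] is reached afterwards through continuity and the mean value theorem. *)
Lemma slice_dw E T : even_box E ->
  (forall x y : R, `|x| < 2 -> `|y| < 2 ->
    'd E (row2 x y) (delta_mx 0 1) * (1 - y ^+ 2) ^+ 2 = 2 * y * T (row2 x y)) ->
  forall x w : R, `|x| < 2 -> 0 < w ->
  is_derive w 1 (slice E x) (slice T x w).
Proof.
move=> [sE _] HT x w hx w0; have w0' := ltW w0.
have w1 : 1 + w != 0 by rewrite gt_eqF //; lra.
pose s := Num.sqrt (w / (1 + w)).
have q0 : 0 < w / (1 + w) by rewrite divr_gt0 //; lra.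
have s0 : 0 < s by rewrite sqrtr_gt0.
have s2 : s ^+ 2 = w / (1 + w) by rewrite sqr_sqrtr // ltW.
have s1 : smooth_at w (fun v : R => v / (1 + v)).
  apply: smooth_atM; first exact: smooth_at_id.
  apply: smooth_atV => //; apply: smooth_atD; [exact: smooth_at_cst|exact: smooth_at_id].
have d1 : is_derive w 1 (fun v : R => v / (1 + v)) ((1 + w) ^- 2).
  have dV : is_derive w 1 (fun v : R => (1 + v)^-1) (- (1 + w) ^- 2).
    have dd : is_derive w 1 (fun v : R => 1 + v) 1.
      have H := is_deriveD (is_derive_cst (1 : R) w (1 : R)) (is_derive_id w (1 : R)).
      by apply: is_derive_eq H _; rewrite add0r.
    have := @is_deriveV _ (fun v : R => 1 + v) w 1 1 w1 dd.
    by rewrite -[_ *: _]/(_ * _) mulr1.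
  have := is_deriveM (is_derive_id w (1 : R)) dV.
  move=> H; apply: is_derive_eq H _; rewrite -![_ *: _]/(_ * _).
  by field.
have d2 := is_derive1_sqrt q0; rewrite -/s in d2.
have d3 := is_derive_snd (smooth_at_diff (sE _ (box2P hx (slice_arg2 w0')))).
have d12 := @is_derive1_comp R Num.sqrt (fun v : R => v / (1 + v)) w _ _ d2 d1.
have := @is_derive1_comp R (fun y => E (row2 x y)) (fun v : R => Num.sqrt (v / (1 + v))) w _ _ d3 d12.
move=> H; apply: is_derive_eq H _.
have := HT x s hx (slice_arg2 w0').
have -> : 1 - s ^+ 2 = (1 + w)^-1 by rewrite s2; field.
rewrite /slice -/s.
move: ('d E _ _) => D E1.
have sn : s != 0 by rewrite gt_eqF.
have -> : T (row2 x s) = D * (1 + w)^-1 ^+ 2 / (2 * s) by rewrite E1; field.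
by field; rewrite sn w1.
Qed.

End EvenFunctions.

(** * Extension across w = 0 and Whitney's theorem *)

Section SeeleyExtension.
Context {R : realType}.
Implicit Types E T : 'rV[R]_2 -> R.

(** A remainder bound with an explicit constant can be summed over a series, so derivatives of
    series are established in this form. *)
Lemma quad_is_derive (f : R -> R) (x L C : R) :
  (\forall y \near x, `|f y - f x - L * (y - x)| <= C * (y - x) ^+ 2) ->
  is_derive x 1 f L.
Proof.
move=> H.
have D : is_diff x f ( *:%R L : {linear R -> R}).
  apply: is_diff_eps => [|e e0]; first exact: scaler_continuous.
  have H2 : \forall h \near (0 : R), `|f (h + x) - f x - L * h| <= C * h ^+ 2.
    move: H; rewrite (near_shift 0 x) /= => H.
    apply: filterS H => h /=; rewrite subr0.
    by rewrite addrK.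
  have d0 : 0 < e / (`|C| + 1) by rewrite divr_gt0 // ltr_wpDl.
  near=> h.
  have h1 : `|f (h + x) - f x - L * h| <= C * h ^+ 2 by near: h.
  have h2 : `|h| <= e / (`|C| + 1) by near: h; exact: (@near0_norm_le R R _ d0).
  apply: le_trans h1 _.
  apply: (@le_trans _ _ (`|C| * `|h| * `|h|)).
    rewrite -mulrA -expr2 -normrX [`|h ^+ 2|]ger0_norm ?sqr_ge0 //.
    by apply: ler_wpM2r; [exact: sqr_ge0|exact: ler_norm].
  apply: ler_wpM2r => //; move: h2; rewrite ler_pdivlMr ?ltr_wpDl // => h2.
  have := normr_ge0 h; have := normr_ge0 C; lra.
have [dD ED] := D.
exact: is_derive_eq (is_derive_d dD) (etrans (congr1 (fun h => h 1) ED) (mulr1 L)).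
Unshelve. all: by end_near. Qed.

(** The mean value theorem is used once for [f] and once for [f1]. It is taken as a hypothesis on a
    convex set [I] so that the result also holds at the end point of a half-line, where only one
    side is available. *)
Lemma second_order (f f1 f2 : R -> R) (I : set R) (M : R) :
  (forall a b c, I a -> I b -> a <= c <= b -> I c) ->
  (forall a b, I a -> I b -> a <= b -> exists2 c, a <= c <= b & f b - f a = f1 c * (b - a)) ->
  (forall a b, I a -> I b -> a <= b -> exists2 c, a <= c <= b & f1 b - f1 a = f2 c * (b - a)) ->
  (forall a, I a -> `|f2 a| <= M) ->
  forall a b, I a -> I b -> `|f b - f a - f1 a * (b - a)| <= M * (b - a) ^+ 2.
Proof.
move=> cI H1 H2 HM a b Ia Ib.
have M0 : 0 <= M by apply: le_trans (HM a Ia).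
have aux c : I c -> `|c - a| <= `|b - a| -> `|f1 c - f1 a| <= M * `|b - a|.
  move=> Ic hc; suff : `|f1 c - f1 a| <= M * `|c - a|.
    by move=> h; apply: le_trans h _; apply: ler_wpM2l.
  have [ac|/ltW ca] := leP a c.
    have [d hd ->] := H2 a c Ia Ic ac; rewrite normrM; apply: ler_wpM2r => //.
    by apply: HM; exact: cI hd.
  have [d hd E] := H2 c a Ic Ia ca; rewrite -normrN opprB E normrM.
  rewrite distrC; apply: ler_wpM2r => //; apply: HM; exact: cI hd.
have sq : `|b - a| * `|b - a| = (b - a) ^+ 2 by rewrite -normrM -expr2 ger0_norm ?sqr_ge0.
have [ab|/ltW ba] := leP a b.
  have [c hc ->] := H1 a b Ia Ib ab; case/andP: (hc) => h1 h2.
  rewrite -mulrBl normrM -sq mulrA; apply: ler_wpM2r => //.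
  apply: aux; first exact: (cI a b).
  by rewrite !ger0_norm ?subr_ge0 // lerD2r.
have [c hc E] := H1 b a Ib Ia ba; case/andP: (hc) => h1 h2.
have -> : f b - f a - f1 a * (b - a) = (f1 c - f1 a) * (b - a) by lra.
rewrite normrM -sq mulrA; apply: ler_wpM2r => //.
apply: aux; first exact: (cI b a).
by rewrite !ler0_norm ?subr_le0 // lerN2 lerD2r.
Qed.

(* For [w < 0] a series of values at reflected points, whose coefficients are
   chosen so that all one-sided derivatives agree at [w = 0]. *)
Definition seeley_ext E (a : nat -> R) (x w : R) : R :=
  if 0 <= w then slice E x w
  else tsum (fun k => a k * slice E x (lam ^+ k * (- w))).

Let lam0 k : 0 <= (lam : R) ^+ k.
Proof. exact: le_trans ler01 (lam_ge1 k). Qed.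

Let arg0 k (w : R) : w <= 0 -> 0 <= lam ^+ k * (- w).
Proof. by move=> w0; rewrite mulr_ge0 // oppr_ge0. Qed.

(** At [w = 0] both branches agree because the coefficients add up to 1; the series formula is thus
    valid on the closed half-line. *)
Lemma seeley_ext_neg E a (x w : R) : seeley a -> w <= 0 ->
  seeley_ext E a x w = tsum (fun k => a k * slice E x (lam ^+ k * (- w))).
Proof.
move=> sa; rewrite le_eqVlt => /orP[/eqP ->|w0]; last first.
  by rewrite /seeley_ext leNgt w0.
rewrite /seeley_ext lexx.
have -> : (fun k => a k * slice E x (lam ^+ k * - 0)) =
    (fun k => slice E x 0 * a k).
  by apply/funext => k; rewrite oppr0 mulr0 mulrC.
by rewrite tsumZ ?seeley_sum ?mulr1 //; exact: seeley_abscv0.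
Qed.

Lemma abscv_mul_bounded (a c : nat -> R) (M : R) : abscv a ->
  (forall k, `|c k| <= M) -> abscv (fun k => a k * c k).
Proof.
move=> ca cM; apply: (@abscv_le _ _ a M ca) => k.
by rewrite normrM mulrC ler_wpM2r.
Qed.

Lemma tsum_mul_bounded (a c : nat -> R) (M : R) : abscv a ->
  (forall k, `|c k| <= M) ->
  `|tsum (fun k => a k * c k)| <= M * tsum (fun k => `|a k|).
Proof.
move=> ca cM; apply: (tsum_le ca) => k.
by rewrite normrM mulrC ler_wpM2r.
Qed.

(** Gathers the remainder of a first-order expansion of a series into one series, to be bounded term
    by term. *)
Lemma tsum_affine (u v t : nat -> R) (c : R) : abscv u -> abscv v -> abscv t ->
  tsum u - tsum v - tsum t * c = tsum (fun k => u k + -1 * v k + - c * t k).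
Proof.
move=> cu cv ct; have cv' := abscvZ (-1) cv; have ct' := abscvZ (- c) ct.
rewrite tsumD //; last exact: abscvD.
rewrite tsumD // !tsumZ //; ring.
Qed.

Lemma tsum_norm_ge0 (a : nat -> R) : abscv a -> 0 <= tsum (fun k => `|a k|).
Proof.
move=> ca; have h k : `|a k| <= 1 * `|a k| by rewrite mul1r.
by have := tsum_le ca h; rewrite mul1r; apply: le_trans.
Qed.

Lemma seeley_ext_bounded E a : even_box E -> seeley a ->
  bounded_box 1 (seeley_ext E a).
Proof.
move=> eE sa; have [M M0 HM] := slice_bounded eE.
have ca := seeley_abscv0 sa; have t0 := tsum_norm_ge0 ca.
exists (M + M * tsum (fun k => `|a k|)) => x w hx hw.
have [w0|/ltW w0] := leP 0 w.
  rewrite /seeley_ext w0; apply: le_trans (HM x w (ltW hx) w0) _.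
  by rewrite lerDl mulr_ge0.
rewrite seeley_ext_neg //.
have h k : `|slice E x (lam ^+ k * - w)| <= M.
  by apply: HM; [exact: ltW|exact: arg0].
apply: le_trans (tsum_mul_bounded ca h) _; by rewrite lerDr.
Qed.

Let norm_lt2 (x : R) : `|x| < 1 -> `|x| < 2.
Proof. by move=> h; apply: lt_trans h _; rewrite ltr1n. Qed.

Lemma slice_second_order_x E : even_box E -> exists2 M, 0 <= M &
  forall x y w : R, `|x| < 1 -> `|y| < 1 -> 0 <= w ->
  `|slice E y w - slice E x w -
    slice (fun p => 'd E p (delta_mx 0 0)) x w * (y - x)| <= M * (y - x) ^+ 2.
Proof.
move=> eE; have eE1 := even_box_dx eE; have eE2 := even_box_dx eE1.
have [M M0 HM] := slice_bounded eE2; exists M => // x y w hx hy w0.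
have mvt (F : 'rV[R]_2 -> R) : even_box F -> forall a b : R, `|a| < 1 -> `|b| < 1 -> a <= b ->
    exists2 c, a <= c <= b & slice F b w - slice F a w =
      slice (fun p => 'd F p (delta_mx 0 0)) c w * (b - a).
  move=> eF a b ha hb ab.
  have D (t : R) : `|t| < 1 -> is_derive t 1 (slice F ^~ w) (slice (fun p => 'd F p (delta_mx 0 0)) t w).
    by move=> ht; apply: slice_dx => //; exact: norm_lt2.
  have [t||c cI E3] := @MVT_segment R (slice F ^~ w)
    (slice (fun p => 'd F p (delta_mx 0 0)) ^~ w) a b ab.
  - rewrite in_itv /= => /andP[/ltW h1 /ltW h2]; apply: D.
    by apply: (norm_lt_between ha hb); rewrite h1.
  - apply: continuous_in_subspaceT => t; rewrite inE /= in_itv /= => h.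
    have [dt _] := D t (norm_lt_between ha hb h).
    exact/differentiable_continuous/derivable1_diffP.
  - by exists c; [move: cI; rewrite in_itv|exact: E3].
apply: (@second_order (slice E ^~ w) (slice (fun p => 'd E p (delta_mx 0 0)) ^~ w)
  (slice (fun p => 'd (fun p => 'd E p (delta_mx 0 0)) p (delta_mx 0 0)) ^~ w)
  [set t : R | `|t| < 1] M) => //.
- by move=> a b c ha hb hc; exact: norm_lt_between hc.
- exact: mvt.
- exact: (mvt _ eE1).
- by move=> a /ltW ha; exact: HM.
Qed.

Lemma slice_second_order_w E T T' : even_box E -> even_box T -> even_box T' ->
  (forall x y : R, `|x| < 2 -> `|y| < 2 ->
    'd E (row2 x y) (delta_mx 0 1) * (1 - y ^+ 2) ^+ 2 = 2 * y * T (row2 x y)) ->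
  (forall x y : R, `|x| < 2 -> `|y| < 2 ->
    'd T (row2 x y) (delta_mx 0 1) * (1 - y ^+ 2) ^+ 2 = 2 * y * T' (row2 x y)) ->
  exists2 M, 0 <= M & forall x w v : R, `|x| < 1 -> 0 <= w -> 0 <= v ->
  `|slice E x v - slice E x w - slice T x w * (v - w)| <= M * (v - w) ^+ 2.
Proof.
move=> eE eT eT' HE HT.
have [M M0 HM] := slice_bounded eT'; exists M => // x w v hx w0 v0.
have mvt (F G : 'rV[R]_2 -> R) : even_box F ->
    (forall x y : R, `|x| < 2 -> `|y| < 2 ->
    'd F (row2 x y) (delta_mx 0 1) * (1 - y ^+ 2) ^+ 2 = 2 * y * G (row2 x y)) ->
    forall a b : R, 0 <= a -> 0 <= b -> a <= b ->
    exists2 c, a <= c <= b & slice F x b - slice F x a = slice G x c * (b - a).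
  move=> eF HF a b ha hb ab.
  have [t||c cI E3] := @MVT_segment R (slice F x) (slice G x) a b ab.
  - rewrite in_itv /= => /andP[h1 h2]; apply: (slice_dw eF HF); first exact: norm_lt2.
    exact: le_lt_trans h1.
  - apply: continuous_in_subspaceT => t; rewrite inE /= in_itv /= => /andP[h1 _].
    apply: (slice_continuous eF); first exact: norm_lt2.
    exact: le_trans h1.
  - by exists c; [move: cI; rewrite in_itv|exact: E3].
apply: (@second_order (slice E x) (slice T x) (slice T' x) [set t : R | 0 <= t] M) => //.
- by move=> a b c /= ha hb /andP[hc _]; exact: le_trans hc.
- exact: (mvt E T).
- exact: (mvt T T').
- by move=> a ha; apply: HM => //; exact: ltW.
Qed.

Lemma seeley_ext_dx E a (x w : R) : even_box E -> seeley a ->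
  `|x| < 1 -> `|w| < 1 ->
  is_derive x 1 (seeley_ext E a ^~ w)
    (seeley_ext (fun p => 'd E p (delta_mx 0 0)) a x w).
Proof.
move=> eE sa hx hw; have eE1 := even_box_dx eE.
have [w0|/ltW w0] := leP 0 w.
  rewrite /seeley_ext w0; apply: slice_dx => //; exact: norm_lt2.
have ca := seeley_abscv0 sa.
have [M M0 HM] := slice_bounded eE.
have [M1 M10 HM1] := slice_bounded eE1.
have [K K0 HK] := slice_second_order_x eE.
apply: (@quad_is_derive _ _ _ (K * tsum (fun k => `|a k|))).
have := near_norm_lt hx; apply: filterS => y hy.
rewrite !seeley_ext_neg // tsum_affine; first last.
- by apply: abscv_mul_bounded ca _ => k; apply: HM1; [exact: ltW|exact: arg0].
- by apply: abscv_mul_bounded ca _ => k; apply: HM; [exact: ltW|exact: arg0].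
- by apply: abscv_mul_bounded ca _ => k; apply: HM; [exact: ltW|exact: arg0].
(* Each term is now [a k] times a second-order remainder of one slice, bounded uniformly in [k]. *)
rewrite [X in tsum X](_ : _ = (fun k => a k *
   (slice E y (lam ^+ k * - w) - slice E x (lam ^+ k * - w) -
    slice (fun p => 'd E p (delta_mx 0 0)) x (lam ^+ k * - w) * (y - x)))); last first.
  by apply/funext => k; ring.
rewrite mulrAC; apply: tsum_mul_bounded => // k.
by apply: HK => //; exact: arg0.
Qed.

(** On either side of 0 the remainder is quadratic; for [w <= 0] the dilation costs a factor
    [lam ^+ (2 * k)] in the k-th term, absorbed by the convergence condition with [m = 2]. *)
Lemma seeley_ext_dw E T a (x w : R) : even_box E -> even_box T -> seeley a ->
  (forall x y : R, `|x| < 2 -> `|y| < 2 ->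
    'd E (row2 x y) (delta_mx 0 1) * (1 - y ^+ 2) ^+ 2 = 2 * y * T (row2 x y)) ->
  `|x| < 1 -> `|w| < 1 ->
  is_derive w 1 (seeley_ext E a x)
    (seeley_ext T (fun k => - lam ^+ k * a k) x w).
Proof.
move=> eE eT sa HE hx hw; have [T' [eT' HT]] := even_box_D eT.
have ca := seeley_abscv0 sa.
have sa' := seeley_shift sa; have ca' := seeley_abscv0 sa'.
have ca2 := seeley_abscv 2 sa.
have [M M0 HM] := slice_bounded eE.
have [M1 M10 HM1] := slice_bounded eT.
have [K K0 HK] := slice_second_order_w eE eT eT' HE HT.
(* [K] serves for [w >= 0] and [K * K2] for [w <= 0]; their sum is one constant valid on both
   sides. *)
pose K2 := tsum (fun k => `|(lam ^+ 2) ^+ k * a k|).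
have K20 : 0 <= K2 by exact: tsum_norm_ge0.
have pos v : 0 <= w -> 0 <= v ->
    `|seeley_ext E a x v - seeley_ext E a x w -
      seeley_ext T (fun k => - lam ^+ k * a k) x w * (v - w)| <=
      (K + K * K2) * (v - w) ^+ 2.
  move=> w0 v0; rewrite /seeley_ext w0 v0; apply: le_trans (HK _ _ _ hx w0 v0) _.
  by apply: ler_wpM2r; rewrite ?sqr_ge0 // lerDl mulr_ge0.
have neg v : w <= 0 -> v <= 0 ->
    `|seeley_ext E a x v - seeley_ext E a x w -
      seeley_ext T (fun k => - lam ^+ k * a k) x w * (v - w)| <=
      (K + K * K2) * (v - w) ^+ 2.
  move=> w0 v0; rewrite !seeley_ext_neg // tsum_affine; first last.
  - by apply: abscv_mul_bounded ca' _ => k; apply: HM1; [exact: ltW|exact: arg0].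
  - by apply: abscv_mul_bounded ca _ => k; apply: HM; [exact: ltW|exact: arg0].
  - by apply: abscv_mul_bounded ca _ => k; apply: HM; [exact: ltW|exact: arg0].
  rewrite [X in tsum X](_ : _ = (fun k => a k *
     (slice E x (lam ^+ k * - v) - slice E x (lam ^+ k * - w) -
      slice T x (lam ^+ k * - w) * (lam ^+ k * - v - lam ^+ k * - w)))); last first.
    by apply/funext => k; ring.
  apply: le_trans (tsum_le ca2 (M := K * (v - w) ^+ 2) _) _ => [k|].
    rewrite normrM [in X in _ <= X]normrM mulrC mulrA; apply: ler_wpM2r => //.
    apply: le_trans (HK _ _ _ hx (arg0 k w0) (arg0 k v0)) _.
    rewrite -mulrBr -mulrA; apply: ler_wpM2l => //.
    rewrite exprMn ger0_norm; last by rewrite exprn_ge0.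
    by rewrite -!exprM mulnC mulrC [_ - - _]addrC opprK -[in X in X <= _]sqrrN opprB.
  rewrite mulrAC; apply: ler_wpM2r; rewrite ?sqr_ge0 //.
  by rewrite lerDr.
apply: (@quad_is_derive _ _ _ (K + K * K2)).
(* Away from 0 nearby points lie on the same side. At 0 both estimates apply, since each includes
   the boundary, and together they give the two-sided derivative. *)
have [w0|w0|w0] := ltrgtP w 0.
- have := lt_nbhsl w0; apply: filterS => v v0; apply: neg; exact: ltW.
- have := lt_nbhsr w0; apply: filterS => v v0; apply: pos; exact: ltW.
- apply: filterS (near_norm_lt hw) => v _; have [v0|/ltW v0] := leP 0 v.
    by apply: pos; rewrite ?w0.
  by apply: neg; rewrite ?w0.
Qed.

(** The class for [smooth_coind] lets both the even function and the coefficients vary, because a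
    derivative in [w] changes both. *)
Lemma seeley_ext_smooth E a : even_box E -> seeley a ->
  smooth_on (box 1) (uncur (seeley_ext E a)).
Proof.
move=> eE sa.
pose P F := exists E a, [/\ even_box E, seeley a & F = seeley_ext E a].
apply: (@smooth_coind R P 1) => [F [E' [a' [eE' sa' ->]]]|F [E' [a' [eE' sa' ->]]]|].
- exact: seeley_ext_bounded.
- have [T [eT HT]] := even_box_D eE'.
  exists (seeley_ext (fun p => 'd E' p (delta_mx 0 0)) a').
  exists (seeley_ext T (fun k => - lam ^+ k * a' k)); split.
  + by exists (fun p => 'd E' p (delta_mx 0 0)), a'; split; [exact: even_box_dx|exact: sa'|exact: erefl].
  + by exists T, (fun k => - lam ^+ k * a' k); split; [exact: eT|exact: seeley_shift|exact: erefl].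
  + move=> x y hx hy; split; first exact: seeley_ext_dx.
    exact: seeley_ext_dw.
- by exists E, a.
Qed.

Theorem Whitney_even E : smooth_at 0 E ->
  (\forall p \near (0 : 'rV[R]_2), E p = E (row2 (p 0 0) (- p 0 1))) ->
  exists2 h, smooth_at 0 h &
    \forall p \near (0 : 'rV[R]_2), E p = h (row2 (p 0 0) (p 0 1 ^+ 2)).
Proof.
move=> sE eE.
have [r r0 Hr] := nbhs0_box (filterI (smooth_at_near sE) eE).
(* Dilating by [c] carries the box of radius 2 into the given box of radius [r]. *)
pose c := r / 2; have c0 : 0 < c by exact: divr_gt0.
have scale (x : R) : `|x| < 2 -> `|c * x| < r.
  move=> hx; rewrite normrM ger0_norm ?ltW // /c -mulrA.
  by rewrite -[X in _ < X]mulr1 ltr_pM2l //; lra.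
pose E' (p : 'rV[R]_2) := E (row2 (c * p 0 0) (c * p 0 1)).
have eE' : even_box E'.
  split=> [p [h0 h1]|x y hx hy].
    apply: (@smooth_at_comp_scalar _ _ 1 p (fun p => row2 (c * p 0 0) (c * p 0 1)) E).
      by apply: smooth_at_row2; apply: smooth_atM; [exact: smooth_at_cst|exact: smooth_at_coord
        |exact: smooth_at_cst|exact: smooth_at_coord].
    by have [] // := Hr (row2 (c * p 0 0) (c * p 0 1)); split; rewrite rcE scale.
  rewrite /E' !rcE mulrN.
  have [|_] := Hr (row2 (c * x) (c * y)); first by split; rewrite rcE scale.
  by rewrite !rcE.
have [a sa] := @seeley_exists R.
have sh := seeley_ext_smooth eE' sa.
(* With [s] the rescaled second coordinate, [s / (1 - s)] is the variable [w] of the slices; at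
   [s = (y / c) ^ 2] this undoes the dilation and the substitution. *)
pose h (p : 'rV[R]_2) := uncur (seeley_ext E' a)
  (row2 (c^-1 * p 0 0) (c^-2 * p 0 1 / (1 - c^-2 * p 0 1))).
exists h.
  apply: (@smooth_at_comp_scalar _ _ 1 0 (fun p : 'rV[R]_2 =>
    row2 (c^-1 * p 0 0) (c^-2 * p 0 1 / (1 - c^-2 * p 0 1)))).
    have s1 : smooth_at 0 (fun p : 'rV[R]_2 => c^-2 * p 0 1).
      by apply: smooth_atM; [exact: smooth_at_cst|exact: smooth_at_coord].
    apply: smooth_at_row2.
      by apply: smooth_atM; [exact: smooth_at_cst|exact: smooth_at_coord].
    apply: smooth_atM => //; apply: smooth_atV.
      by apply: smooth_atB => //; exact: smooth_at_cst.
    by rewrite mxE mulr0 subr0 oner_neq0.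
  exists (box 1); split=> //; first exact: open_box.
  by split; rewrite rcE !mxE ?mulr0 ?mul0r normr0.
(* On this box [s < 1/4], so [1 - s] is positive and the nonnegative branch of the extension is the
   one evaluated. *)
have c2 : 0 < c / 2 by exact: divr_gt0.
apply: filterS (box_nbhs0 c2) => p [h0 h1].
set x := p 0 0 in h0 *; set y := p 0 1 in h1 *.
pose s := c^-2 * y ^+ 2.
have s0 : 0 <= s by rewrite mulr_ge0 ?sqr_ge0 // invr_ge0 sqr_ge0.
have s1 : s < 4^-1.
  rewrite /s mulrC ltr_pdivrMr ?exprn_gt0 //.
  have -> : y ^+ 2 = `|y| ^+ 2 by rewrite real_normK ?num_real.
  have -> : 4^-1 * c ^+ 2 = (c / 2) ^+ 2 by field.
  by rewrite ltr_pXn2r ?nnegrE // ltW.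
rewrite /h /uncur !rcE -/s /seeley_ext.
have d0 : 0 < 1 - s by lra.
have -> : 0 <= s / (1 - s) by rewrite divr_ge0 // ltW.
have sE2 : s / (1 - s) / (1 + s / (1 - s)) = s.
  by field; rewrite gt_eqF //=; apply/eqP; lra.
rewrite /slice sE2 /E' !rcE mulVKf ?gt_eqF //.
have -> : s = (c^-1 * y) ^+ 2 by rewrite exprMn exprVn.
rewrite sqrtr_sqr normrM ger0_norm ?invr_ge0 ?ltW // mulVKf ?gt_eqF //.
have [|_] := Hr p.
  have cr : c / 2 < r by rewrite /c; lra.
  by split; [exact: lt_trans h0 cr|exact: lt_trans h1 cr].
rewrite -/x -/y => Ep.
have [y0|y0] := leP 0 y; first by rewrite ger0_norm // /x /y row2K.
by rewrite ltr0_norm // -Ep.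
Qed.

End SeeleyExtension.

(** * Jets of curves *)

Section OneVariable.
Context {R : realType}.

Lemma near_eq_derive1n (W : normedModType R) (f g : R -> W) (x : R) n :
  (\forall s \near x, f s = g s) ->
  \forall s \near x, derive1n n f s = derive1n n g s.
Proof.
elim: n f g => [|n IH] f g fg //.
have := near_join (IH _ _ fg); apply: filterS => s h.
by rewrite !derive1nS !derive1E; exact: near_eq_derive.
Qed.

Lemma eq_derive1n (W : normedModType R) (f g : R -> W) (x : R) n :
  (\forall s \near x, f s = g s) -> derive1n n f x = derive1n n g x.
Proof. by move=> /(near_eq_derive1n n)/nbhs_singleton. Qed.

Lemma derive1n_linear (W W' : normedModType R) (L : {linear W -> W'}) (f : R -> W)
    (x : R) n : continuous L -> smooth_at x f ->
  derive1n n (fun s => L (f s)) x = L (derive1n n f x).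
Proof.
move=> cL; elim: n f => [//|n IH] f hf.
rewrite !derive1Sn -IH; last exact: smooth_at_derive1.
apply: eq_derive1n; apply: filterS (smooth_at_near hf) => s /smooth_at_diff df.
have dL : differentiable L (f s) by exact: linear_differentiable.
have dLf : differentiable (fun s => L (f s)) s by exact: (differentiable_comp df dL).
apply: etrans (derive1_d dLf) _; apply: etrans (d_comp (1 : R) df dL) _.
by rewrite diff_lin //; congr (L _); exact: esym (derive1_d df).
Qed.

Lemma derive1n_coord m (f : R -> 'rV[R]_m.+1) (x : R) n i : smooth_at x f ->
  (derive1n n f x) 0 i = derive1n n (fun s => f s 0 i) x.
Proof.
move=> hf; apply: esym.
apply: (@derive1n_linear _ _ (coord_fun i : {linear 'rV[R]_m.+1 -> R})) => //.
by move=> y; exact: coord_continuous.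
Qed.

Lemma derive1nD (W : normedModType R) (f g : R -> W) (x : R) n :
  smooth_at x f -> smooth_at x g ->
  derive1n n (fun s => f s + g s) x = derive1n n f x + derive1n n g x.
Proof.
elim: n f g => [//|n IH] f g hf hg.
rewrite !derive1Sn -IH; try exact: smooth_at_derive1.
apply: eq_derive1n.
apply: filterS2 (smooth_at_near hf) (smooth_at_near hg) => s sf sg.
have sfg := smooth_atD sf sg.
apply: etrans (derive1_d (smooth_at_diff sfg)) _.
apply: etrans (d_add (1 : R) (smooth_at_diff sf) (smooth_at_diff sg)) _.
by congr (_ + _); apply: esym; apply: derive1_d; exact: smooth_at_diff.
Qed.

Lemma derive1n_sum (x : R) n I (r : seq I) (F : I -> R -> R) :
  (forall i, smooth_at x (F i)) ->
  derive1n n (fun s => \sum_(i <- r) F i s) x = \sum_(i <- r) derive1n n (F i) x.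
Proof.
move=> H; elim: r => [|i r IH].
  rewrite big_nil (_ : (fun s => _) = cst 0); last first.
    by apply/funext => s; rewrite big_nil.
  have C m : derive1n m (cst 0 : R -> R) = cst 0.
    elim: m => [//|m IHm]; rewrite derive1nS IHm; apply/funext => s.
    by rewrite derive1_cst.
  by rewrite C.
rewrite big_cons -IH -derive1nD //; last exact: smooth_at_sum.
by congr derive1n; apply/funext => s; rewrite big_cons.
Qed.

Lemma derive1_mul (f g : R -> R) (x : R) : smooth_at x f -> smooth_at x g ->
  derive1 (fun s => f s * g s) x = derive1 f x * g x + f x * derive1 g x.
Proof.
move=> sf sg; apply: etrans (derive1_d (smooth_at_diff (smooth_atM sf sg))) _.
apply: etrans (d_mul (1 : R) (smooth_at_diff sf) (smooth_at_diff sg)) _.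
by rewrite addrC mulrC; congr (_ * _ + _ * _); apply: esym; apply: derive1_d; exact: smooth_at_diff.
Qed.

Lemma derive1nM (f g : R -> R) (x : R) n : smooth_at x f -> smooth_at x g ->
  derive1n n.+1 (fun s => f s * g s) x =
  derive1n n (fun s => derive1 f s * g s) x + derive1n n (fun s => f s * derive1 g s) x.
Proof.
move=> hf hg; have hf' := smooth_at_derive1 hf; have hg' := smooth_at_derive1 hg.
rewrite -derive1nD; try exact: smooth_atM.
rewrite derive1Sn; apply: eq_derive1n.
apply: filterS2 (smooth_at_near hf) (smooth_at_near hg) => s sf sg.
exact: derive1_mul.
Qed.

Lemma Leibniz1 (f g : R -> R) (x : R) : smooth_at x f -> smooth_at x g ->
  derive1n 1 (fun s => f s * g s) x =
  derive1n 1 f x * g x + f x * derive1n 1 g x.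
Proof. exact: derive1_mul. Qed.

Lemma Leibniz2 (f g : R -> R) (x : R) : smooth_at x f -> smooth_at x g ->
  derive1n 2 (fun s => f s * g s) x =
  derive1n 2 f x * g x + 2 * derive1n 1 f x * derive1n 1 g x + f x * derive1n 2 g x.
Proof.
move=> hf hg; transitivity (
  (derive1n 2 f x * g x + derive1n 1 f x * derive1n 1 g x) +
  (derive1n 1 f x * derive1n 1 g x + f x * derive1n 2 g x));
  last by move: (derive1n 2 f x) (derive1n 1 f x) (derive1n 2 g x) (derive1n 1 g x)
    => a2 a1 b2 b1; ring.
exact: etrans (derive1nM 1 hf hg) (f_equal2 +%R
  (Leibniz1 (smooth_at_derive1 hf) hg) (Leibniz1 hf (smooth_at_derive1 hg))).
Qed.

Lemma Leibniz3 (f g : R -> R) (x : R) : smooth_at x f -> smooth_at x g ->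
  derive1n 3 (fun s => f s * g s) x =
  derive1n 3 f x * g x + 3 * derive1n 2 f x * derive1n 1 g x +
  3 * derive1n 1 f x * derive1n 2 g x + f x * derive1n 3 g x.
Proof.
move=> hf hg; transitivity (
  (derive1n 3 f x * g x + 2 * derive1n 2 f x * derive1n 1 g x + derive1n 1 f x * derive1n 2 g x) +
  (derive1n 2 f x * derive1n 1 g x + 2 * derive1n 1 f x * derive1n 2 g x + f x * derive1n 3 g x));
  last by move: (derive1n 3 f x) (derive1n 2 f x) (derive1n 1 f x)
    (derive1n 3 g x) (derive1n 2 g x) (derive1n 1 g x)
    => a3 a2 a1 b3 b2 b1; ring.
exact: etrans (derive1nM 2 hf hg) (f_equal2 +%R
  (Leibniz2 (smooth_at_derive1 hf) hg) (Leibniz2 hf (smooth_at_derive1 hg))).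
Qed.

Lemma Leibniz4 (f g : R -> R) (x : R) : smooth_at x f -> smooth_at x g ->
  derive1n 4 (fun s => f s * g s) x =
  derive1n 4 f x * g x + 4 * derive1n 3 f x * derive1n 1 g x +
  6 * derive1n 2 f x * derive1n 2 g x + 4 * derive1n 1 f x * derive1n 3 g x +
  f x * derive1n 4 g x.
Proof.
move=> hf hg; transitivity (
  (derive1n 4 f x * g x + 3 * derive1n 3 f x * derive1n 1 g x +
   3 * derive1n 2 f x * derive1n 2 g x + derive1n 1 f x * derive1n 3 g x) +
  (derive1n 3 f x * derive1n 1 g x + 3 * derive1n 2 f x * derive1n 2 g x +
   3 * derive1n 1 f x * derive1n 3 g x + f x * derive1n 4 g x));
  last by move: (derive1n 4 f x) (derive1n 3 f x) (derive1n 2 f x)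
    (derive1n 1 f x) (derive1n 4 g x) (derive1n 3 g x) (derive1n 2 g x) (derive1n 1 g x)
    => a4 a3 a2 a1 b4 b3 b2 b1; ring.
exact: etrans (derive1nM 3 hf hg) (f_equal2 +%R
  (Leibniz3 (smooth_at_derive1 hf) hg) (Leibniz3 hf (smooth_at_derive1 hg))).
Qed.

(** One derivative of [s ^+ n.+1 * r s] is again of the form [s ^+ n] times a smooth function, whose
    value at 0 is [n.+1 * r 0]. *)
Lemma derive1n_monomial n (r : R -> R) j : smooth_at 0 r -> (j <= n)%N ->
  derive1n j (fun s => s ^+ n * r s) 0 = if (j < n)%N then 0 else n`!%:R * r 0.
Proof.
elim: n r j => [|n IH] r j hr.
  by rewrite leqn0 => /eqP ->; rewrite /= expr0 fact0.
case: j => [|j] jn; first by rewrite /= expr0n mul0r.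
have hr' := smooth_at_derive1 hr.
have hr2 : smooth_at 0 (fun s : R => n.+1%:R * r s + s * derive1 r s).
  apply: smooth_atD; apply: smooth_atM => //; [exact: smooth_at_cst|exact: smooth_at_id].
rewrite derive1Sn.
have -> : derive1n j (derive1 (fun s => s ^+ n.+1 * r s)) 0 =
    derive1n j (fun s => s ^+ n * (n.+1%:R * r s + s * derive1 r s)) 0.
  apply: eq_derive1n; apply: filterS (smooth_at_near hr) => s sr.
  rewrite derive1_mul //; last exact: smooth_atX (smooth_at_id s).
  rewrite exp_derive1 exprS -[_ *: _]/(_ * _) /=; ring.
by rewrite IH // ltnS mul0r addr0 factS natrM -mulrA mulrCA mulrA.
Qed.

Lemma Hadamard1 (h : R -> R) : smooth_at 0 h -> exists2 g, smooth_at 0 g &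
  \forall s \near (0 : R), h s = h 0 + s * g s.
Proof.
move=> sh.
have sc : smooth_at 0 (fun p : 'rV[R]_2 => h (p 0 1)).
  apply: (@smooth_at_compR _ _ 0 (fun p : 'rV[R]_2 => p 0 1) h).
    exact: smooth_at_coord.
  by rewrite mxE.
have [g sg Hg] := Hadamard sc.
have sr : smooth_at 0 (fun s : R => row2 0 s).
  by apply: smooth_at_row2; [exact: smooth_at_cst|exact: smooth_at_id].
exists (fun s => g (row2 0 s)).
  by apply: (@smooth_at_comp_scalar _ _ 1 0 (fun s : R => row2 0 s)); rewrite ?row20.
have := smooth_at_near_val sr row20 Hg; apply: filterS => s /=.
by rewrite !rcE.
Qed.

(** Each vanishing derivative makes the current quotient vanish at 0, so that Hadamard's lemma
    extracts one more factor [s]. *)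
Lemma Taylor_order (h : R -> R) k : smooth_at 0 h ->
  (forall j, (j < k)%N -> derive1n j h 0 = 0) ->
  exists h1, [/\ smooth_at 0 h1, \forall s \near (0 : R), h s = s ^+ k * h1 s &
    derive1n k h 0 = k`!%:R * h1 0].
Proof.
elim: k => [|k IH] sh H.
  exists h; split=> //; first by apply: filterS (smooth_at_near sh) => s _; rewrite expr0 mul1r.
  by rewrite fact0 mul1r.
have [h1 [s1 E1 D1]] := IH sh (fun j jk => H j (ltnW jk)).
have h10 : h1 0 = 0.
  move: D1; rewrite H // => /esym/eqP; rewrite mulf_eq0 pnatr_eq0.
  by rewrite -[_ == 0%N]negbK -lt0n fact_gt0 /= => /eqP.
have [h2 s2 E2] := Hadamard1 s1.
have E : \forall s \near (0 : R), h s = s ^+ k.+1 * h2 s.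
  by apply: filterS2 E1 E2 => s -> ->; rewrite h10 add0r exprSr mulrA.
exists h2; split=> //.
by rewrite (eq_derive1n _ E) derive1n_monomial // ltnn.
Qed.

(** With [h = s ^ k h1] and [g = s g1] the product is [s ^ k] times [U g1 ^ k h1(g)], whose value at
    0 is read off. *)
Lemma order_comp (h g U : R -> R) k : smooth_at 0 h -> smooth_at 0 g ->
  smooth_at 0 U -> g 0 = 0 -> (forall j, (j < k)%N -> derive1n j h 0 = 0) ->
  (forall j, (j < k)%N -> derive1n j (fun s => U s * h (g s)) 0 = 0) /\
  derive1n k (fun s => U s * h (g s)) 0 =
    U 0 * derive1 g 0 ^+ k * derive1n k h 0.
Proof.
move=> sh sg sU g0 H; have [h1 [s1 E1 D1]] := Taylor_order sh H.
have [g1 sg1 Eg] := Hadamard1 sg.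
have Dg : derive1 g 0 = g1 0.
  have : derive1n 1 g 0 = derive1n 1 (fun s => s ^+ 1 * g1 s) 0.
    by apply: eq_derive1n; apply: filterS Eg => s ->; rewrite g0 add0r expr1.
  by rewrite derive1n_monomial //= mul1r.
have E : \forall s \near (0 : R), U s * h (g s) =
    s ^+ k * (U s * (g1 s ^+ k * h1 (g s))).
  have := smooth_at_near_val sg g0 E1.
  apply: filterS2 Eg => s Egs /= ->; rewrite {1}Egs g0 add0r exprMn; ring.
have sr : smooth_at 0 (fun s => U s * (g1 s ^+ k * h1 (g s))).
  apply: smooth_atM => //; apply: smooth_atM; first exact: smooth_atX.
  by apply: (@smooth_at_compR _ _ 0 g h1) => //; rewrite g0.
split=> [j jk|].
  by rewrite (eq_derive1n _ E) derive1n_monomial ?jk // ltnW.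
by rewrite (eq_derive1n _ E) derive1n_monomial // ltnn g0 D1 Dg; ring.
Qed.

End OneVariable.

(** * Higher chain rule for a curve with vanishing velocity *)

Section ChainRule.
Context {R : realType} {m : nat}.
Implicit Types F : 'rV[R]_m.+1 -> R.
Context (q : R -> 'rV[R]_m.+1) (sq : smooth_at 0 q) (q0 : q 0 = 0)
  (dq0 : derive1 q 0 = 0).

Let qi i (s : R) := q s 0 i.
Let Fi F i p := 'd F p (delta_mx 0 i).

Let sqi i : smooth_at 0 (qi i).
Proof. by have /smooth_at_rowP := sq; exact. Qed.

Let smooth_Fq F : smooth_at 0 F -> smooth_at 0 (fun s => F (q s)).
Proof. by move=> sF; apply: smooth_at_comp_scalar => //; rewrite q0. Qed.

(** The first derivative is written with the partial derivatives of [F] along [q]. These are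
    functions of the same kind, so lower-order formulas apply to them. *)
Let chainS F n : smooth_at 0 F ->
  derive1n n.+1 (fun s => F (q s)) 0 =
    \sum_i derive1n n (fun s => Fi F i (q s) * derive1 (qi i) s) 0.
Proof.
move=> sF; rewrite -derive1n_sum => [|i]; last first.
  apply: smooth_atM; first by apply: smooth_Fq; exact: smooth_at_d.
  exact: smooth_at_derive1.
rewrite derive1Sn; apply: eq_derive1n.
have nF := smooth_at_near_val sq q0 (smooth_at_near sF).
apply: filterS2 (smooth_at_near sq) nF => s hq hF.
have dq := smooth_at_diff hq; have dF := smooth_at_diff hF.
have dFq : differentiable (fun s => F (q s)) s by exact: (differentiable_comp dq dF).
apply: etrans (derive1_d dFq) _; apply: etrans (d_comp (1 : R) dq dF) _.
apply: etrans (d_sum_basis _ _ _) _; apply: eq_bigr => i _.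
rewrite -[_ *: _]/(_ * _) mulrC; congr (_ * _).
have E1 := d_row (1 : R) i dq.
apply: etrans E1 _; apply: esym; apply: derive1_d; apply: smooth_at_diff.
by have /smooth_at_rowP := hq; exact.
Qed.

Let dqi0 i : derive1 (qi i) 0 = 0.
Proof.
have := derive1n_coord 1 i sq; rewrite !derive1n1 => <-.
by rewrite dq0 mxE.
Qed.

Lemma chain1 F : smooth_at 0 F -> derive1 (fun s => F (q s)) 0 = 0.
Proof.
move=> sF; have := chainS 0 sF; rewrite derive1n1 => ->.
by apply: big1 => i _; rewrite derive1n0 dqi0 mulr0.
Qed.

Let Fq F i (s : R) := Fi F i (q s).

Let smooth_Fq1 F i : smooth_at 0 F -> smooth_at 0 (Fq F i).
Proof. by move=> sF; apply: smooth_Fq; exact: smooth_at_d. Qed.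

Let Fq0 F i : Fq F i 0 = Fi F i 0. Proof. by rewrite /Fq q0. Qed.

Let dFq0 F i : smooth_at 0 F -> derive1n 1 (Fq F i) 0 = 0.
Proof. by move=> sF; apply: (@chain1 (Fi F i)); exact: smooth_at_d. Qed.

Lemma chain2 F : smooth_at 0 F -> derive1n 2 (fun s => F (q s)) 0 =
  \sum_i Fi F i 0 * derive1n 2 (qi i) 0.
Proof.
move=> sF; apply: etrans (chainS 1 sF) _; apply: eq_bigr => i _.
transitivity (derive1n 1 (Fq F i) 0 * derive1 (qi i) 0 + Fq F i 0 * derive1n 2 (qi i) 0).
  exact: Leibniz1 (smooth_Fq1 i sF) (smooth_at_derive1 (sqi i)).
by rewrite dqi0 Fq0 mulr0 add0r.
Qed.

Lemma chain3 F : smooth_at 0 F -> derive1n 3 (fun s => F (q s)) 0 =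
  \sum_i Fi F i 0 * derive1n 3 (qi i) 0.
Proof.
move=> sF; apply: etrans (chainS 2 sF) _; apply: eq_bigr => i _.
transitivity (derive1n 2 (Fq F i) 0 * derive1 (qi i) 0 +
  2 * derive1n 1 (Fq F i) 0 * derive1n 2 (qi i) 0 + Fq F i 0 * derive1n 3 (qi i) 0).
  exact: Leibniz2 (smooth_Fq1 i sF) (smooth_at_derive1 (sqi i)).
by rewrite (dqi0 i) (Fq0 F i) (dFq0 i sF) !mulr0 mul0r !add0r.
Qed.

Lemma chain4 F : smooth_at 0 F -> derive1n 4 (fun s => F (q s)) 0 =
  \sum_i (Fi F i 0 * derive1n 4 (qi i) 0 +
    3 * derive1n 2 (Fq F i) 0 * derive1n 2 (qi i) 0).
Proof.
move=> sF; apply: etrans (chainS 3 sF) _; apply: eq_bigr => i _.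
transitivity (derive1n 3 (Fq F i) 0 * derive1 (qi i) 0 +
  3 * derive1n 2 (Fq F i) 0 * derive1n 2 (qi i) 0 +
  3 * derive1n 1 (Fq F i) 0 * derive1n 3 (qi i) 0 + Fq F i 0 * derive1n 4 (qi i) 0).
  exact: Leibniz3 (smooth_Fq1 i sF) (smooth_at_derive1 (sqi i)).
rewrite (dqi0 i) (Fq0 F i) (dFq0 i sF).
move: (derive1n 3 (Fq F i) 0) (derive1n 2 (Fq F i) 0) => a b.
by move: (derive1n 2 (qi i) 0) (derive1n 3 (qi i) 0) (derive1n 4 (qi i) 0) => c d e; ring.
Qed.

Lemma chain5 F : smooth_at 0 F -> derive1n 5 (fun s => F (q s)) 0 =
  \sum_i (Fi F i 0 * derive1n 5 (qi i) 0 +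
    6 * derive1n 2 (Fq F i) 0 * derive1n 3 (qi i) 0 +
    4 * derive1n 3 (Fq F i) 0 * derive1n 2 (qi i) 0).
Proof.
move=> sF; apply: etrans (chainS 4 sF) _; apply: eq_bigr => i _.
transitivity (derive1n 4 (Fq F i) 0 * derive1 (qi i) 0 +
  4 * derive1n 3 (Fq F i) 0 * derive1n 2 (qi i) 0 +
  6 * derive1n 2 (Fq F i) 0 * derive1n 3 (qi i) 0 +
  4 * derive1n 1 (Fq F i) 0 * derive1n 4 (qi i) 0 + Fq F i 0 * derive1n 5 (qi i) 0).
  exact: Leibniz4 (smooth_Fq1 i sF) (smooth_at_derive1 (sqi i)).
rewrite (dqi0 i) (Fq0 F i) (dFq0 i sF).
move: (derive1n 4 (Fq F i) 0) (derive1n 3 (Fq F i) 0) (derive1n 2 (Fq F i) 0) => a b c.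
move: (derive1n 2 (qi i) 0) (derive1n 3 (qi i) 0) (derive1n 4 (qi i) 0) => d e g.
by move: (derive1n 5 (qi i) 0) => h; ring.
Qed.

(** Let [D] be the second derivative of a partial of [F] along [q]. Its third derivative is then
    [l * D], so the nonlinear part of order five is [(6 + 4) * l * D * q''] and that of order four
    is [3 * D * q'']; the coefficients 3 and -10 l cancel them. *)
Lemma chain_fifth F (l : R) : smooth_at 0 F ->
  derive1n 3 q 0 = l *: derive1n 2 q 0 ->
  3 * derive1n 5 (fun s => F (q s)) 0 - 10 * l * derive1n 4 (fun s => F (q s)) 0 =
  'd F 0 (3 *: derive1n 5 q 0 - (10 * l) *: derive1n 4 q 0).
Proof.
move=> sF ql; apply: esym; apply: etrans (d_sum_basis _ _ _) _.
have ql' i : derive1n 3 (qi i) 0 = l * derive1n 2 (qi i) 0.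
  have := derive1n_coord 3 i sq; rewrite ql mxE => <-.
  by congr (_ * _); exact: derive1n_coord.
rewrite (chain5 sF) (chain4 sF) !mulr_sumr -sumrB.
apply: eq_bigr => i _.
have sFi : smooth_at 0 (Fi F i) by exact: smooth_at_d.
have c3 : derive1n 3 (Fq F i) 0 = l * derive1n 2 (Fq F i) 0.
  apply: etrans (chain3 sFi) _; apply: esym.
  apply: etrans (congr1 ( *%R l) (chain2 sFi)) _.
  by rewrite mulr_sumr; apply: eq_bigr => j _; rewrite ql' mulrCA.
have q4 : (derive1n 4 q 0) 0 i = derive1n 4 (qi i) 0 by exact: derive1n_coord.
have q5 : (derive1n 5 q 0) 0 i = derive1n 5 (qi i) 0 by exact: derive1n_coord.
have Ev : (3 *: derive1n 5 q 0 - (10 * l) *: derive1n 4 q 0) 0 i =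
    3 * derive1n 5 (qi i) 0 - (10 * l) * derive1n 4 (qi i) 0.
  rewrite -q4 -q5; move: (derive1n 5 q 0) (derive1n 4 q 0) => A B.
  by rewrite !mxE.
rewrite Ev c3 (ql' i); rewrite -[_ *: _]/(_ * Fi F i 0).
move: (derive1n 4 (qi i) 0) (derive1n 5 (qi i) 0) => c d.
move: (derive1n 2 (Fq F i) 0) (derive1n 2 (qi i) 0) (Fi F i 0) => a b e.
ring.
Qed.

End ChainRule.

(** * Determinants and scalar products in dimensions two and three *)

Section LinearAlgebra.
Context {R : realType}.
Implicit Types u v w n : 'rV[R]_3.

Lemma sum2E (V : nmodType) (F : 'I_2 -> V) : \sum_i F i = F 0 + F 1.
Proof.
rewrite !big_ord_recl big_ord0 addr0.
by congr (F _ + F _); apply/val_inj.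
Qed.

Lemma sum3E (V : nmodType) (F : 'I_3 -> V) : \sum_i F i = F 0 + F 1 + F 2.
Proof.
rewrite !big_ord_recl big_ord0 addr0 addrA.
by congr (F _ + F _ + F _); apply/val_inj.
Qed.

Lemma det_mx22 (M : 'M[R]_2) : \det M = M 0 0 * M 1 1 - M 0 1 * M 1 0.
Proof.
rewrite (expand_det_row _ 0) sum2E /cofactor !det_mx11 !mxE.
have -> : lift 0 (0 : 'I_1) = 1 :> 'I_2 by apply/val_inj.
have -> : lift 1 (0 : 'I_1) = 0 :> 'I_2 by apply/val_inj.
by rewrite /= addn0 expr0 expr1; ring.
Qed.

Lemma det2E (v w : 'rV[R]_2) : det2 v w = v 0 0 * w 0 1 - v 0 1 * w 0 0.
Proof. by rewrite /det2 det_mx22 !mxE. Qed.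

Lemma det3E u v w : det3 u v w =
  u 0 0 * (v 0 1 * w 0 2 - v 0 2 * w 0 1) -
  u 0 1 * (v 0 0 * w 0 2 - v 0 2 * w 0 0) +
  u 0 2 * (v 0 0 * w 0 1 - v 0 1 * w 0 0).
Proof.
rewrite /det3 (expand_det_row _ 0) sum3E /cofactor !det_mx22 !mxE.
have -> : lift 0 (0 : 'I_2) = 1 :> 'I_3 by apply/val_inj.
have -> : lift 0 (1 : 'I_2) = 2 :> 'I_3 by apply/val_inj.
have -> : lift 1 (0 : 'I_2) = 0 :> 'I_3 by apply/val_inj.
have -> : lift 1 (1 : 'I_2) = 2 :> 'I_3 by apply/val_inj.
have -> : lift 2 (0 : 'I_2) = 0 :> 'I_3 by apply/val_inj.
have -> : lift 2 (1 : 'I_2) = 1 :> 'I_3 by apply/val_inj.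
by rewrite /= !add0n expr0 expr1 expr2; ring.
Qed.

Lemma dot3E u v : dot u v = u 0 0 * v 0 0 + u 0 1 * v 0 1 + u 0 2 * v 0 2.
Proof. by rewrite /dot sum3E. Qed.

(* Multiplicativity of the determinant, applied to a matrix and the transpose
   of another one. *)
Lemma det3_Gram a b c u v w : det3 a b c * det3 u v w =
  dot a u * (dot b v * dot c w - dot b w * dot c v) -
  dot a v * (dot b u * dot c w - dot b w * dot c u) +
  dot a w * (dot b u * dot c v - dot b v * dot c u).
Proof. rewrite !det3E !dot3E; ring. Qed.

Lemma dot_gt0 u : u != 0 -> 0 < dot u u.
Proof.
move=> u0; rewrite dot3E lt_def; apply/andP; split; last first.
  by rewrite !addr_ge0 // -expr2 sqr_ge0.
apply: contra_neq u0 => E.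
have h0 := sqr_ge0 (u 0 0); have h1 := sqr_ge0 (u 0 1); have h2 := sqr_ge0 (u 0 2).
have sq (x : R) : x ^+ 2 <= 0 -> x = 0.
  by move=> h; apply/eqP; rewrite -sqrf_eq0 eq_le h sqr_ge0.
by apply/rowP; apply: ord3P; rewrite mxE; apply: sq; lra.
Qed.

Lemma det3_neq0 u v w :
  (forall a b c : R, a *: u + b *: v + c *: w = 0 -> [/\ a = 0, b = 0 & c = 0]) ->
  det3 u v w != 0.
Proof.
move=> H; rewrite /det3 -unitfE -unitmxE -row_free_unit -kermx_eq0.
apply/eqP/row_matrixP => i; rewrite row0.
set A := \matrix_(i < 3) _.
have mulA (y : 'rV[R]_3) : y *m A = y 0 0 *: u + y 0 1 *: v + y 0 2 *: w.
  by apply/rowP => j; rewrite !mxE sum3E !mxE.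
have xA : row i (kermx A) *m A = 0 by rewrite -row_mul mulmx_ker row0.
move: (row i (kermx A)) xA => x; rewrite mulA => /H[a0 b0 c0].
by apply/rowP; apply: ord3P; rewrite [RHS]mxE.
Qed.

Lemma det3_free u v w : det3 u v w != 0 ->
  forall a b c : R, a *: u + b *: v + c *: w = 0 -> [/\ a = 0, b = 0 & c = 0].
Proof.
move=> D a b c E.
have ha : a * det3 u v w = 0.
  have -> : a * det3 u v w = det3 (a *: u + b *: v + c *: w) v w.
    by rewrite !det3E !mxE; ring.
  by rewrite E det3E !mxE; ring.
have hb : b * det3 u v w = 0.
  have -> : b * det3 u v w = det3 u (a *: u + b *: v + c *: w) w.
    by rewrite !det3E !mxE; ring.
  by rewrite E det3E !mxE; ring.
have hc : c * det3 u v w = 0.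
  have -> : c * det3 u v w = det3 u v (a *: u + b *: v + c *: w).
    by rewrite !det3E !mxE; ring.
  by rewrite E det3E !mxE; ring.
by split; apply/eqP; [move/eqP: ha|move/eqP: hb|move/eqP: hc];
  rewrite mulf_eq0 (negbTE D) orbF.
Qed.

(** Pairing a vanishing combination with [n] kills the coefficient of [n], because [dot n n] is
    positive. *)
Lemma det3_orthogonal u v n :
  (forall a b : R, a *: u + b *: v = 0 -> a = 0 /\ b = 0) ->
  dot u n = 0 -> dot v n = 0 -> n != 0 -> det3 u v n != 0.
Proof.
move=> H un vn n0; apply: det3_neq0 => a b c E.
have c0 : c = 0.
  have : dot (a *: u + b *: v + c *: n) n = c * dot n n.
    have -> : dot (a *: u + b *: v + c *: n) n = a * dot u n + b * dot v n + c * dot n n.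
      by rewrite !dot3E !mxE; ring.
    by rewrite un vn !mulr0 !add0r.
  rewrite E => /esym/eqP; have -> : dot 0 n = 0 by rewrite dot3E !mxE; ring.
  by rewrite mulf_eq0 (gt_eqF (dot_gt0 n0)) orbF => /eqP.
by move: E; rewrite c0 scale0r addr0 => /H[-> ->].
Qed.

Lemma det3_combine (a0 a1 b0 b1 : R) u v n :
  det3 (a0 *: u + a1 *: v) (b0 *: u + b1 *: v) n = (a0 * b1 - a1 * b0) * det3 u v n.
Proof. rewrite !det3E !mxE; ring. Qed.

Lemma row_full2P (a b : 'rV[R]_2) :
  row_full (col_mx a b) <-> det2 a b != 0.
Proof.
pose A : 'M[R]_2 := col_mx a b.
have EA : A = \matrix_(i < 2) [:: a; b]`_i.
  apply/matrixP => i j; rewrite [RHS]mxE; move: i; apply: ord2P.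
    rewrite -[RHS](col_mxEu a b 0 j) /A; congr (col_mx a b _ j); exact/val_inj.
  rewrite -[RHS](col_mxEd a b 0 j) /A; congr (col_mx a b _ j); exact/val_inj.
have -> : row_full (col_mx a b) = (A \in unitmx) by rewrite -row_full_unit.
by rewrite unitmxE unitfE EA.
Qed.

End LinearAlgebra.

(** * Determinants of differentials and differentiation rules for vector-valued maps *)

Section DerivativeAlgebra.
Context {R : realType}.

Lemma det2_mulmx (a b : 'rV[R]_2) (M : 'M[R]_2) :
  det2 (a *m M) (b *m M) = det2 a b * \det M.
Proof.
rewrite /det2 -det_mulmx; congr (\det _); apply/matrixP => i j.
rewrite !mxE; move: i; apply: ord2P; rewrite /= ?mxE; apply: eq_bigr => i _;
  by rewrite !mxE.
Qed.

Lemma det3_mulmx (a b c : 'rV[R]_3) (M : 'M[R]_3) :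
  det3 (a *m M) (b *m M) (c *m M) = det3 a b c * \det M.
Proof.
rewrite /det3 -det_mulmx; congr (\det _); apply/matrixP => i j.
rewrite !mxE; move: i; apply: ord3P; rewrite /= ?mxE; apply: eq_bigr => i _;
  by rewrite !mxE.
Qed.

Lemma det2_d (f : 'rV[R]_2 -> 'rV[R]_2) p a b :
  det2 ('d f p a) ('d f p b) = det2 a b * \det ('J f p).
Proof. by rewrite !d_jacobian det2_mulmx. Qed.

Lemma det3_d (f : 'rV[R]_3 -> 'rV[R]_3) p a b c :
  det3 ('d f p a) ('d f p b) ('d f p c) = det3 a b c * \det ('J f p).
Proof. by rewrite !d_jacobian det3_mulmx. Qed.

Lemma det_jacobian m (f : 'rV[R]_m.+1 -> 'rV[R]_m.+1) p :
  (forall v, 'd f p v = 0 -> v = 0) -> \det ('J f p) != 0.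
Proof. by move=> /unitmx_jacobian; rewrite unitmxE unitfE. Qed.

Lemma d_surjective m (f : 'rV[R]_m.+1 -> 'rV[R]_m.+1) p w :
  (forall v, 'd f p v = 0 -> v = 0) -> exists v, 'd f p v = w.
Proof.
by move=> /unitmx_jacobian U; exists (w *m invmx ('J f p)); rewrite d_jacobian mulmxKV.
Qed.

Lemma singular_setP (f : 'rV[R]_2 -> 'rV[R]_3) p :
  singular_set f p <-> exists2 v, v != 0 & 'd f p v = 0.
Proof.
rewrite /singular_set /=; split.
  rewrite ltn_neqAle => /andP[+ _]; rewrite -[_ == _]/(row_free ('J f p)) -kermx_eq0.
  move=> /eqP H; apply: contrapT => N; apply: H; apply/row_matrixP => i.
  rewrite row0; apply: contrapT => /eqP K; apply: N; exists (row i (kermx ('J f p))) => //.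
  by rewrite d_jacobian -row_mul mulmx_ker row0.
move=> [v v0 E]; rewrite ltn_neqAle rank_leq_row andbT.
rewrite -[_ == _]/(row_free ('J f p)); apply: contra v0 => F.
by apply/eqP; apply: (row_free_inj F); rewrite mul0mx -d_jacobian.
Qed.

Lemma singular_data_smooth (f : 'rV[R]_2 -> 'rV[R]_3) gamma eta :
  singular_data f gamma eta -> smooth_at 0 gamma.
Proof.
move=> [[e e0 [sg _ _ _]] _]; exists `]-e, e[%classic; split => //=.
by rewrite in_itv /= oppr_lt0 e0.
Qed.

Lemma derive1_d_comp (V W : normedModType R) (c : R -> V) (F : V -> W) t :
  smooth_at t c -> smooth_at (c t) F -> differentiable (fun s => F (c s)) t ->
  derive1 (fun s => F (c s)) t = 'd F (c t) (derive1 c t).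
Proof.
move=> sc sF dFc; apply: etrans (derive1_d dFc) _.
apply: etrans (d_comp (1 : R) (smooth_at_diff sc) (smooth_at_diff sF)) _.
exact: (congr1 ('d F (c t)) (esym (derive1_d (smooth_at_diff sc)))).
Qed.

(** Base point and direction both vary, so the direction is expanded in the standard basis and only
    fixed directions are differentiated. *)
Lemma smooth_at_d_along (V : normedModType R) m k (x : V) (a v : V -> 'rV[R]_m.+1)
    (F : 'rV[R]_m.+1 -> 'rV[R]_k.+1) :
  smooth_at x a -> smooth_at x v -> smooth_at (a x) F ->
  smooth_at x (fun y => 'd F (a y) (v y)).
Proof.
move=> sa sv sF; apply/smooth_at_rowP => i.
have -> : (fun y => ('d F (a y) (v y)) 0 i) =
    (fun y => \sum_(j < m.+1) v y 0 j * ('d F (a y) (delta_mx 0 j)) 0 i).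
  apply/funext => y; rewrite (d_sum_basis F (a y) (v y)) summxE.
  by apply: eq_bigr => j _; rewrite mxE.
apply: smooth_at_sum => j; apply: smooth_atM; first by have /smooth_at_rowP := sv; apply.
have s := smooth_at_comp sa (smooth_at_d (delta_mx 0 j) sF).
by have /smooth_at_rowP := s; apply.
Qed.

Lemma smooth_at_dot (V : normedModType R) (x : V) (a b : V -> 'rV[R]_3) :
  smooth_at x a -> smooth_at x b -> smooth_at x (fun y => dot (a y) (b y)).
Proof.
move=> /smooth_at_rowP sa /smooth_at_rowP sb; rewrite /dot.
by apply: smooth_at_sum => i; apply: smooth_atM.
Qed.

Lemma smooth_at_det3 (V : normedModType R) (x : V) (a b c : V -> 'rV[R]_3) :
  smooth_at x a -> smooth_at x b -> smooth_at x c ->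
  smooth_at x (fun y => det3 (a y) (b y) (c y)).
Proof.
move=> /smooth_at_rowP sa /smooth_at_rowP sb /smooth_at_rowP sc; rewrite /det3.
apply: smooth_at_det => i j.
have -> : (fun y => (\matrix_(i0 < 3) [:: a y; b y; c y]`_i0) i j) =
    (fun y => ([:: a y; b y; c y]`_i : 'rV[R]_3) 0 j).
  by apply/funext => y; rewrite mxE.
by move: i; apply: ord3P.
Qed.

Lemma d_dot (V : normedModType R) (x : V) (a b : V -> 'rV[R]_3) v :
  smooth_at x a -> smooth_at x b ->
  'd (fun y => dot (a y) (b y)) x v = dot ('d a x v) (b x) + dot (a x) ('d b x v).
Proof.
move=> sa sb; have /smooth_at_rowP ra := sa; have /smooth_at_rowP rb := sb.
have da i := d_row v i (smooth_at_diff sa).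
have db i := d_row v i (smooth_at_diff sb).
have dm i : 'd (fun y => a y 0 i * b y 0 i) x v =
    a x 0 i * ('d b x v) 0 i + b x 0 i * ('d a x v) 0 i.
  apply: etrans (d_mul v (smooth_at_diff (ra i)) (smooth_at_diff (rb i))) _.
  exact: (f_equal2 (fun z w => a x 0 i * z + b x 0 i * w) (esym (db i)) (esym (da i))).
have sm i := smooth_at_diff (smooth_atM (ra i) (rb i)).
have sm01 := smooth_at_diff (smooth_atD (smooth_atM (ra 0) (rb 0)) (smooth_atM (ra 1) (rb 1))).
have -> : (fun y => dot (a y) (b y)) = (fun y => a y 0 0 * b y 0 0 + a y 0 1 * b y 0 1 + a y 0 2 * b y 0 2).
  by apply/funext => y; rewrite dot3E.
apply: etrans (d_add v sm01 (sm 2)) _.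
apply: etrans (congr1 (fun z => z + _) (d_add v (sm 0) (sm 1))) _.
apply: etrans (f_equal2 (fun z w => z + w) (f_equal2 (fun z w => z + w) (dm 0) (dm 1)) (dm 2)) _.
have H (A B u w : 'rV[R]_3) : A 0 0 * w 0 0 + B 0 0 * u 0 0 + (A 0 1 * w 0 1 + B 0 1 * u 0 1) +
    (A 0 2 * w 0 2 + B 0 2 * u 0 2) = dot u B + dot A w by rewrite !dot3E; ring.
exact: H.
Qed.

Lemma smooth_atZ (V : normedModType R) m (x : V) (a : V -> R) (g : V -> 'rV[R]_m.+1) :
  smooth_at x a -> smooth_at x g -> smooth_at x (fun y => a y *: g y).
Proof.
move=> sa /smooth_at_rowP sg; apply/smooth_at_rowP => i.
have -> : (fun y => (a y *: g y) 0 i) = (fun y => a y * g y 0 i).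
  by apply/funext => y; rewrite mxE.
exact: smooth_atM.
Qed.

Lemma smooth_at_det2 (V : normedModType R) (x : V) (a b : V -> 'rV[R]_2) :
  smooth_at x a -> smooth_at x b -> smooth_at x (fun y => det2 (a y) (b y)).
Proof.
move=> /smooth_at_rowP sa /smooth_at_rowP sb; rewrite /det2.
apply: smooth_at_det => i j.
have -> : (fun y => (\matrix_(i0 < 2) [:: a y; b y]`_i0) i j) =
    (fun y => ([:: a y; b y]`_i : 'rV[R]_2) 0 j).
  by apply/funext => y; rewrite mxE.
by move: i; apply: ord2P.
Qed.

Lemma dot0l (u : 'rV[R]_3) : dot 0 u = 0.
Proof. by rewrite dot3E !mxE !mul0r !addr0. Qed.

Lemma dotDl (u v w : 'rV[R]_3) : dot (u + v) w = dot u w + dot v w.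
Proof. by rewrite !dot3E !mxE; ring. Qed.

Lemma dotZl (a : R) (v w : 'rV[R]_3) : dot (a *: v) w = a * dot v w.
Proof. by rewrite !dot3E !mxE; ring. Qed.

(* Multiplying by a regular function [y] is injective on germs: at a zero of [y],
   differentiate [y h = 0] in a direction where [y] varies. *)
Lemma near_mul_eq0 (V : normedModType R) (x : V) (y h : V -> R) :
  smooth_at x y -> smooth_at x h ->
  (\forall p \near x, exists v, 'd y p v != 0) ->
  (\forall p \near x, y p * h p = 0) -> \forall p \near x, h p = 0.
Proof.
move=> sy sh dy yh.
have sy' := smooth_at_near sy; have sh' := smooth_at_near sh.
have yh' : \forall p \near x, \forall z \near p, y z * h z = 0 by exact: near_join.
near=> p.
have [v yv] : exists v, 'd y p v != 0 by near: p.
have syp : smooth_at p y by near: p.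
have shp : smooth_at p h by near: p.
have [yp0|yp0] := eqVneq (y p) 0; last first.
  have : y p * h p = 0 by near: p.
  by move=> /eqP; rewrite mulf_eq0 (negbTE yp0) => /eqP.
have Y : \forall z \near p, y z * h z = 0 by near: p.
have E := d_near v Y (smooth_at_diff (smooth_atM syp shp)).
have := etrans (esym (d_mul v (smooth_at_diff syp) (smooth_at_diff shp))) (etrans E (d_cst _ _ _)).
rewrite yp0 mul0r add0r => /eqP; rewrite mulf_eq0 (negbTE yv) orbF => /eqP; exact.
Unshelve. all: by end_near. Qed.

Lemma smooth_axis (x : R) : smooth_at x (fun x : R => row2 x 0).
Proof. by apply: smooth_at_row2; [exact: smooth_at_id|exact: smooth_at_cst]. Qed.

Lemma smooth_on_axis (F : 'rV[R]_2 -> R) : smooth_at 0 F ->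
  smooth_at 0 (fun x : R => F (row2 x 0)).
Proof. by move=> sF; apply: (smooth_at_comp_scalar (smooth_axis 0)); rewrite row20. Qed.

Lemma derive1_axis0 (F : 'rV[R]_2 -> R) : smooth_at 0 F ->
  derive1 (fun x : R => F (row2 x 0)) 0 = 'd F 0 (delta_mx 0 0).
Proof.
move=> sF; have sr := smooth_axis 0.
have sFr : smooth_at (row2 0 0) F by rewrite row20.
apply: etrans (derive1_d_comp sr sFr (smooth_at_diff (smooth_at_comp_scalar sr sFr))) _.
rewrite row20 delta2_0; congr ('d F 0 _).
apply: etrans (derive1_d (smooth_at_diff sr)) _.
apply: etrans (d_row2 (1 : R) (smooth_at_id (0 : R)) (smooth_at_cst (0 : R) (0 : R))) _.
by congr row2; [exact: d_id|exact: d_cst].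
Qed.

Lemma rowvec0 m (i : 'I_m) : (0 : 'rV[R]_m) 0 i = 0. Proof. exact: mxE. Qed.

(** On the axis the Hadamard quotient is the partial derivative itself: in the product rule for
    [p 0 1 * G p] the term with the derivative of [G] carries the factor [p0 0 1 = 0]. *)
Lemma Hadamard_d (F G : 'rV[R]_2 -> R) (p0 : 'rV[R]_2) : p0 0 1 = 0 ->
  smooth_at p0 F -> smooth_at p0 G ->
  (\forall p \near p0, F p = F (row2 (p 0 0) 0) + p 0 1 * G p) ->
  'd F p0 (delta_mx 0 1) = G p0.
Proof.
move=> p01 sF sG FE; set v := delta_mx 0 1.
have sr : smooth_at p0 (fun p : 'rV[R]_2 => row2 (p 0 0) 0).
  by apply: smooth_at_row2; [exact: smooth_at_coord|exact: smooth_at_cst].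
have r0 : row2 (p0 0 0) 0 = p0 by rewrite -[RHS]row2K p01.
have sFr : smooth_at (row2 (p0 0 0) 0) F by rewrite r0.
have s1 := smooth_at_coord 1 p0.
have sA := smooth_at_comp_scalar sr sFr; have sM := smooth_atM s1 sG.
apply: etrans (d_near v FE (smooth_at_diff sF)) _.
apply: etrans (d_add v (smooth_at_diff sA) (smooth_at_diff sM)) _.
have E1 : 'd (fun p : 'rV[R]_2 => F (row2 (p 0 0) 0)) p0 v = 0.
  apply: etrans (d_comp v (smooth_at_diff sr) (smooth_at_diff sFr)) _.
  have -> : 'd (fun p : 'rV[R]_2 => row2 (p 0 0) 0) p0 v = 0.
    apply: etrans (d_row2 v (smooth_at_coord 0 p0) (smooth_at_cst p0 0)) _.
    apply: etrans (f_equal2 row2 (d_coord 0 p0 v) (d_cst (0 : R) p0 v)) _.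
    by rewrite /v delta2_1 rcE row20.
  exact: linear0.
have E2 := d_mul v (smooth_at_diff s1) (smooth_at_diff sG).
have E3 := etrans E2 (congr1 (fun z => p0 0 1 * _ + G p0 * z) (d_coord 1 p0 v)).
apply: etrans (f_equal2 (fun a b => a + b) E1 E3) _.
by rewrite p01 mul0r !add0r /v delta2_1 rcE mulr1.
Qed.

Section ChainRuleRow.
Context (m k : nat) (q : R -> 'rV[R]_m.+1) (sq : smooth_at 0 q) (q0 : q 0 = 0)
  (dq0 : derive1 q 0 = 0) (F : 'rV[R]_m.+1 -> 'rV[R]_k.+1) (sF : smooth_at 0 F).

Let sFi i : smooth_at 0 (fun p => F p 0 i).
Proof. by have /smooth_at_rowP := sF; apply. Qed.

Let sFq : smooth_at 0 (fun s => F (q s)).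
Proof. by apply: smooth_at_comp; rewrite ?q0. Qed.

Let d_coord_sum i n : \sum_j 'd (fun p => F p 0 i) 0 (delta_mx 0 j) * derive1n n (fun s => q s 0 j) 0 =
  ('d F 0 (derive1n n q 0)) 0 i.
Proof.
apply: esym; apply: etrans (d_row _ i (smooth_at_diff sF)) _.
apply: etrans (d_sum_basis _ _ _) _; apply: eq_bigr => j _.
rewrite -[_ *: _]/(_ * _) mulrC; congr (_ * _).
exact: (derive1n_coord n j sq).
Qed.

Lemma chain2_row : derive1n 2 (fun s => F (q s)) 0 = 'd F 0 (derive1n 2 q 0).
Proof.
apply/rowP => i; apply: etrans (derive1n_coord 2 i sFq) _.
exact: etrans (chain2 sq q0 dq0 (sFi i)) (d_coord_sum i 2).
Qed.

Lemma chain3_row : derive1n 3 (fun s => F (q s)) 0 = 'd F 0 (derive1n 3 q 0).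
Proof.
apply/rowP => i; apply: etrans (derive1n_coord 3 i sFq) _.
exact: etrans (chain3 sq q0 dq0 (sFi i)) (d_coord_sum i 3).
Qed.

Lemma chain_fifth_row (l : R) : derive1n 3 q 0 = l *: derive1n 2 q 0 ->
  3 *: derive1n 5 (fun s => F (q s)) 0 - (10 * l) *: derive1n 4 (fun s => F (q s)) 0 =
  'd F 0 (3 *: derive1n 5 q 0 - (10 * l) *: derive1n 4 q 0).
Proof.
move=> E; apply/rowP => i; rewrite [LHS]mxE [in X in X + _]mxE [in X in _ + X]mxE [in X in _ - X]mxE.
apply: etrans (f_equal2 (fun a b => 3 * a - 10 * l * b) (derive1n_coord 5 i sFq) (derive1n_coord 4 i sFq)) _.
apply: etrans (chain_fifth sq q0 dq0 (sFi i) E) _.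
exact: (esym (d_row _ i (smooth_at_diff sF))).
Qed.

End ChainRuleRow.

End DerivativeAlgebra.

(** * Invariants of germs in prenormal form *)

Section Prenormal.
Context {R : realType}.
Implicit Types (p v w : 'rV[R]_2).

Definition even_lift (B : 'rV[R]_2 -> R) p : R := B (row2 (p 0 0) (p 0 1 ^+ 2)).

Definition prenormal (B : 'rV[R]_2 -> R) p : 'rV[R]_3 :=
  row3 (p 0 0) (p 0 1 ^+ 2) (p 0 1 ^+ 3 * even_lift B p).

Lemma fold_smooth p : smooth_at p (fun p => row2 (p 0 0) (p 0 1 ^+ 2)).
Proof.
by apply: smooth_at_row2; [exact: smooth_at_coord|apply: smooth_atX; exact: smooth_at_coord].
Qed.

Lemma fold0 : row2 ((0 : 'rV[R]_2) 0 0) ((0 : 'rV[R]_2) 0 1 ^+ 2) = 0.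
Proof. by rewrite !mxE expr0n row20. Qed.

Lemma even_lift_smooth B : smooth_at 0 B -> smooth_at 0 (even_lift B).
Proof.
move=> sB; apply: (smooth_at_comp_scalar (fold_smooth 0)).
by move: sB; rewrite -{1}fold0.
Qed.

Lemma prenormal_smooth_near B p : smooth_at p (even_lift B) -> smooth_at p (prenormal B).
Proof.
move=> sB; apply: smooth_at_row3; first exact: smooth_at_coord.
  by apply: smooth_atX; exact: smooth_at_coord.
by apply: smooth_atM => //; apply: smooth_atX; exact: smooth_at_coord.
Qed.

Lemma prenormal0 B : prenormal B 0 = 0.
Proof. by rewrite /prenormal !mxE !expr0n mul0r row30. Qed.

Lemma d_sqr (V : normedModType R) (g : V -> R) (x v : V) : smooth_at x g ->
  'd (fun y => g y ^+ 2) x v = 2 * g x * 'd g x v.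
Proof.
move=> sg; have -> : (fun y => g y ^+ 2) = (fun y => g y * g y).
  by apply/funext => y; rewrite expr2.
apply: etrans (d_mul v (smooth_at_diff sg) (smooth_at_diff sg)) _.
by move: (g x) ('d g x v) => a b; ring.
Qed.

Lemma d_cube (V : normedModType R) (g : V -> R) (x v : V) : smooth_at x g ->
  'd (fun y => g y ^+ 3) x v = 3 * g x ^+ 2 * 'd g x v.
Proof.
move=> sg; have -> : (fun y => g y ^+ 3) = (fun y => g y * g y ^+ 2).
  by apply/funext => y; rewrite exprS.
apply: etrans (d_mul v (smooth_at_diff sg) (smooth_at_diff (smooth_atX 2 sg))) _.
apply: etrans (congr1 (fun z => g x * z + _) (d_sqr v sg)) _.
by move: (g x) ('d g x v) => a b; ring.
Qed.

(** The factor [p 0 1] is kept apart: it makes the axis singular with the second direction as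
    kernel, while the two remaining vectors are independent at every point. *)
Lemma d_prenormal B p w : smooth_at p (even_lift B) ->
  'd (prenormal B) p w =
    w 0 0 *: row3 1 0 (p 0 1 ^+ 3 * 'd (even_lift B) p (delta_mx 0 0)) +
    (p 0 1 * w 0 1) *: row3 0 2
      (p 0 1 * (p 0 1 * 'd (even_lift B) p (delta_mx 0 1) + 3 * even_lift B p)).
Proof.
move=> sB; have s0 := smooth_at_coord 0 p; have s1 := smooth_at_coord 1 p.
apply: etrans (d_row3 w s0 (smooth_atX 2 s1) (smooth_atM (smooth_atX 3 s1) sB)) _.
have e0 := d_coord 0 p w; have e1 := etrans (d_sqr w s1) (congr1 _ (d_coord 1 p w)).
have e2 := etrans (d_cube w s1) (congr1 _ (d_coord 1 p w)).
have e3 := etrans (d_sum_basis (even_lift B) p w) (sum2E _).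
have e4 := etrans (d_mul w (smooth_at_diff (smooth_atX 3 s1)) (smooth_at_diff sB))
  (f_equal2 (fun a b => p 0 1 ^+ 3 * a + even_lift B p * b) e3 e2).
apply: etrans (f_equal2 (fun a b => row3 a b _) e0 e1) _.
apply: etrans (congr1 (row3 _ _) e4) _.
have H (b bx by_ : R) : row3 (w 0 0) (2 * p 0 1 * w 0 1)
  (p 0 1 ^+ 3 * (w 0 0 *: bx + w 0 1 *: by_) + b * (3 * p 0 1 ^+ 2 * w 0 1)) =
  w 0 0 *: row3 1 0 (p 0 1 ^+ 3 * bx) +
    (p 0 1 * w 0 1) *: row3 0 2 (p 0 1 * (p 0 1 * by_ + 3 * b)).
  apply/rowP; apply: ord3P; rewrite !mxE /=; [ring|ring|].
  by rewrite -![_ *: _]/(_ * _); ring.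
exact: H.
Qed.

Context (B : 'rV[R]_2 -> R) (sB : smooth_at 0 B).
Context (Phi : 'rV[R]_3 -> 'rV[R]_3) (dPhi : diffeo_germ Phi).
Context (phi : 'rV[R]_2 -> 'rV[R]_2) (dphi : diffeo_germ phi).
Context (f nu : 'rV[R]_2 -> 'rV[R]_3).
Context (fE : \forall p \near (0 : 'rV[R]_2), f p = Phi (prenormal B (phi p))).
Context (nuf : normal_vector f nu).

Local Notation q p := (prenormal B (phi p)).
Local Notation b := (even_lift B).
Let T i p := 'd Phi (q p) (delta_mx 0 i).
Let y p := phi p 0 1.
Let H p := y p * 'd b (phi p) (delta_mx 0 1) + 3 * b (phi p).
(** [G0] and [G1] are the images under the differential of [Phi] of the two vectors in
    [d_prenormal]. They span the limiting tangent plane and stay independent across the singular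
    set. *)
Let G0 p := T 0 p + (y p ^+ 3 * 'd b (phi p) (delta_mx 0 0)) *: T 2 p.
Let G1 p := 2 *: T 1 p + (y p * H p) *: T 2 p.

Let sphi : smooth_at 0 phi. Proof. by case: dphi => e []. Qed.
Let phi0 : phi 0 = 0. Proof. by case: dphi => e []. Qed.
Let sPhi : smooth_at 0 Phi. Proof. by case: dPhi => e []. Qed.
Let Phi0 : Phi 0 = 0. Proof. by case: dPhi => e []. Qed.
Let sb : smooth_at 0 b. Proof. exact: even_lift_smooth. Qed.
Let sbphi : smooth_at (phi 0) b. Proof. by rewrite phi0. Qed.
Let q0 : q 0 = 0. Proof. by rewrite phi0 prenormal0. Qed.
Let sPhiq : smooth_at (q 0) Phi. Proof. by rewrite q0. Qed.
Let sq : smooth_at 0 (fun p => q p).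
Proof. exact: (smooth_at_comp sphi (prenormal_smooth_near sbphi)). Qed.

Let sT i : smooth_at 0 (T i).
Proof. exact: (smooth_at_comp sq (smooth_at_d (delta_mx 0 i) sPhiq)). Qed.
Let sy : smooth_at 0 y.
Proof. by have /smooth_at_rowP := sphi; apply. Qed.
Let sbp : smooth_at 0 (fun p => b (phi p)).
Proof. exact: (smooth_at_comp_scalar sphi sbphi). Qed.
Let sbi i : smooth_at 0 (fun p => 'd b (phi p) (delta_mx 0 i)).
Proof. exact: (smooth_at_comp_scalar sphi (smooth_at_d _ sbphi)). Qed.
Let sH : smooth_at 0 H.
Proof.
apply: smooth_atD; first exact: (smooth_atM sy (sbi 1)).
by apply: smooth_atM => //; exact: smooth_at_cst.
Qed.
Let snu : smooth_at 0 nu. Proof. by case: nuf. Qed.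

Let near_smooth_phi : \forall p \near (0 : 'rV[R]_2), smooth_at p phi.
Proof. exact: smooth_at_near. Qed.
Let near_smooth_b : \forall p \near (0 : 'rV[R]_2), smooth_at (phi p) b.
Proof. exact: (smooth_at_near_val sphi phi0 (smooth_at_near sb)). Qed.
Let near_smooth_Phi : \forall p \near (0 : 'rV[R]_2), smooth_at (q p) Phi.
Proof. exact: (smooth_at_near_val sq q0 (smooth_at_near sPhi)). Qed.
Let near_inj_phi : \forall p \near (0 : 'rV[R]_2), forall v, 'd phi p v = 0 -> v = 0.
Proof. exact: diffeo_germ_d_inj. Qed.
Let near_inj_Phi : \forall p \near (0 : 'rV[R]_2), forall v : 'rV[R]_3, 'd Phi (q p) v = 0 -> v = 0.
Proof. exact: (smooth_at_near_val sq q0 (diffeo_germ_d_inj dPhi)). Qed.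

Let d_Phi p (v : 'rV[R]_3) : 'd Phi (q p) v = v 0 0 *: T 0 p + v 0 1 *: T 1 p + v 0 2 *: T 2 p.
Proof. exact: (etrans (d_sum_basis Phi (q p) v) (sum3E _)). Qed.

Let d_q : \forall p \near (0 : 'rV[R]_2), forall v,
  'd (fun p => q p) p v = 'd (prenormal B) (phi p) ('d phi p v).
Proof.
near=> p => v; have s1 : smooth_at p phi by near: p.
have s2 : smooth_at (phi p) b by near: p.
exact: (d_comp v (smooth_at_diff s1) (smooth_at_diff (prenormal_smooth_near s2))).
Unshelve. all: by end_near. Qed.

Let d_f : \forall p \near (0 : 'rV[R]_2), forall v, 'd f p v =
  ('d phi p v) 0 0 *: G0 p + (y p * ('d phi p v) 0 1) *: G1 p.
Proof.
have fE2 : \forall p \near (0 : 'rV[R]_2), \forall z \near p, Phi (q z) = f z.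
  apply: near_join; exact: filterS fE.
near=> p => v; have s1 : smooth_at p phi by near: p.
have s2 : smooth_at (phi p) b by near: p.
have s3 : smooth_at (q p) Phi by near: p.
have sqp : smooth_at p (fun p => q p) := smooth_at_comp s1 (prenormal_smooth_near s2).
have E : \forall z \near p, Phi (q z) = f z by near: p.
have dq : 'd (fun p => q p) p v = 'd (prenormal B) (phi p) ('d phi p v).
  by move: v; near: p.
apply: etrans (esym (d_near v E (smooth_at_diff (smooth_at_comp sqp s3)))) _.
apply: etrans (d_comp v (smooth_at_diff sqp) (smooth_at_diff s3)) _.
apply: etrans (congr1 _ (etrans dq (d_prenormal _ s2))) _.
apply: etrans (d_Phi p _) _.
rewrite /G0 /G1 /H /y.
have K (a c z bx by_ b0 : R) (t0 t1 t2 : 'rV[R]_3) :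
  let r := a *: row3 1 0 (z ^+ 3 * bx) + (z * c) *: row3 0 2 (z * (z * by_ + 3 * b0)) in
  r 0 0 *: t0 + r 0 1 *: t1 + r 0 2 *: t2 =
  a *: (t0 + (z ^+ 3 * bx) *: t2) + (z * c) *: (2 *: t1 + (z * (z * by_ + 3 * b0)) *: t2).
  by apply/rowP => j; rewrite !mxE /=; ring.
exact: K.
Unshelve. all: by end_near. Qed.

Let G_free : \forall p \near (0 : 'rV[R]_2), forall a c : R,
  a *: G0 p + c *: G1 p = 0 -> a = 0 /\ c = 0.
Proof.
near=> p => a c E.
have inj : forall v : 'rV[R]_3, 'd Phi (q p) v = 0 -> v = 0 by near: p.
have : row3 a (2 * c) (a * (y p ^+ 3 * 'd b (phi p) (delta_mx 0 0)) + c * (y p * H p)) = 0.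
  apply: inj; apply: etrans (d_Phi p _) _; rewrite -[RHS]E /G0 /G1.
  move: (y p ^+ 3 * 'd b (phi p) (delta_mx 0 0)) (y p * H p) (T 0 p) (T 1 p) (T 2 p) => u v t0 t1 t2.
  by apply/rowP => j; rewrite !mxE /=; ring.
move=> Z; split.
  by have := congr1 (fun v : 'rV[R]_3 => v 0 0) Z; rewrite /= !mxE.
by have := congr1 (fun v : 'rV[R]_3 => v 0 1) Z; rewrite /= !mxE /=; lra.
Unshelve. all: by end_near. Qed.

Lemma prenormal_singular : \forall p \near (0 : 'rV[R]_2), singular_set f p <-> phi p 0 1 = 0.
Proof.
near=> p.
have inj : forall v, 'd phi p v = 0 -> v = 0 by near: p.
have df : forall v, 'd f p v =
  ('d phi p v) 0 0 *: G0 p + (y p * ('d phi p v) 0 1) *: G1 p by near: p.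
have G : forall a c : R, a *: G0 p + c *: G1 p = 0 -> a = 0 /\ c = 0 by near: p.
split.
  move=> /singular_setP[v v0]; rewrite df => /G[w0] /eqP; rewrite mulf_eq0.
  case/orP => /eqP // w1; case/eqP: v0; apply: inj.
  by apply/rowP; apply: ord2P; rewrite [RHS]mxE.
move=> y0; apply/singular_setP; have [v vE] := d_surjective (row2 0 1) inj.
exists v.
  apply/eqP => v0; move: vE; rewrite v0 linear0 => /(congr1 (fun w : 'rV[R]_2 => w 0 1)).
  by rewrite /= !mxE /= => /esym/eqP; rewrite oner_eq0.
by rewrite df vE !mxE /= /y y0 mul0r !scale0r addr0.
Unshelve. all: by end_near. Qed.

Let sG0 : smooth_at 0 G0.
Proof.
apply: smooth_atD => //; apply: smooth_atZ => //; apply: smooth_atM => //.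
exact: smooth_atX.
Qed.
Let sG1 : smooth_at 0 G1.
Proof.
apply: smooth_atD; last by apply: smooth_atZ => //; exact: smooth_atM.
by apply: smooth_atZ => //; exact: smooth_at_cst.
Qed.

Let y0 : y 0 = 0. Proof. by rewrite /y phi0 mxE. Qed.

Let d_y : \forall p \near (0 : 'rV[R]_2), forall v, 'd y p v = ('d phi p v) 0 1.
Proof.
near=> p => v; have s1 : smooth_at p phi by near: p.
exact: (esym (d_row v 1 (smooth_at_diff s1))).
Unshelve. all: by end_near. Qed.

(** Normality to the image of the differential gives only [y * dot G1 nu = 0]; since [y] is a
    regular function, it can be cancelled on germs, also along its zero set. *)
Let G_normal : \forall p \near (0 : 'rV[R]_2), dot (G0 p) (nu p) = 0 /\ dot (G1 p) (nu p) = 0.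
Proof.
have yG : \forall p \near (0 : 'rV[R]_2),
    dot (G0 p) (nu p) = 0 /\ y p * dot (G1 p) (nu p) = 0.
  case: nuf => _ _ orth; near=> p.
  have inj : forall v, 'd phi p v = 0 -> v = 0 by near: p.
  have df : forall v, 'd f p v =
    ('d phi p v) 0 0 *: G0 p + (y p * ('d phi p v) 0 1) *: G1 p by near: p.
  have o : forall X, dot ('d f p X) (nu p) = 0 by near: p.
  split.
    have [v vE] := d_surjective (row2 1 0) inj.
    by have := o v; rewrite df vE !rcE mulr0 scale0r addr0 scale1r.
  have [v vE] := d_surjective (row2 0 1) inj.
  by have := o v; rewrite df vE !rcE mulr1 scale0r add0r dotZl.
have G1n : \forall p \near (0 : 'rV[R]_2), dot (G1 p) (nu p) = 0.
  apply: (near_mul_eq0 sy (smooth_at_dot sG1 snu)).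
    near=> p.
    have inj : forall v, 'd phi p v = 0 -> v = 0 by near: p.
    have dy : forall v, 'd y p v = ('d phi p v) 0 1 by near: p.
    have [v vE] := d_surjective (row2 0 1) inj.
    by exists v; rewrite dy vE rcE oner_eq0.
  by apply: filterS yG => p [].
by near=> p; split; [have [] : dot (G0 p) (nu p) = 0 /\
    y p * dot (G1 p) (nu p) = 0 by near: p|near: p].
Unshelve. all: by end_near. Qed.

(** The signed area density is [y * K], where [K] is nonzero at 0 because [nu] is transverse to the
    plane of [G0] and [G1]. Its differential at 0 is therefore [K 0] times that of [y]. *)
Lemma prenormal_nondegenerate : nondegenerate_singular f nu.
Proof.
split.
  by apply/(nbhs_singleton prenormal_singular); rewrite phi0 mxE.
pose K p := det2 ('d phi p (delta_mx 0 0)) ('d phi p (delta_mx 0 1)) *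
  det3 (G0 p) (G1 p) (nu p).
have lamE : \forall p \near (0 : 'rV[R]_2), y p * K p = signed_area_density f nu p.
  near=> p.
  have df : forall v, 'd f p v =
    ('d phi p v) 0 0 *: G0 p + (y p * ('d phi p v) 0 1) *: G1 p by near: p.
  rewrite /signed_area_density (df (delta_mx 0 0)) (df (delta_mx 0 1)) det3_combine.
  rewrite /K det2E.
  by move: (det3 _ _ _) (y p) ('d phi p (delta_mx 0 0)) ('d phi p (delta_mx 0 1)) => d z u v; ring.
have sK : smooth_at 0 K.
  apply: smooth_atM; last exact: smooth_at_det3.
  by apply: smooth_at_det2; exact: smooth_at_d.
have inj := nbhs_singleton near_inj_phi.
have [v vE] := d_surjective (row2 0 1) inj; exists v.
have := d_near v lamE (smooth_at_diff (smooth_atM sy sK)).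
move=> /(etrans (esym (d_mul v (smooth_at_diff sy) (smooth_at_diff sK)))) <-.
rewrite y0 mul0r add0r (nbhs_singleton d_y v) vE rcE mulr1 /K mulf_neq0 //.
  rewrite det2_d mulf_neq0 ?det_jacobian //.
  by rewrite delta2_0 delta2_1 det2E !rcE mulr1 mul0r subr0 oner_eq0.
have [n0 n1] := nbhs_singleton G_normal.
apply: det3_orthogonal => //; first exact: (nbhs_singleton G_free).
by case: nuf => _ /nbhs_singleton.
Unshelve. all: by end_near. Qed.

(* The two relations on [nu] come from differentiating the normality
   conditions along the null direction, in which [prenormal B] is stationary. *)
Lemma prenormal_contact : \forall p \near (0 : 'rV[R]_2), phi p 0 1 = 0 ->
  [/\ dot (T 0 p) (nu p) = 0, dot (T 1 p) (nu p) = 0 &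
  forall v, ('d phi p v) 0 0 = 0 ->
  dot (T 0 p) ('d nu p v) = 0 /\
  2 * dot (T 1 p) ('d nu p v) =
    - (3 * ('d phi p v) 0 1 * B (row2 (phi p 0 0) 0) * dot (T 2 p) (nu p))].
Proof.
have G0n : \forall p \near (0 : 'rV[R]_2), \forall z \near p,
    dot (T 0 z) (nu z) + y z * (y z ^+ 2 * 'd b (phi z) (delta_mx 0 0) * dot (T 2 z) (nu z)) = 0.
  apply: near_join; apply: filterS G_normal => p [+ _].
  by rewrite /G0 dotDl dotZl exprS !mulrA.
have G1n : \forall p \near (0 : 'rV[R]_2), \forall z \near p,
    2 * dot (T 1 z) (nu z) + y z * (H z * dot (T 2 z) (nu z)) = 0.
  apply: near_join; apply: filterS G_normal => p [_].
  by rewrite /G1 dotDl !dotZl !mulrA.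
near=> p; rewrite -[phi p 0 1]/(y p) => yp0.
have g0 : \forall z \near p, dot (T 0 z) (nu z) +
    y z * (y z ^+ 2 * 'd b (phi z) (delta_mx 0 0) * dot (T 2 z) (nu z)) = 0 by near: p.
have g1 : \forall z \near p, 2 * dot (T 1 z) (nu z) + y z * (H z * dot (T 2 z) (nu z)) = 0.
  by near: p.
split.
- by have := nbhs_singleton g0; rewrite yp0 mul0r addr0.
- by have := nbhs_singleton g1; rewrite yp0 mul0r addr0 => ?; lra.
move=> v w0.
have s1 : smooth_at p phi by near: p.
have s2 : smooth_at (phi p) b by near: p.
have s3 : smooth_at (q p) Phi by near: p.
have sqp : smooth_at p (fun p => q p) := smooth_at_comp s1 (prenormal_smooth_near s2).
have snp : smooth_at p nu by near: p; exact: (smooth_at_near snu).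
have syp : smooth_at p y by near: p; exact: (smooth_at_near sy).
have sHp : smooth_at p H by near: p; exact: (smooth_at_near sH).
have sTp i : smooth_at p (T i) := smooth_at_comp sqp (smooth_at_d (delta_mx 0 i) s3).
have dy : 'd y p v = ('d phi p v) 0 1 by exact: (esym (d_row v 1 (smooth_at_diff s1))).
have dq0 : 'd (fun p => q p) p v = 0.
  apply: etrans (d_comp v (smooth_at_diff s1) (smooth_at_diff (prenormal_smooth_near s2))) _.
  apply: etrans (d_prenormal _ s2) _.
  by rewrite w0 -[phi p 0 1]/(y p) yp0 mul0r !scale0r addr0.
have dT i : 'd (T i) p v = 0.
  apply: etrans (d_comp v (smooth_at_diff sqp) (smooth_at_diff (smooth_at_d (delta_mx 0 i) s3))) _.
  by apply: etrans (congr1 _ dq0) _; exact: linear0.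
have smp i : smooth_at p (fun z => dot (T i z) (nu z)) := smooth_at_dot (sTp i) snp.
have dm i : 'd (fun z => dot (T i z) (nu z)) p v = dot (T i p) ('d nu p v).
  apply: etrans (d_dot v (sTp i) snp) _.
  apply: etrans (congr1 (fun u => dot u _ + _) (dT i)) _.
  by rewrite dot0l add0r.
have d_yZ Z : smooth_at p Z -> 'd (fun z => y z * Z z) p v = Z p * ('d phi p v) 0 1.
  move=> sZ; apply: etrans (d_mul v (smooth_at_diff syp) (smooth_at_diff sZ)) _.
  apply: etrans (f_equal2 (fun a c => a * _ + Z p * c) yp0 dy) _.
  by rewrite mul0r add0r.
split.
  have sZ : smooth_at p (fun z => y z ^+ 2 * 'd b (phi z) (delta_mx 0 0) * dot (T 2 z) (nu z)).
    apply: smooth_atM => //; apply: smooth_atM; first exact: smooth_atX.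
    exact: (smooth_at_comp_scalar s1 (smooth_at_d _ s2)).
  have E := etrans (d_near v g0 (smooth_at_diff (smooth_atD (smp 0) (smooth_atM syp sZ)))) (d_cst _ _ _).
  have E2 := etrans (esym (d_add v (smooth_at_diff (smp 0)) (smooth_at_diff (smooth_atM syp sZ)))) E.
  have E3 := etrans (esym (f_equal2 (fun a c => a + c) (dm 0) (d_yZ _ sZ))) E2.
  by move: E3; rewrite yp0 expr0n /= !mul0r addr0.
have sZ : smooth_at p (fun z => H z * dot (T 2 z) (nu z)) by apply: smooth_atM.
have s2m : smooth_at p (fun z => 2 * dot (T 1 z) (nu z)).
  by apply: smooth_atM => //; exact: smooth_at_cst.
have E := etrans (d_near v g1 (smooth_at_diff (smooth_atD s2m (smooth_atM syp sZ)))) (d_cst _ _ _).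
have E2 := etrans (esym (d_add v (smooth_at_diff s2m) (smooth_at_diff (smooth_atM syp sZ)))) E.
have d2 : 'd (fun z => 2 * dot (T 1 z) (nu z)) p v = 2 * dot (T 1 p) ('d nu p v).
  apply: etrans (d_mul v (smooth_at_diff (smooth_at_cst p (2 : R))) (smooth_at_diff (smp 1))) _.
  apply: etrans (f_equal2 (fun a c => 2 * a + _ * c) (dm 1) (d_cst (2 : R) p v)) _.
  by rewrite mulr0 addr0.
have E3 := etrans (esym (f_equal2 (fun a c => a + c) d2 (d_yZ _ sZ))) E2.
have -> : B (row2 (phi p 0 0) 0) = b (phi p).
  by rewrite /even_lift -[phi p 0 1]/(y p) yp0 expr0n.
have HE : H p = 3 * b (phi p) by rewrite /H yp0 mul0r add0r.
move: E3; rewrite HE.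
move: (dot (T 1 p) ('d nu p v)) (dot (T 2 p) (nu p)) (('d phi p v) 0 1) (b (phi p)) => A1 A2 A3 A4.
by move=> /eqP; rewrite addr_eq0 => /eqP ->; congr (- _); ring.
Unshelve. all: by end_near. Qed.

Context (gamma eta : R -> 'rV[R]_2) (sd : singular_data f gamma eta).

(** In the coordinates [phi] the singular curve is [(g, 0)] and the null field is [(0, e)]. *)
Let g (t : R) : R := phi (gamma t) 0 0.
Let e (t : R) : R := ('d phi (gamma t) (eta t)) 0 1.

Let sgamma : smooth_at 0 gamma.
Proof. exact: singular_data_smooth sd. Qed.
Let gamma0 : gamma 0 = 0. Proof. by case: sd => -[r r0 []]. Qed.
Let dgamma0 : derive1 gamma 0 != 0.
Proof.
by case: sd => -[r r0 [_ _ + _]] _; apply; rewrite /= in_itv /= oppr_lt0 r0.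
Qed.
Let seta : smooth_at 0 eta. Proof. by case: sd => _ []. Qed.
Let sgphi : smooth_at (gamma 0) phi. Proof. by rewrite gamma0. Qed.
Let sphig : smooth_at 0 (fun t => phi (gamma t)). Proof. exact: smooth_at_comp. Qed.
Let sg : smooth_at 0 g. Proof. by have /smooth_at_rowP := sphig; apply. Qed.
Let se : smooth_at 0 e.
Proof. by have /smooth_at_rowP := smooth_at_d_along sgamma seta sgphi; apply. Qed.
Let sf : smooth_at 0 f.
Proof.
apply: (@smooth_at_eq _ _ _ _ (fun p => Phi (q p))); last exact: (smooth_at_comp sq sPhiq).
by apply: filterS fE.
Qed.

Let along (P : set 'rV[R]_2) : (\forall p \near (0 : 'rV[R]_2), P p) ->
  \forall t \near (0 : R), P (gamma t).
Proof. exact: (smooth_at_near_val sgamma gamma0). Qed.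

Let yg : \forall t \near (0 : R), y (gamma t) = 0.
Proof.
have S : \forall t \near (0 : R), singular_set f (gamma t).
  case: sd => -[r r0 [_ _ _ [U _ E]]] _.
  have : \forall t \near (0 : R), `]-r, r[%classic t.
    by apply: near_in_itvoo; rewrite in_itv /= oppr_lt0 r0.
  apply: filterS => t tr; have [] : (singular_set f `&` U) (gamma t) by rewrite -E; exists t.
  by [].
have A := along prenormal_singular; near=> t.
have SP : singular_set f (gamma t) <-> phi (gamma t) 0 1 = 0 by near: t.
by apply/SP; near: t.
Unshelve. all: by end_near. Qed.

(** Independence of [G0] and [G1] turns the vanishing of the differential on [eta] into the
    vanishing of the first adapted component; the other one is then nonzero as [phi] is a
    diffeomorphism. *)
Let d_phi_eta : \forall t \near (0 : R),
  ('d phi (gamma t) (eta t)) 0 0 = 0 /\ e t != 0.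
Proof.
have A1 := along d_f; have A2 := along G_free; have A3 := along near_inj_phi.
case: sd => _ [_ eta0 nul]; near=> t.
have df : forall v, 'd f (gamma t) v = ('d phi (gamma t) v) 0 0 *: G0 (gamma t) +
  (y (gamma t) * ('d phi (gamma t) v) 0 1) *: G1 (gamma t) by near: t.
have G : forall a c : R, a *: G0 (gamma t) + c *: G1 (gamma t) = 0 -> a = 0 /\ c = 0.
  by near: t.
have inj : forall v, 'd phi (gamma t) v = 0 -> v = 0 by near: t.
have N : forall X, 'd f (gamma t) X = 0 <-> exists r, X = r *: eta t by near: t.
have et0 : eta t != 0 by near: t.
have : 'd f (gamma t) (eta t) = 0 by apply/N; exists 1; rewrite scale1r.
rewrite df => /G[w0 _]; split=> //; apply: contra_neq et0 => w1; apply: inj.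
by apply/rowP; apply: ord2P; rewrite [RHS]mxE.
Unshelve. all: by end_near. Qed.

Let d_phi_gamma : \forall t \near (0 : R),
  'd phi (gamma t) (derive1 gamma t) = row2 (derive1 g t) 0.
Proof.
have A1 := along near_smooth_phi.
have yg2 : \forall t \near (0 : R), \forall s \near t, y (gamma s) = 0 by exact: near_join.
have sg1 : \forall t \near (0 : R), smooth_at t gamma by exact: smooth_at_near.
near=> t.
have s1 : smooth_at (gamma t) phi by near: t.
have s2 : smooth_at t gamma by near: t.
have Y : \forall s \near t, y (gamma s) = 0 by near: t.
have s3 : smooth_at t (fun s => phi (gamma s)) := smooth_at_comp s2 s1.
have E : 'd phi (gamma t) (derive1 gamma t) = derive1 (fun s => phi (gamma s)) t.
  exact: (esym (derive1_d_comp s2 s1 (smooth_at_diff s3))).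
rewrite E; apply/rowP; apply: ord2P; rewrite rcE.
  exact: (derive1n_coord 1 0 s3).
apply: etrans (derive1n_coord 1 1 s3) _.
apply: etrans (eq_derive1n 1 Y) _.
exact: derive1_cst.
Unshelve. all: by end_near. Qed.

Let d_fgamma : \forall t \near (0 : R),
  derive1 (f \o gamma) t = derive1 g t *: T 0 (gamma t).
Proof.
have A1 := along d_f; have A2 := along (smooth_at_near sf).
have sg1 : \forall t \near (0 : R), smooth_at t gamma by exact: smooth_at_near.
near=> t.
have df : forall v, 'd f (gamma t) v = ('d phi (gamma t) v) 0 0 *: G0 (gamma t) +
  (y (gamma t) * ('d phi (gamma t) v) 0 1) *: G1 (gamma t) by near: t.
have s1 : smooth_at (gamma t) f by near: t.
have s2 : smooth_at t gamma by near: t.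
have yt : y (gamma t) = 0 by near: t.
have dg : 'd phi (gamma t) (derive1 gamma t) = row2 (derive1 g t) 0 by near: t.
have -> : derive1 (f \o gamma) t = 'd f (gamma t) (derive1 gamma t).
  exact: (derive1_d_comp s2 s1 (smooth_at_diff (smooth_at_comp s2 s1))).
by rewrite df dg !rcE /G0 yt expr0n /= !mul0r !scale0r !addr0.
Unshelve. all: by end_near. Qed.

Lemma prenormal_coordinates : [/\ smooth_at 0 g, g 0 = 0, derive1 g 0 != 0 & e 0 != 0] /\
  'd phi 0 (derive1 gamma 0) = row2 (derive1 g 0) 0 /\ 'd phi 0 (eta 0) = row2 0 (e 0).
Proof.
have dg := nbhs_singleton d_phi_gamma; have [de e0] := nbhs_singleton d_phi_eta.
rewrite gamma0 in dg de; have e00 : e 0 = ('d phi 0 (eta 0)) 0 1 by rewrite /e gamma0.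
split; last first.
  split; first exact: dg.
  by apply/rowP; apply: ord2P; rewrite rcE; [exact: de|exact: (esym e00)].
split; [exact: sg|by rewrite /g gamma0 phi0 mxE| |exact: e0].
have inj := nbhs_singleton near_inj_phi.
apply: contra_neq dgamma0 => g'0; apply: inj.
by apply: etrans dg _; rewrite g'0 row20.
Qed.

Lemma prenormal_transverse : null_transverse gamma eta.
Proof.
have [[_ _ g'0 e0] [dg de]] := prenormal_coordinates.
apply/row_full2P; have : det2 ('d phi 0 (derive1 gamma 0)) ('d phi 0 (eta 0)) != 0.
  by rewrite dg de det2E !rcE mul0r subr0 mulf_neq0.
by rewrite det2_d; apply: contra_neq => ->; rewrite mul0r.
Qed.

Let J p := det3 (T 0 p) (T 1 p) (T 2 p).

Let J_neq0 : \forall p \near (0 : 'rV[R]_2), J p != 0.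
Proof.
near=> p.
have inj : forall v : 'rV[R]_3, 'd Phi (q p) v = 0 -> v = 0 by near: p.
rewrite /J /T det3_d mulf_neq0 ?det_jacobian //.
by rewrite det3E !mxE /=; apply/eqP; lra.
Unshelve. all: by end_near. Qed.

(** The determinant is computed against the basis [T 0, T 1, T 2] by the Gram identity. As [nu] is
    orthogonal to [T 0] and [T 1], and the derivative of [nu] to [T 0], one product survives, and
    [prenormal_contact] evaluates its last factor. *)
Lemma prenormal_psi : exists (U : R -> R) (K : R), [/\ smooth_at 0 U,
  \forall t \near (0 : R), psi f nu gamma eta t = U t * B (row2 (g t) 0),
  0 < K & U 0 = derive1 g 0 * e 0 * K / \det ('J Phi 0)].
Proof.
(* The factor 3/2 and one of the two factors [dot (T 2 p) (nu p)] come from [prenormal_contact]; the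
   Gram identity gives the rest. The square makes [K] nonnegative. *)
pose K p := 3 / 2 * dot (T 0 p) (T 0 p) * dot (T 2 p) (nu p) ^+ 2.
pose U (t : R) := derive1 g t * e t * K (gamma t) / J (gamma t).
exists U, (K 0); split.
- have sT0 i : smooth_at (gamma 0) (T i) by rewrite gamma0; exact: sT.
  have snu0 : smooth_at (gamma 0) nu by rewrite gamma0.
  have sTg i : smooth_at 0 (fun t => T i (gamma t)) := smooth_at_comp sgamma (sT0 i).
  have snug : smooth_at 0 (fun t => nu (gamma t)) := smooth_at_comp sgamma snu0.
  apply: smooth_atM; last first.
    apply: smooth_atV; first by exact: smooth_at_det3.
    by rewrite gamma0; exact: (nbhs_singleton J_neq0).
  apply: smooth_atM; first by apply: smooth_atM => //; exact: smooth_at_derive1.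
  apply: smooth_atM; last by apply: smooth_atX; exact: smooth_at_dot.
  by apply: smooth_atM; [exact: smooth_at_cst|exact: smooth_at_dot].
- have A1 := along prenormal_contact; have A2 := along J_neq0; near=> t.
  have J0 : J (gamma t) != 0 by near: t.
  have yt : y (gamma t) = 0 by near: t.
  have [m0 m1 C] : [/\ dot (T 0 (gamma t)) (nu (gamma t)) = 0, dot (T 1 (gamma t)) (nu (gamma t)) = 0 &
    forall v, ('d phi (gamma t) v) 0 0 = 0 ->
    dot (T 0 (gamma t)) ('d nu (gamma t) v) = 0 /\
    2 * dot (T 1 (gamma t)) ('d nu (gamma t) v) =
      - (3 * ('d phi (gamma t) v) 0 1 * B (row2 (g t) 0) * dot (T 2 (gamma t)) (nu (gamma t)))].
    by move: yt; near: t.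
  have [w0 _] : ('d phi (gamma t) (eta t)) 0 0 = 0 /\ e t != 0 by near: t.
  have [c0 c1] := C _ w0.
  have df : derive1 (f \o gamma) t = derive1 g t *: T 0 (gamma t) by near: t.
  rewrite /psi df /U /K.
  have dotC (u v : 'rV[R]_3) : dot u v = dot v u by rewrite !dot3E; ring.
  have := det3_Gram (T 0 (gamma t)) (nu (gamma t)) ('d nu (gamma t) (eta t))
    (T 0 (gamma t)) (T 1 (gamma t)) (T 2 (gamma t)).
  rewrite (dotC (nu _) (T 0 _)) (dotC (nu _) (T 1 _)) (dotC (nu _) (T 2 _)).
  rewrite (dotC ('d nu _ _) (T 0 _)) (dotC ('d nu _ _) (T 1 _)) m0 m1 c0.
  rewrite -[det3 (T 0 _) (T 1 _) (T 2 _)]/(J (gamma t)).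
  have det3Zl (a : R) (u v w : 'rV[R]_3) : det3 (a *: u) v w = a * det3 u v w.
    by rewrite !det3E !mxE; ring.
  rewrite det3Zl.
  move: c1; rewrite -[('d phi _ _) 0 1]/(e t).
  move: J0; move: (det3 _ _ _) (J (gamma t)) (dot (T 1 (gamma t)) _) => d j a.
  move: (dot (T 2 (gamma t)) _) (dot (T 0 (gamma t)) (T 0 (gamma t))) (dot _ (T 2 (gamma t))) => m n z.
  move: (dot _ (T 1 (gamma t))) (B _) (derive1 g t) (e t) => k b0 g' e' j0 aE dE.
  have {}aE : a = - (3 / 2 * e' * b0 * m).
    have two : (2 : R) != 0 by rewrite pnatr_eq0.
    by apply: (mulfI two); rewrite aE; field.
  have {}dE : d = 3 / 2 * n * m ^+ 2 * e' * b0 / j.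
    by apply: (mulIf j0); rewrite dE aE; field.
  by rewrite dE; field.
- have [n0 n1 _] := nbhs_singleton prenormal_contact y0.
  have J0 := nbhs_singleton J_neq0; have free := det3_free J0.
  have T00 : T 0 0 != 0.
    apply/eqP => T00; have [] := free 1 0 0; first by rewrite T00 scaler0 !scale0r !addr0.
    by move/eqP; rewrite oner_eq0.
  have D : det3 (T 0 0) (T 1 0) (nu 0) != 0.
    apply: det3_orthogonal => //; last by case: nuf => _ /nbhs_singleton.
    by move=> a c E; have [] := free a c 0; first by rewrite scale0r addr0.
  (* Otherwise [nu 0] would be orthogonal to all three vectors of a basis, and the Gram identity
     would make [J 0 * D] vanish. *)
  have m20 : dot (T 2 0) (nu 0) != 0.
    apply: contra_neq (mulf_neq0 J0 D) => m2.
    by rewrite /J det3_Gram n0 n1 m2 !(mulr0, mul0r, subrr, addr0).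
  apply: mulr_gt0; last by rewrite lt_def sqrf_eq0 m20 sqr_ge0.
  by apply: mulr_gt0; [rewrite divr_gt0 ?ltr0n|exact: dot_gt0].
- rewrite /U gamma0; congr (_ / _); rewrite /J /T det3_d q0.
  by rewrite det3E !mxE /= !(mulr0, mul0r, mulr1, mul1r, subr0, addr0).
Unshelve. all: by end_near. Qed.

Lemma prenormal_derive_psi k :
  (forall j, (j < k)%N -> derive1n j (fun x => B (row2 x 0)) 0 = 0) ->
  exists2 K, 0 < K &
  (forall j, (j < k)%N -> derive1n j (psi f nu gamma eta) 0 = 0) /\
  derive1n k (psi f nu gamma eta) 0 = derive1 g 0 * e 0 * K / \det ('J Phi 0) *
    derive1 g 0 ^+ k * derive1n k (fun x => B (row2 x 0)) 0.
Proof.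
move=> b0; have [U [K [sU psiE K0 U0]]] := prenormal_psi; exists K => //.
have [[_ g0 _ _] _] := prenormal_coordinates.
have sB0 := smooth_on_axis sB.
have [ord1 ord2] := order_comp sB0 sg sU g0 b0.
split; first by move=> j jk; rewrite (eq_derive1n j psiE) ord1.
by rewrite (eq_derive1n k psiE) ord2 U0.
Qed.

Context (c : R -> 'rV[R]_2) (l r : R).
Context (sc : smooth_at 0 c) (c0 : c 0 = 0) (dc : derive1 c 0 = r *: eta 0).
Context (d3c : derive1n 3 (f \o c) 0 = l *: derive1n 2 (f \o c) 0).
Context (B0 : B 0 = 0) (B1 : 'd B 0 (delta_mx 0 0) = 0).

(* Along [c] the adapted source coordinates are [x = O(s^2)] and [y = r e s + O(s^2)],
   so that [prenormal B] has third coordinate [s^5 ((r e)^5 'd B 0 (0, 1) + O(s))]. *)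
Lemma prenormal_det_a : det_a f gamma c l =
  720 * (r * e 0) ^+ 7 * derive1 g 0 * 'd B 0 (delta_mx 0 1) * \det ('J Phi 0).
Proof.
have [[_ g0 _ _] [dphig dphie]] := prenormal_coordinates.
have sphic0 : smooth_at (c 0) phi by rewrite c0.
have sphic : smooth_at 0 (fun s => phi (c s)) := smooth_at_comp sc sphic0.
have dphic : derive1 (fun s => phi (c s)) 0 = row2 0 (r * e 0).
  apply: etrans (derive1_d_comp sc sphic0 (smooth_at_diff sphic)) _.
  rewrite c0 dc linearZ /= dphie.
  by apply/rowP; apply: ord2P; rewrite !mxE /= ?mulr0.
pose x (s : R) := phi (c s) 0 0; pose z (s : R) := phi (c s) 0 1.
have sx : smooth_at 0 x by have /smooth_at_rowP := sphic; apply.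
have sz : smooth_at 0 z by have /smooth_at_rowP := sphic; apply.
have x0 : x 0 = 0 by rewrite /x c0 phi0 mxE.
have z0 : z 0 = 0 by rewrite /z c0 phi0 mxE.
have dx0 : derive1 x 0 = 0.
  by apply: etrans (esym (derive1n_coord 1 0 sphic)) _; rewrite /= dphic rcE.
have dz0 : derive1 z 0 = r * e 0.
  by apply: etrans (esym (derive1n_coord 1 1 sphic)) _; rewrite /= dphic rcE.
(* The velocity of [c] is along the null vector, so the first adapted coordinate has order two and
   the second has order one. *)
have [j [sj xE _]] : exists h1, [/\ smooth_at 0 h1, \forall s \near (0 : R), x s = s ^+ 2 * h1 s &
    derive1n 2 x 0 = 2`!%:R * h1 0].
  by apply: Taylor_order => // -[|[|]].
have [k [sk zE dzk]] : exists h1, [/\ smooth_at 0 h1, \forall s \near (0 : R), z s = s ^+ 1 * h1 s &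
    derive1n 1 z 0 = 1`!%:R * h1 0].
  by apply: Taylor_order => // -[|].
have k0 : k 0 = r * e 0 by rewrite -dz0; move: dzk; rewrite /= mul1r.
have [B' sB' BE] := Hadamard sB.
have dB1 : 'd B 0 (delta_mx 0 1) = B' 0 := Hadamard_d (rowvec0 1) sB sB' BE.
have sB0 := smooth_on_axis sB.
have [b2 [sb2 b2E _]] : exists h1, [/\ smooth_at 0 h1,
    \forall s \near (0 : R), B (row2 s 0) = s ^+ 2 * h1 s &
    derive1n 2 (fun x : R => B (row2 x 0)) 0 = 2`!%:R * h1 0].
  apply: Taylor_order => // -[_|[_|//]]; first by rewrite /= row20.
  exact: etrans (derive1_axis0 sB) B1.
pose Q s := q (c s).
(* [m] is the third coordinate of [Q] divided by [s ^+ 5]: the part of [B] on the axis has order two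
   and brings [x ^ 2], hence two further factors [s]. *)
pose m (s : R) := s ^+ 2 * (k s ^+ 3 * j s ^+ 2 * b2 (x s)) +
  k s ^+ 5 * B' (row2 (x s) (z s ^+ 2)).
have sxz : smooth_at 0 (fun s => row2 (x s) (z s ^+ 2)).
  by apply: smooth_at_row2 => //; exact: smooth_atX.
have xz0 : row2 (x 0) (z 0 ^+ 2) = 0 by rewrite x0 z0 expr0n row20.
have sqc : smooth_at (c 0) (fun p => q p) by rewrite c0.
have sQ : smooth_at 0 Q := smooth_at_comp sc sqc.
have Q0 : Q 0 = 0 by rewrite /Q c0.
have sm : smooth_at 0 m.
  apply: smooth_atD.
    apply: smooth_atM; first by apply: smooth_atX; exact: smooth_at_id.
    apply: smooth_atM; first by apply: smooth_atM; exact: smooth_atX.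
    by apply: smooth_at_compR => //; rewrite x0.
  apply: smooth_atM; first exact: smooth_atX.
  by apply: smooth_at_comp_scalar => //; rewrite xz0.
have QE1 : \forall s \near (0 : R), Q s 0 1 = s ^+ 2 * k s ^+ 2.
  by apply: filterS zE => s E; rewrite /Q /prenormal rcE -[phi (c s) 0 1]/(z s) E expr1 exprMn.
have QE2 : \forall s \near (0 : R), Q s 0 2 = s ^+ 5 * m s.
  have b2x := smooth_at_near_val sx x0 b2E.
  have Bxz := smooth_at_near_val sxz xz0 BE.
  near=> s.
  rewrite /Q /prenormal rcE /even_lift -[phi (c s) 0 1]/(z s) -[phi (c s) 0 0]/(x s).
  have -> : B (row2 (x s) (z s ^+ 2)) = B (row2 (row2 (x s) (z s ^+ 2) 0 0) 0) +
    row2 (x s) (z s ^+ 2) 0 1 * B' (row2 (x s) (z s ^+ 2)) by near: s.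
  rewrite !rcE.
  have -> : B (row2 (x s) 0) = x s ^+ 2 * b2 (x s) by near: s.
  rewrite /m; move: (b2 _) (B' _) => u w.
  have -> : x s = s ^+ 2 * j s by near: s.
  have -> : z s = s ^+ 1 * k s by near: s.
  by move: (j s) (k s) => a a'; ring.
have D0 n : (derive1n n Q 0) 0 0 = derive1n n x 0.
  apply: etrans (derive1n_coord n 0 sQ) _.
  by congr (derive1n n _ 0); apply/funext => s; rewrite /Q /prenormal rcE.
have D1 n : (n <= 2)%N -> (derive1n n Q 0) 0 1 = if (n < 2)%N then 0 else 2`!%:R * k 0 ^+ 2.
  move=> n2; apply: etrans (derive1n_coord n 1 sQ) _.
  apply: etrans (eq_derive1n n QE1) _.
  exact: derive1n_monomial (smooth_atX 2 sk) n2.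
have D2 n : (n <= 5)%N -> (derive1n n Q 0) 0 2 = if (n < 5)%N then 0 else 5`!%:R * m 0.
  move=> n5; apply: etrans (derive1n_coord n 2 sQ) _.
  apply: etrans (eq_derive1n n QE2) _.
  exact: derive1n_monomial sm n5.
have dQ0 : derive1 Q 0 = 0.
  apply/rowP; apply: ord3P; rewrite [RHS]mxE.
  - exact: etrans (D0 1%N) dx0.
  - exact: (D1 1%N).
  - exact: (D2 1%N).
have fcE : \forall s \near (0 : R), (f \o c) s = Phi (Q s).
  exact: smooth_at_near_val sc c0 fE.
have inj : forall v : 'rV[R]_3, 'd Phi 0 v = 0 -> v = 0.
  by have := nbhs_singleton near_inj_Phi; rewrite q0.
have c2 : derive1n 2 (f \o c) 0 = 'd Phi 0 (derive1n 2 Q 0) :=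
  etrans (eq_derive1n 2 fcE) (chain2_row sQ Q0 dQ0 sPhi).
have c3 : derive1n 3 (f \o c) 0 = 'd Phi 0 (derive1n 3 Q 0) :=
  etrans (eq_derive1n 3 fcE) (chain3_row sQ Q0 dQ0 sPhi).
(* The relation with [l] is carried back from [f \o c] to [Q] by injectivity of the differential of
   [Phi]. *)
have dQ3 : derive1n 3 Q 0 = l *: derive1n 2 Q 0.
  apply/eqP; rewrite -subr_eq0; apply/eqP; apply: inj.
  apply: etrans (linearB ('d Phi 0) _ _) _; apply/eqP; rewrite subr_eq0; apply/eqP.
  apply: etrans (esym c3) _; apply: etrans d3c _.
  apply: etrans (congr1 (fun v : 'rV[R]_3 => l *: v) c2) _.
  exact: (esym (linearZZ ('d Phi 0) l _)).
have f4 : derive1n 4 (f \o c) 0 = derive1n 4 (fun s => Phi (Q s)) 0 := eq_derive1n 4 fcE.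
have f5 : derive1n 5 (f \o c) 0 = derive1n 5 (fun s => Phi (Q s)) 0 := eq_derive1n 5 fcE.
have c5 : 3 *: derive1n 5 (f \o c) 0 - (10 * l) *: derive1n 4 (f \o c) 0 =
    'd Phi 0 (3 *: derive1n 5 Q 0 - (10 * l) *: derive1n 4 Q 0).
  rewrite f4 f5; exact: (chain_fifth_row sQ Q0 dQ0 sPhi dQ3).
have c1 : derive1 (f \o gamma) 0 = 'd Phi 0 (derive1 g 0 *: delta_mx 0 0).
  apply: etrans (nbhs_singleton d_fgamma) _.
  by rewrite gamma0 /T q0 linearZ.
rewrite -[LHS]/(det3 (derive1 (f \o gamma) 0) (derive1n 2 (f \o c) 0)
  (3 *: derive1n 5 (f \o c) 0 - (10 * l) *: derive1n 4 (f \o c) 0)).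
rewrite c1 c2 c5; apply: etrans (det3_d _ _ _ _ _) _; congr (_ * _).
have m0 : m 0 = (r * e 0) ^+ 5 * 'd B 0 (delta_mx 0 1).
  by rewrite /m xz0 expr0n mul0r add0r k0 dB1.
have fact2 : 2`!%:R = 2 :> R by [].
have fact5 : 5`!%:R = 120 :> R by rewrite (_ : 5`! = 120)%N.
have u1 : (derive1n 2 Q 0) 0 1 = 2 * (r * e 0) ^+ 2.
  exact: etrans (D1 2%N isT) (f_equal2 (fun a b : R => a * b ^+ 2) fact2 k0).
have u2 : (derive1n 2 Q 0) 0 2 = 0 := D2 2%N isT.
have v2 : (derive1n 4 Q 0) 0 2 = 0 := D2 4%N isT.
have w2 : (derive1n 5 Q 0) 0 2 = 120 * ((r * e 0) ^+ 5 * 'd B 0 (delta_mx 0 1)).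
  exact: etrans (D2 5%N isT) (f_equal2 (fun a b : R => a * b) fact5 m0).
(* The constant is [720 = 2 * 3 * 120]: 2 from the second derivative of the middle coordinate, 3
   from the combination, and [5!] from the last coordinate. *)
have alg (u v w : 'rV[R]_3) (g' re b' : R) : u 0 1 = 2 * re ^+ 2 -> u 0 2 = 0 ->
    v 0 2 = 0 -> w 0 2 = 120 * (re ^+ 5 * b') ->
    det3 (g' *: delta_mx 0 0) u (3 *: w - (10 * l) *: v) = 720 * re ^+ 7 * g' * b'.
  by move=> h1 h2 h3 h4; rewrite det3E !mxE /= h1 h2 h3 h4; ring.
exact: alg u1 u2 v2 w2.
Unshelve. all: by end_near. Qed.

End Prenormal.

(** * Prenormal germs and cuspidal S singularities *)

Section NormalForm.
Context {R : realType}.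

Lemma smooth_at_near_neq0 (V : normedModType R) (x : V) (g : V -> R) :
  smooth_at x g -> g x != 0 -> \forall p \near x, g p != 0.
Proof.
move=> sg g0; apply: (smooth_at_near_val (P := [set r | r != 0]) sg erefl).
by apply: open_nbhs_nbhs; split; [exact: open_neq|].
Qed.

Lemma d_mul0 (V : normedModType R) (a g : V -> R) (x v : V) :
  smooth_at x a -> smooth_at x g -> a x = 0 ->
  'd (fun p => a p * g p) x v = g x * 'd a x v.
Proof.
move=> sa sg a0; apply: etrans (d_mul v (smooth_at_diff sa) (smooth_at_diff sg)) _.
by rewrite a0 mul0r add0r.
Qed.

Lemma cuspidal_SE k sigma (p : 'rV[R]_2) : (0 < k)%N ->
  cuspidal_S k.-1 sigma p =
  row3 (p 0 0) (p 0 1 ^+ 2) (p 0 1 ^+ 3 * (p 0 0 ^+ k + signR sigma * p 0 1 ^+ 2)).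
Proof. by move=> k0; apply/rowP; apply: ord3P; rewrite !mxE //= prednK. Qed.

Lemma sqr_signR sigma : signR sigma * signR sigma = 1 :> R.
Proof. by case: sigma; rewrite /signR ?mulrNN ?mulr1. Qed.

Lemma signR_neq0 sigma : signR sigma != 0 :> R.
Proof. by case: sigma; rewrite /signR ?oppr_eq0 oner_eq0. Qed.

Lemma powR_root (a : R) k : (0 < k)%N -> 0 <= a -> powR a k%:R^-1 ^+ k = a.
Proof.
move=> k0 a0; rewrite -powR_mulrn ?powR_ge0 // -powRrM mulVf ?powRr1 //.
by rewrite pnatr_eq0 -lt0n.
Qed.

(** The same rescaling of [x] is performed in the source and in the target. This is possible because
    the factor depends only on [x] and [y ^ 2], the first two target coordinates. *)
Lemma prenormal_normal_form k sigma (B : 'rV[R]_2 -> R) : (0 < k)%N ->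
  smooth_at 0 B ->
  (forall j, (j < k)%N -> derive1n j (fun x : R => B (row2 x 0)) 0 = 0) ->
  derive1n k (fun x : R => B (row2 x 0)) 0 != 0 ->
  'd B 0 (delta_mx 0 1) != 0 ->
  (~~ odd k -> Num.sg (derive1n k (fun x : R => B (row2 x 0)) 0 * 'd B 0 (delta_mx 0 1)) =
    signR sigma) ->
  exists T s, [/\ diffeo_germ T, diffeo_germ s &
    \forall p \near (0 : 'rV[R]_2), T (prenormal B p) = cuspidal_S k.-1 sigma (s p)].
Proof.
move=> k0 sB b0 bk w0 sgn.
have sB0 := smooth_on_axis sB.
have [b1 [sb1 b1E bkE]] := Taylor_order sB0 b0.
have [B1 sB1 BE] := Hadamard sB.
have B10 := Hadamard_d (rowvec0 1) sB sB1 BE.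
rewrite B10 in w0 sgn; rewrite bkE in bk sgn; move: (derive1n _ _ _) bkE => _ _.
have b10 : b1 0 != 0 by apply: contra_neq bk => ->; rewrite mulr0.
pose sg0 := Num.sg (b1 0 / B1 0); pose sig : R := signR sigma.
have sgM : sg0 * (b1 0 / B1 0) = `|b1 0 / B1 0| by rewrite normrEsg.
have sg00 : sg0 * sg0 = 1.
  by rewrite -expr2 sqr_sg mulf_neq0 ?invr_eq0.
(* For odd [k] a sign equals its own k-th power, so a reflection of [x] realizes either sign. For
   even [k] no reflection is made, and the hypothesis says that [sg0] already is the required
   sign. *)
have [tau [tau2 tauk]] : exists tau : R, tau != 0 /\ tau ^+ k * sg0 = sig.
  have [ok|ek] := boolP (odd k).
    exists (sg0 * sig); split.
      by rewrite mulf_neq0 ?signR_neq0 // sgr_eq0 mulf_neq0 ?invr_eq0.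
    rewrite -[k]odd_double_half ok exprD expr1 -mul2n exprM expr2.
    rewrite mulrACA sg00 mul1r sqr_signR expr1n mulr1.
    by rewrite mulrAC sg00 mul1r.
  exists 1; split; first exact: oner_neq0.
  rewrite expr1n mul1r -[sig](sgn ek) /sg0 !sgrM sgrV.
  by rewrite (_ : Num.sg k`!%:R = 1) ?mul1r // gtr0_sg // ltr0n fact_gt0.
have sb1c : smooth_at 0 (fun p : 'rV[R]_2 => b1 (p 0 0)).
  by apply: smooth_at_compR; [exact: smooth_at_coord|rewrite mxE].
(* The factor [sg0] makes [rho] positive near 0, so that its k-th root is smooth. *)
pose rho (p : 'rV[R]_2) := sg0 * (b1 (p 0 0) / B1 p).
have srho : smooth_at 0 rho.
  apply: smooth_atM; first exact: smooth_at_cst.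
  by apply: smooth_atM => //; exact: smooth_atV.
have rho0 : 0 < rho 0 by rewrite /rho mxE sgM normr_gt0 mulf_neq0 ?invr_eq0.
pose M (p : 'rV[R]_2) := tau * powR (rho p) k%:R^-1.
have sM : smooth_at 0 M.
  by apply: smooth_atM; [exact: smooth_at_cst|exact: smooth_at_powR].
have M0 : M 0 != 0 by rewrite /M mulf_neq0 // gt_eqF // powR_gt0.
pose L (p : 'rV[R]_2) := sig / B1 p.
have sL : smooth_at 0 L by apply: smooth_atM; [exact: smooth_at_cst|exact: smooth_atV].
have L0 : L 0 != 0.
  by rewrite /L mulf_neq0 ?invr_eq0 ?signR_neq0.
(* [T] multiplies the last coordinate by [sig / B1]: this turns [y ^ 2 * B1] into [sig * y ^ 2], and
   the coefficient of [x ^ k] into the k-th power of [M]. *)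
pose T (P : 'rV[R]_3) := row3 (P 0 0 * M (row2 (P 0 0) (P 0 1))) (P 0 1)
  (P 0 2 * L (row2 (P 0 0) (P 0 1))).
pose s (p : 'rV[R]_2) := row2 (p 0 0 * M (row2 (p 0 0) (p 0 1 ^+ 2))) (p 0 1).
have coord3 i := smooth_at_coord i (0 : 'rV[R]_3).
have coord2 i := smooth_at_coord i (0 : 'rV[R]_2).
have s3 : smooth_at 0 (fun P : 'rV[R]_3 => row2 (P 0 0) (P 0 1)) by exact: smooth_at_row2.
have z3 : row2 ((0 : 'rV[R]_3) 0 0) ((0 : 'rV[R]_3) 0 1) = 0 by rewrite !mxE row20.
have z2 := fold0 : row2 ((0 : 'rV[R]_2) 0 0) ((0 : 'rV[R]_2) 0 1 ^+ 2) = 0.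
have sM3 : smooth_at 0 (fun P : 'rV[R]_3 => M (row2 (P 0 0) (P 0 1))).
  by apply: smooth_at_comp_scalar => //; rewrite z3.
have sL3 : smooth_at 0 (fun P : 'rV[R]_3 => L (row2 (P 0 0) (P 0 1))).
  by apply: smooth_at_comp_scalar => //; rewrite z3.
have sM2 : smooth_at 0 (fun p : 'rV[R]_2 => M (row2 (p 0 0) (p 0 1 ^+ 2))).
  by apply: (smooth_at_comp_scalar (fold_smooth 0)); rewrite z2.
exists T, s; split.
- apply: inverse_function.
  + by apply: smooth_at_row3 => //; exact: smooth_atM.
  + by rewrite /T !mxE !mul0r row30.
  + move=> v; have -> : 'd T 0 v = row3 (M 0 * v 0 0) (v 0 1) (L 0 * v 0 2).
      apply: etrans (d_row3 v (smooth_atM (coord3 0) sM3) (coord3 1) (smooth_atM (coord3 2) sL3)) _.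
      have c0 i : (0 : 'rV[R]_3) 0 i = 0 by rewrite mxE.
      have E1 := etrans (d_mul0 v (coord3 0) sM3 (c0 0)) (f_equal2 (fun a b => M a * b) z3 (d_coord 0 0 v)).
      have E2 := etrans (d_mul0 v (coord3 2) sL3 (c0 2)) (f_equal2 (fun a b => L a * b) z3 (d_coord 2 0 v)).
      by apply: etrans (f_equal2 (fun a b => row3 a _ b) E1 E2) _; congr row3; exact: d_coord.
    move=> E; apply/rowP; apply: ord3P; rewrite [RHS]mxE.
    * have /eqP := congr1 (fun w : 'rV[R]_3 => w 0 0) E.
      by rewrite rcE mxE mulf_eq0 (negbTE M0) => /eqP.
    * by have := congr1 (fun w : 'rV[R]_3 => w 0 1) E; rewrite rcE mxE.
    * have /eqP := congr1 (fun w : 'rV[R]_3 => w 0 2) E.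
      by rewrite rcE mxE mulf_eq0 (negbTE L0) => /eqP.
- apply: inverse_function.
  + by apply: smooth_at_row2 => //; exact: smooth_atM.
  + by rewrite /s !mxE !mul0r row20.
  + move=> v; have -> : 'd s 0 v = row2 (M 0 * v 0 0) (v 0 1).
      apply: etrans (d_row2 v (smooth_atM (coord2 0) sM2) (coord2 1)) _.
      have c0 i : (0 : 'rV[R]_2) 0 i = 0 by rewrite mxE.
      have E1 := etrans (d_mul0 v (coord2 0) sM2 (c0 0)) (f_equal2 (fun a b => M a * b) z2 (d_coord 0 0 v)).
      by apply: etrans (congr1 (fun a => row2 a _) E1) _; congr row2; exact: d_coord.
    move=> E; apply/rowP; apply: ord2P; rewrite [RHS]mxE.
    * have /eqP := congr1 (fun w : 'rV[R]_2 => w 0 0) E.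
      by rewrite rcE mxE mulf_eq0 (negbTE M0) => /eqP.
    * by have := congr1 (fun w : 'rV[R]_2 => w 0 1) E; rewrite rcE mxE.
have fold_near (P : set 'rV[R]_2) : (\forall p \near (0 : 'rV[R]_2), P p) ->
    \forall p \near (0 : 'rV[R]_2), P ((fun p : 'rV[R]_2 => row2 (p 0 0) (p 0 1 ^+ 2)) p).
  exact: (smooth_at_near_val (fold_smooth 0) z2).
have N1 := fold_near _ BE.
have N2 := smooth_at_near_val (coord2 0) (mxE _ _ _ _ : (0 : 'rV[R]_2) 0 0 = 0) b1E.
have N3 := fold_near _ (smooth_at_near_val srho erefl (lt_nbhsr rho0)).
have N4 := fold_near _ (smooth_at_near_neq0 sB1 w0).
near=> p.
have E1 : B (row2 (p 0 0) (p 0 1 ^+ 2)) = B (row2 (p 0 0) 0) + p 0 1 ^+ 2 * B1 (row2 (p 0 0) (p 0 1 ^+ 2)).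
  have : B (row2 (p 0 0) (p 0 1 ^+ 2)) = B (row2 (row2 (p 0 0) (p 0 1 ^+ 2) 0 0) 0) +
    row2 (p 0 0) (p 0 1 ^+ 2) 0 1 * B1 (row2 (p 0 0) (p 0 1 ^+ 2)) by near: p.
  by rewrite !rcE.
have E2 : B (row2 (p 0 0) 0) = p 0 0 ^+ k * b1 (p 0 0) by near: p.
have r0 : 0 < rho (row2 (p 0 0) (p 0 1 ^+ 2)) by near: p.
have B1p : B1 (row2 (p 0 0) (p 0 1 ^+ 2)) != 0 by near: p.
rewrite cuspidal_SE // /T /prenormal /even_lift /s !rcE E1 E2 exprMn /M exprMn powR_root ?(ltW r0) //.
rewrite /L /rho rcE -[signR sigma]/sig; congr row3.
have alg (b B' x y : R) : B' != 0 -> y ^+ 3 * (x ^+ k * b + y ^+ 2 * B') * (sig / B') =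
  y ^+ 3 * (x ^+ k * (tau ^+ k * (sg0 * (b / B'))) + sig * y ^+ 2).
  have -> : tau ^+ k * (sg0 * (b / B')) = sig * (b / B') by rewrite -tauk !mulrA.
  by move=> B'0; field.
exact: alg.
Unshelve. all: by end_near. Qed.

End NormalForm.

(** * Reduction of frontals to prenormal form *)

Section Coordinates.
Context {R : realType}.

(** The first Hadamard quotient equals the partial derivative in [y] on the axis, hence vanishes
    there, and a second division is possible. *)
Lemma Hadamard2 (g : 'rV[R]_2 -> R) : smooth_at 0 g ->
  (\forall x \near (0 : R), 'd g (row2 x 0) (delta_mx 0 1) = 0) ->
  exists2 k, smooth_at 0 k &
    \forall p \near (0 : 'rV[R]_2), g p = g (row2 (p 0 0) 0) + p 0 1 ^+ 2 * k p.
Proof.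
move=> sg flat; have [g1 sg1 gE] := Hadamard sg; have [k sk kE] := Hadamard sg1.
exists k => //.
have sr := smooth_axis (0 : R).
have A1 := smooth_at_near_val sr row20 (smooth_at_near sg).
have A2 := smooth_at_near_val sr row20 (smooth_at_near sg1).
have A3 := smooth_at_near_val sr row20 (near_join gE).
have g10 : \forall x \near (0 : R), g1 (row2 x 0) = 0.
  near=> x.
  have -> : g1 (row2 x 0) = 'd g (row2 x 0) (delta_mx 0 1).
    apply: esym; apply: Hadamard_d; first exact: row2_1.
    - by near: x.
    - by near: x.
    - by near: x.
  by near: x.
have N := smooth_at_near_val (smooth_at_coord 0 (0 : 'rV[R]_2)) (rowvec0 0) g10.
near=> p.
have E1 : g p = g (row2 (p 0 0) 0) + p 0 1 * g1 p by near: p.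
have E2 : g1 p = g1 (row2 (p 0 0) 0) + p 0 1 * k p by near: p.
have E3 : g1 (row2 (p 0 0) 0) = 0 by near: p.
by rewrite E1 E2 E3 add0r mulrA expr2.
Unshelve. all: by end_near. Qed.

Lemma d_Hadamard2 (g k : 'rV[R]_2 -> R) : smooth_at 0 g -> smooth_at 0 k ->
  (\forall p \near (0 : 'rV[R]_2), g p = g (row2 (p 0 0) 0) + p 0 1 ^+ 2 * k p) ->
  \forall p \near (0 : 'rV[R]_2), 'd g p (delta_mx 0 1) =
    p 0 1 * (2 * k p + p 0 1 * 'd k p (delta_mx 0 1)).
Proof.
move=> sg sk gE; have sr : smooth_at 0 (fun p : 'rV[R]_2 => row2 (p 0 0) 0).
  by apply: smooth_at_row2; [exact: smooth_at_coord|exact: smooth_at_cst].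
have r0 : row2 ((0 : 'rV[R]_2) 0 0) 0 = 0 by rewrite rowvec0 row20.
have A1 := near_join gE; have A2 := smooth_at_near sg; have A3 := smooth_at_near sk.
have A4 := smooth_at_near_val sr r0 (smooth_at_near sg).
have A5 := smooth_at_near sr.
near=> p; set v := delta_mx 0 1.
have E : \forall z \near p, g z = g (row2 (z 0 0) 0) + z 0 1 ^+ 2 * k z by near: p.
have sgp : smooth_at p g by near: p.
have skp : smooth_at p k by near: p.
have sgr : smooth_at (row2 (p 0 0) 0) g by near: p.
have srp : smooth_at p (fun p : 'rV[R]_2 => row2 (p 0 0) 0) by near: p.
have s1 := smooth_at_coord 1 p.
have sA := smooth_at_comp_scalar srp sgr; have sM := smooth_atM (smooth_atX 2 s1) skp.
apply: etrans (d_near v E (smooth_at_diff sgp)) _.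
apply: etrans (d_add v (smooth_at_diff sA) (smooth_at_diff sM)) _.
have E1 : 'd (fun p : 'rV[R]_2 => g (row2 (p 0 0) 0)) p v = 0.
  apply: etrans (d_comp v (smooth_at_diff srp) (smooth_at_diff sgr)) _.
  have -> : 'd (fun p : 'rV[R]_2 => row2 (p 0 0) 0) p v = 0.
    apply: etrans (d_row2 v (smooth_at_coord 0 p) (smooth_at_cst p 0)) _.
    apply: etrans (f_equal2 row2 (d_coord 0 p v) (d_cst (0 : R) p v)) _.
    by rewrite /v delta2_1 rcE row20.
  exact: linear0.
have E2 := d_mul v (smooth_at_diff (smooth_atX 2 s1)) (smooth_at_diff skp).
have v1 : v 0 1 = 1 by rewrite /v delta2_1 rcE.
have E3 := etrans (d_sqr v s1) (congr1 (fun a => 2 * p 0 1 * a) (etrans (d_coord 1 p v) v1)).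
have E4 := etrans E2 (congr1 (fun z => p 0 1 ^+ 2 * _ + k p * z) E3).
apply: etrans (f_equal2 (fun a b => a + b) E1 E4) _.
have alg (y b c : R) : 0 + (y ^+ 2 * c + b * (2 * y * 1)) = y * (2 * b + y * c) by ring.
exact: alg.
Unshelve. all: by end_near. Qed.

(** The change of coordinates [(X, y)] preserves the axis. As [X] has no first-order variation
    across it, the change also fixes the transverse unit vector there, so flatness is preserved. *)
Lemma flat_pullback (X g : 'rV[R]_2 -> R) (e : 'rV[R]_2 -> 'rV[R]_2) :
  smooth_at 0 X -> smooth_at 0 e -> e 0 = 0 -> smooth_at 0 g -> X 0 = 0 ->
  (\forall p \near (0 : 'rV[R]_2), e (row2 (X p) (p 0 1)) = p) ->
  (\forall p \near (0 : 'rV[R]_2), row2 (X (e p)) (e p 0 1) = p) ->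
  (\forall u \near (0 : R), 'd X (row2 u 0) (delta_mx 0 1) = 0) ->
  (\forall u \near (0 : R), 'd g (row2 u 0) (delta_mx 0 1) = 0) ->
  \forall x \near (0 : R), 'd (fun p => g (e p)) (row2 x 0) (delta_mx 0 1) = 0.
Proof.
move=> sX se e0 sg X0 eK Ke flatX flatg.
have sr := smooth_axis (0 : R).
have ser : smooth_at (row2 0 0) e by rewrite row20.
have ser0 : e (row2 0 0) = 0 by rewrite row20.
have sz := smooth_at_comp sr ser.
have along (P : set 'rV[R]_2) : (\forall p \near (0 : 'rV[R]_2), P p) ->
  \forall x \near (0 : R), P (e (row2 x 0)) by exact: (smooth_at_near_val sz ser0).
have su : smooth_at 0 (fun x : R => e (row2 x 0) 0 0) by have /smooth_at_rowP := sz; apply.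
have u0 : e (row2 0 0) 0 0 = 0 by rewrite ser0 rowvec0.
pose flat (h : 'rV[R]_2 -> R) : set R := fun u => 'd h (row2 u 0) (delta_mx 0 1) = 0.
have A1 : \forall x \near (0 : R), flat X (e (row2 x 0) 0 0) := smooth_at_near_val su u0 flatX.
have A2 : \forall x \near (0 : R), flat g (e (row2 x 0) 0 0) := smooth_at_near_val su u0 flatg.
have A12 : \forall x \near (0 : R), flat X (e (row2 x 0) 0 0) /\ flat g (e (row2 x 0) 0 0).
  by apply: filterS2 A1 A2 => x ? ?; split.
have A3 := along _ (near_join eK).
have A4 := along _ (smooth_at_near sX).
have A5 := along _ (smooth_at_near sg).
have A6 := smooth_at_near_val sr row20 (smooth_at_near se).
have A7 := smooth_at_near_val sr row20 Ke.
near=> x.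
have E7 : row2 (X (e (row2 x 0))) (e (row2 x 0) 0 1) = row2 x 0 by near: x.
have z1 : e (row2 x 0) 0 1 = 0.
  by have := congr1 (fun v : 'rV[R]_2 => v 0 1) E7; rewrite !rcE.
have zE : e (row2 x 0) = row2 (e (row2 x 0) 0 0) 0 by rewrite -[LHS]row2K z1.
have sXz : smooth_at (e (row2 x 0)) X by near: x.
have sgz : smooth_at (e (row2 x 0)) g by near: x.
have sex : smooth_at (row2 x 0) e by near: x.
have [fX fg] : flat X (e (row2 x 0) 0 0) /\ flat g (e (row2 x 0) 0 0) by near: x; exact: A12.
have eKz : \forall p \near e (row2 x 0), e (row2 (X p) (p 0 1)) = p by near: x.
rewrite /flat -zE in fX fg; set z := e (row2 x 0) in E7 z1 sXz sgz fX fg eKz.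
have sc := smooth_at_coord 1 z; have sF := smooth_at_row2 sXz sc.
have dF : 'd (fun p => row2 (X p) (p 0 1)) z (delta_mx 0 1) = delta_mx 0 1.
  apply: etrans (d_row2 _ sXz sc) _.
  apply: etrans (f_equal2 row2 fX (d_coord 1 z _)) _.
  by rewrite delta2_1 rcE.
have sexF : smooth_at (row2 (X z) (z 0 1)) e by rewrite E7.
have de : 'd e (row2 x 0) (delta_mx 0 1) = delta_mx 0 1.
  have E1 := d_near (delta_mx 0 1) eKz (smooth_at_diff (smooth_at_comp sF sexF)).
  have E2 := etrans (esym (d_comp (delta_mx 0 1) (smooth_at_diff sF) (smooth_at_diff sexF))) E1.
  apply: etrans _ (etrans E2 (d_id _ _)).
  exact: (esym (f_equal2 (fun p v : 'rV[R]_2 => 'd e p v) E7 dF)).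
apply: etrans (d_comp _ (smooth_at_diff sex) (smooth_at_diff sgz)) _.
by apply: etrans (congr1 _ de) fg.
Unshelve. all: by end_near. Qed.

(** The odd part is [y * E]. Its oddness gives [y * (E - E \o m) = 0], and cancelling [y] shows that
    [E] is even; Whitney's theorem then applies to the even part and to [E]. *)
Lemma parity_split (C : 'rV[R]_2 -> R) : smooth_at 0 C ->
  exists h B, [/\ smooth_at 0 h, smooth_at 0 B &
    \forall p \near (0 : 'rV[R]_2), C p =
      h (row2 (p 0 0) (p 0 1 ^+ 2)) + p 0 1 * B (row2 (p 0 0) (p 0 1 ^+ 2))].
Proof.
move=> sC; pose m (p : 'rV[R]_2) := row2 (p 0 0) (- p 0 1).
have sm : smooth_at 0 m.
  by apply: smooth_at_row2; [exact: smooth_at_coord|apply: smooth_atN; exact: smooth_at_coord].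
have m0 : m 0 = 0 by rewrite /m !rowvec0 oppr0 row20.
have mK p : m (m p) = p by rewrite /m !rcE opprK row2K.
have flip (P : set 'rV[R]_2) : (\forall p \near (0 : 'rV[R]_2), P p) ->
  \forall p \near (0 : 'rV[R]_2), P (m p) by exact: (smooth_at_near_val sm m0).
have sCm0 : smooth_at (m 0) C by rewrite m0.
have sCm := smooth_at_comp_scalar sm sCm0.
pose Ce p := 2^-1 * (C p + C (m p)); pose Co p := 2^-1 * (C p - C (m p)).
have sCe : smooth_at 0 Ce by apply: smooth_atM; [exact: smooth_at_cst|exact: smooth_atD].
have sCo : smooth_at 0 Co by apply: smooth_atM; [exact: smooth_at_cst|exact: smooth_atB].
have [h sh hE] : exists2 h, smooth_at 0 h &
    \forall p \near (0 : 'rV[R]_2), Ce p = h (row2 (p 0 0) (p 0 1 ^+ 2)).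
  apply: Whitney_even => //; apply: filterS (smooth_at_near sC) => p _.
  by rewrite -/(m p) /Ce mK addrC.
have [E sE CoE] := Hadamard sCo.
have Co0 x : Co (row2 x 0) = 0 by rewrite /Co /m !rcE oppr0 subrr mulr0.
have evE : \forall p \near (0 : 'rV[R]_2), E p = E (m p).
  have sEm0 : smooth_at (m 0) E by rewrite m0.
  have sEm := smooth_at_comp_scalar sm sEm0.
  have : \forall p \near (0 : 'rV[R]_2), E p - E (m p) = 0.
    apply: (near_mul_eq0 (smooth_at_coord 1 0) (smooth_atB sE sEm)).
      apply: filterS CoE => p _; exists (delta_mx 0 1).
      by rewrite (d_coord 1 p (delta_mx 0 1)) delta2_1 rcE oner_eq0.
    have CoEm := flip _ CoE.
    near=> p.
    have E1 : Co p = Co (row2 (p 0 0) 0) + p 0 1 * E p by near: p.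
    have E2 : Co (m p) = Co (row2 (m p 0 0) 0) + m p 0 1 * E (m p) by near: p.
    have E3 : Co (m p) = - Co p by rewrite /Co mK; ring.
    move: E2; rewrite E3 E1 !Co0 {2}/m rcE !add0r => E2.
    by rewrite mulrBr -[p 0 1 * E p]opprK E2 mulNr opprK subrr.
  by apply: filterS => p /eqP; rewrite subr_eq0 => /eqP.
have [B sB BE] := Whitney_even sE evE.
exists h, B; split => //; near=> p.
have <- : Ce p = h (row2 (p 0 0) (p 0 1 ^+ 2)) by near: p.
have <- : E p = B (row2 (p 0 0) (p 0 1 ^+ 2)) by near: p.
have E1 : Co p = Co (row2 (p 0 0) 0) + p 0 1 * E p by near: p.
rewrite -[p 0 1 * E p]add0r -(Co0 (p 0 0)) -E1 /Ce /Co.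
by field.
Unshelve. all: by end_near. Qed.

End Coordinates.

(** * Maps stationary across an axis *)

Section Reduction.
Context {R : realType}.

(** The first component serves as new [x]. The second is then [y0(x) + y ^ 2 A] with [A(0) = 1], so
    [y * sqrt A] serves as new [y]. Of the third only the odd part in [y] resists target changes of
    coordinates. *)
Lemma prenormal_of_graph (g k : 'rV[R]_2 -> 'rV[R]_3) :
  smooth_at 0 g -> smooth_at 0 k -> g 0 = 0 ->
  'd g 0 (delta_mx 0 0) = delta_mx 0 0 -> k 0 = delta_mx 0 1 ->
  (\forall u \near (0 : R), 'd g (row2 u 0) (delta_mx 0 1) = 0) ->
  (\forall p \near (0 : 'rV[R]_2), g p = g (row2 (p 0 0) 0) + p 0 1 ^+ 2 *: k p) ->
  exists B Phi phi, [/\ smooth_at 0 B, diffeo_germ Phi, diffeo_germ phi &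
    \forall p \near (0 : 'rV[R]_2), g p = Phi (prenormal B (phi p))].
Proof.
move=> sg sk g0 dg0 k0 flatg gE.
have c2 i := smooth_at_coord i (0 : 'rV[R]_2).
have sgi i : smooth_at 0 (fun p => g p 0 i) by have /smooth_at_rowP := sg; apply.
have ski i : smooth_at 0 (fun p => k p 0 i) by have /smooth_at_rowP := sk; apply.
have gi0 i : g 0 0 i = 0 by rewrite g0 mxE.
have sr := smooth_axis (0 : R).
have flat i : \forall u \near (0 : R), 'd (fun p => g p 0 i) (row2 u 0) (delta_mx 0 1) = 0.
  apply: filterS2 flatg (smooth_at_near_val sr row20 (smooth_at_near sg)) => u E su.
  apply: etrans (esym (d_row _ i (smooth_at_diff su))) _.
  by apply: etrans (congr1 (fun w : 'rV[R]_3 => w 0 i) E) _; rewrite mxE.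
pose X p := g p 0 0.
have dX v : 'd X 0 v = v 0 0.
  have E0 : 'd X 0 (delta_mx 0 0) = 1.
    apply: etrans (esym (d_row _ 0 (smooth_at_diff sg))) _.
    by apply: etrans (congr1 (fun w : 'rV[R]_3 => w 0 0) dg0) _; rewrite mxE.
  have E1 : 'd X 0 (delta_mx 0 1) = 0 by have := nbhs_singleton (flat 0); rewrite row20.
  apply: etrans (d_sum_basis _ _ _) _; apply: etrans (sum2E _) _.
  apply: etrans (f_equal2 (fun a b : R => v 0 0 *: a + v 0 1 *: b) E0 E1) _.
  by rewrite -[_ *: _]/(_ * _) -[_ *: 0]/(_ * _) mulr1 mulr0 addr0.
pose phi1 p := row2 (X p) (p 0 1).
have sphi1 : smooth_at 0 phi1 := smooth_at_row2 (sgi 0) (c2 1).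
have phi10 : phi1 0 = 0 by rewrite /phi1 /X gi0 rowvec0 row20.
have dphi1 : diffeo_germ phi1.
  apply: inverse_function => // v.
  have -> : 'd phi1 0 v = v.
    apply: etrans (d_row2 v (sgi 0) (c2 1)) _.
    by apply: etrans (f_equal2 row2 (dX v) (d_coord 1 0 v)) _; exact: row2K.
  by [].
have [e1 [_ se1 _ e10 [e1K Ke1]]] := dphi1.
have se1' i : smooth_at (e1 0) (fun p => g p 0 i) by rewrite e10.
have s3 i : smooth_at 0 (fun p => g (e1 p) 0 i) := smooth_at_comp_scalar se1 (se1' i).
have flat3 i := flat_pullback (sgi 0) se1 e10 (sgi i) (gi0 0) e1K Ke1 (flat 0) (flat i).
have [A sA AE] := Hadamard2 (s3 1) (flat3 1).
have [C sC CE] := Hadamard2 (s3 2) (flat3 2).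
pose y0 (x : R) := g (e1 (row2 x 0)) 0 1; pose z0 (x : R) := g (e1 (row2 x 0)) 0 2.
have s30 i : smooth_at (row2 0 0) (fun p => g (e1 p) 0 i) by rewrite row20.
have sy0 : smooth_at 0 y0 := smooth_at_comp_scalar sr (s30 1).
have sz0 : smooth_at 0 z0 := smooth_at_comp_scalar sr (s30 2).
have y00 : y0 0 = 0 by rewrite /y0 row20 e10 gi0.
have z00 : z0 0 = 0 by rewrite /z0 row20 e10 gi0.
(* The value is found on the line [x = 0], where [g] has first two components [v ^ 2 * k_0] and
   [v ^ 2 * k_1]. *)
have A0 : A 0 = 1.
  have [y1 sy1 y1E] := Hadamard1 sy0.
  have ss : smooth_at 0 (fun v : R => row2 0 v).
    by apply: smooth_at_row2; [exact: smooth_at_cst|exact: smooth_at_id].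
  have s0 : row2 0 0 = 0 :> 'rV[R]_2 := row20.
  have sX2 : smooth_at (row2 0 0) X by rewrite s0; exact: sgi.
  have sphi2 : smooth_at (row2 0 0) phi1 by rewrite s0.
  have sXs := smooth_at_comp_scalar ss sX2.
  have X20 : X (row2 0 0) = 0 by rewrite s0 /X gi0.
  have sphis := smooth_at_comp ss sphi2.
  have phi20 : phi1 (row2 0 0) = 0 by rewrite s0.
  (* [v ^ 2 * D v] is the difference of two expressions for the second component of [g]. Cancelling
     [v] twice gives [D 0 = 0], which at [k 0 = (0, 1, 0)] reads [A 0 = 1]. *)
  pose D (v : R) := k (row2 0 v) 0 1 - k (row2 0 v) 0 0 * y1 (X (row2 0 v)) - A (phi1 (row2 0 v)).
  have sD : smooth_at 0 D.
    have sk2 i : smooth_at (row2 0 0) (fun p => k p 0 i) by rewrite s0.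
    have sy2 : smooth_at (X (row2 0 0)) y1 by rewrite X20.
    have sA2 : smooth_at (phi1 (row2 0 0)) A by rewrite phi20.
    apply: smooth_atB; last exact: (smooth_at_comp_scalar sphis sA2).
    apply: smooth_atB; first exact: (smooth_at_comp_scalar ss (sk2 1)).
    apply: smooth_atM; first exact: (smooth_at_comp_scalar ss (sk2 0)).
    exact: (smooth_at_compR sXs sy2).
  have N1 := smooth_at_near_val ss s0 gE.
  have N2 := smooth_at_near_val ss s0 e1K.
  have N3 := smooth_at_near_val sphis phi20 AE.
  have N4 := smooth_at_near_val sXs X20 y1E.
  have id_reg : \forall v \near (0 : R), exists w, 'd (fun v : R => v) v w != 0.
    apply: filterS y1E => v _; exists 1.
    by rewrite (d_id v (1 : R)) oner_eq0.
  have vvD : \forall v \near (0 : R), v * (v * D v) = 0.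
    near=> v.
    have E1 : g (row2 0 v) = g (row2 (row2 0 v 0 0) 0) + row2 0 v 0 1 ^+ 2 *: k (row2 0 v).
      by near: v.
    have E2 : e1 (phi1 (row2 0 v)) = row2 0 v by near: v.
    have E3 : g (e1 (phi1 (row2 0 v))) 0 1 = y0 (phi1 (row2 0 v) 0 0) +
        phi1 (row2 0 v) 0 1 ^+ 2 * A (phi1 (row2 0 v)) by near: v.
    have E4 : y0 (X (row2 0 v)) = y0 0 + X (row2 0 v) * y1 (X (row2 0 v)) by near: v.
    have gX : X (row2 0 v) = v ^+ 2 * k (row2 0 v) 0 0.
      by rewrite /X E1 !rcE s0 g0 add0r mxE.
    have gY : g (row2 0 v) 0 1 = v ^+ 2 * k (row2 0 v) 0 1.
      by rewrite E1 !rcE s0 g0 add0r mxE.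
    move: E3; rewrite E2 gY [phi1 _ 0 0]row2_0 [phi1 _ 0 1]row2_1 row2_1 E4 y00 add0r.
    rewrite /D {1}gX; move: (A _) (y1 _) (k _ 0 0) (k _ 0 1) => a b c d E.
    have -> : v * (v * (d - c * b - a)) = v ^+ 2 * d - (v ^+ 2 * c * b + v ^+ 2 * a) by ring.
    by rewrite E subrr.
  have vD : \forall v \near (0 : R), v * D v = 0.
    exact: near_mul_eq0 (smooth_at_id 0) (smooth_atM (smooth_at_id 0) sD) id_reg vvD.
  have := nbhs_singleton (near_mul_eq0 (smooth_at_id 0) sD id_reg vD).
  rewrite /D phi20 s0 k0 !mxE /= mul0r subr0 => /eqP.
  by rewrite subr_eq0 => /eqP.
pose S p := powR (A p) 2^-1.
have sS : smooth_at 0 S by apply: smooth_at_powR => //; rewrite A0 ltr01.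
have S0 : S 0 = 1 by rewrite /S A0 powR1.
have A_gt0 : \forall p \near (0 : 'rV[R]_2), 0 < A p.
  exact: (smooth_at_near_val sA A0 (lt_nbhsr ltr01)).
pose phi2 (p : 'rV[R]_2) := row2 (p 0 0) (p 0 1 * S p).
have phi20 : phi2 0 = 0 by rewrite /phi2 !rowvec0 mul0r row20.
have dphi2 : diffeo_germ phi2.
  apply: inverse_function => //.
    by apply: smooth_at_row2 => //; exact: smooth_atM.
  move=> v; have -> : 'd phi2 0 v = v.
    apply: etrans (d_row2 v (c2 0) (smooth_atM (c2 1) sS)) _.
    apply: etrans (f_equal2 row2 (d_coord 0 0 v) (d_mul0 v (c2 1) sS (rowvec0 1))) _.
    apply: etrans (f_equal2 (fun a b => row2 _ (a * b)) S0 (d_coord 1 0 v)) _.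
    by rewrite mul1r row2K.
  by [].
have [e2 [sphi2 se2 _ e20 [e2K Ke2]]] := dphi2.
have sCe : smooth_at (e2 0) C by rewrite e20.
have sAe : smooth_at (e2 0) A by rewrite e20.
(* [y ^ 2 * C] becomes the square of the new second coordinate times [C / A], written in the new
   coordinates. *)
pose C' p := C (e2 p) / A (e2 p).
have sC' : smooth_at 0 C'.
  apply: smooth_atM; first exact: (smooth_at_comp_scalar se2 sCe).
  by apply: smooth_atV; [exact: (smooth_at_comp_scalar se2 sAe)|rewrite e20 A0 oner_eq0].
have [h [B [sh sB C'E]]] := parity_split sC'.
(* [Psi] restores the axis curve [(x, y0, z0)] and the even part [h]; both depend on the first two
   target coordinates only. *)
pose Psi (P : 'rV[R]_3) := row3 (P 0 0) (y0 (P 0 0) + P 0 1)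
  (z0 (P 0 0) + P 0 1 * h (row2 (P 0 0) (P 0 1)) + P 0 2).
exists B, Psi, (fun p => phi2 (phi1 p)); split => //.
- have c3 i := smooth_at_coord i (0 : 'rV[R]_3).
  have s03 : smooth_at ((0 : 'rV[R]_3) 0 0) y0 by rewrite rowvec0.
  have sz3 : smooth_at ((0 : 'rV[R]_3) 0 0) z0 by rewrite rowvec0.
  have sr3 := smooth_at_row2 (c3 0) (c3 1).
  have r30 : row2 ((0 : 'rV[R]_3) 0 0) ((0 : 'rV[R]_3) 0 1) = 0 by rewrite !rowvec0 row20.
  have sh3 : smooth_at (row2 ((0 : 'rV[R]_3) 0 0) ((0 : 'rV[R]_3) 0 1)) h by rewrite r30.
  have sy3 := smooth_at_compR (c3 0) s03; have szz := smooth_at_compR (c3 0) sz3.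
  have shh := smooth_at_comp_scalar sr3 sh3.
  have sY := smooth_atD sy3 (c3 1).
  have syh := smooth_atM (c3 1) shh.
  have szh := smooth_atD szz syh.
  have sZ := smooth_atD szh (c3 2).
  apply: inverse_function; first exact: smooth_at_row3.
    by rewrite /Psi !rowvec0 y00 z00 mul0r !addr0 row30.
  move=> v E; have {}E := etrans (esym (d_row3 v (c3 0) sY sZ)) E.
  have v0 : v 0 0 = 0.
    have := congr1 (fun w : 'rV[R]_3 => w 0 0) E; rewrite rcE rowvec0.
    exact: etrans (esym (d_coord 0 0 v)).
  have dF (F : R -> R) : smooth_at ((0 : 'rV[R]_3) 0 0) F ->
      'd (fun P : 'rV[R]_3 => F (P 0 0)) 0 v = 0.
    move=> sF; apply: etrans (d_comp v (smooth_at_diff (c3 0)) (smooth_at_diff sF)) _.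
    apply: etrans (congr1 ('d F ((0 : 'rV[R]_3) 0 0)) (etrans (d_coord 0 0 v) v0)) _.
    exact: linear0.
  have v1 : v 0 1 = 0.
    have := congr1 (fun w : 'rV[R]_3 => w 0 1) E; rewrite rcE rowvec0.
    move=> /(etrans (esym (d_add v (smooth_at_diff sy3) (smooth_at_diff (c3 1))))).
    move=> /(etrans (esym (f_equal2 (fun a b => a + b) (dF _ s03) (d_coord 1 0 v)))).
    by rewrite add0r.
  have v2 : v 0 2 = 0.
    have := congr1 (fun w : 'rV[R]_3 => w 0 2) E; rewrite rcE rowvec0.
    move=> /(etrans (esym (d_add v (smooth_at_diff szh) (smooth_at_diff (c3 2))))).
    have dyh := etrans (d_mul0 v (c3 1) shh (rowvec0 1)) (congr1 _ (etrans (d_coord 1 0 v) v1)).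
    have dzh := etrans (d_add v (smooth_at_diff szz) (smooth_at_diff syh))
      (f_equal2 (fun a b => a + b) (dF _ sz3) dyh).
    move=> /(etrans (esym (f_equal2 (fun a b => a + b) dzh (d_coord 2 0 v)))).
    by rewrite mulr0 !add0r.
  by apply/rowP; apply: ord3P; rewrite [RHS]mxE.
- exact: diffeo_germ_comp.
- have M1 := smooth_at_near_val sphi1 phi10 AE.
  have M2 := smooth_at_near_val sphi1 phi10 CE.
  have M3 := smooth_at_near_val sphi1 phi10 A_gt0.
  have M4 := smooth_at_near_val sphi1 phi10 e2K.
  have sphi20 : smooth_at (phi1 0) phi2 by rewrite phi10.
  have phi2_0 : phi2 (phi1 0) = 0 by rewrite phi10.
  have M5 := smooth_at_near_val (smooth_at_comp sphi1 sphi20) phi2_0 C'E.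
  near=> p.
  have F1 : e1 (phi1 p) = p by near: p.
  have F2 : g (e1 (phi1 p)) 0 1 = y0 (phi1 p 0 0) + phi1 p 0 1 ^+ 2 * A (phi1 p) by near: p.
  have F3 : g (e1 (phi1 p)) 0 2 = z0 (phi1 p 0 0) + phi1 p 0 1 ^+ 2 * C (phi1 p) by near: p.
  have F4 : e2 (phi2 (phi1 p)) = phi1 p by near: p.
  have F5 : 0 < A (phi1 p) by near: p.
  have F6 : C' (phi2 (phi1 p)) = h (row2 (phi2 (phi1 p) 0 0) (phi2 (phi1 p) 0 1 ^+ 2)) +
    phi2 (phi1 p) 0 1 * B (row2 (phi2 (phi1 p) 0 0) (phi2 (phi1 p) 0 1 ^+ 2)) by near: p.
  have F7 : S (phi1 p) ^+ 2 = A (phi1 p) by apply: powR_root => //; exact: ltW.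
  have F8 : phi2 (phi1 p) 0 0 = phi1 p 0 0 by rewrite rcE.
  have F9 : phi2 (phi1 p) 0 1 ^+ 2 = phi1 p 0 1 ^+ 2 * A (phi1 p) by rewrite rcE exprMn F7.
  rewrite F1 in F2 F3.
  have q0 : prenormal B (phi2 (phi1 p)) 0 0 = phi1 p 0 0 by rewrite row3_0 F8.
  have q1 : prenormal B (phi2 (phi1 p)) 0 1 = phi1 p 0 1 ^+ 2 * A (phi1 p) by rewrite row3_1 F9.
  have q2 : prenormal B (phi2 (phi1 p)) 0 2 = phi2 (phi1 p) 0 1 ^+ 3 *
      B (row2 (phi1 p 0 0) (phi1 p 0 1 ^+ 2 * A (phi1 p))).
    by rewrite row3_2 /even_lift F8 F9.
  move: q0 q1 q2; move: (prenormal B _) => q q0 q1 q2; rewrite /Psi q0 q1 q2.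
  apply/rowP; apply: ord3P.
  + by rewrite row3_0 row2_0.
  + by rewrite row3_1.
  + rewrite row3_2 F3; move: F6; rewrite /C' F4 F8 F9; move: F9 F5.
    move: (phi2 (phi1 p) 0 1) (phi1 p 0 1) (A _) (C _) (h _) (B _) (z0 _) => t v a c u b z E a0.
    move=> F; rewrite -addrA; congr (_ + _).
    have ca : a * (c / a) = c by rewrite mulrCA divff ?mulr1 // gt_eqF.
    rewrite -[in LHS]ca F mulrA -E.
    have alg (x y w : R) : x ^+ 2 * (y + x * w) = x ^+ 2 * y + x ^+ 3 * w by ring.
    exact: alg.
Unshelve. all: by end_near. Qed.

End Reduction.

(** * Coordinates along the singular curve of a frontal *)

Section FrontalReduction.
Context {R : realType}.

Lemma diffeo_germ_mulmx m (M : 'M[R]_m.+1) : M \in unitmx ->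
  diffeo_germ (fun P : 'rV[R]_m.+1 => P *m M).
Proof.
move=> U; have s := smooth_at_mulmx M (smooth_at_id (0 : 'rV[R]_m.+1)).
apply: inverse_function => [//||v]; first exact: mul0mx.
move=> /(etrans (esym (d_mulmx M v (smooth_at_diff (smooth_at_id (0 : 'rV[R]_m.+1)))))).
move=> /(etrans (congr1 (fun w => w *m M) (esym (d_id 0 v)))) E.
by rewrite -[v](mulmxK U) E mul0mx.
Qed.

Context (f nu : 'rV[R]_2 -> 'rV[R]_3) (gamma eta : R -> 'rV[R]_2).
Context (sf : smooth_at 0 f) (nuf : normal_vector f nu).
Context (nd : nondegenerate_singular f nu) (sd : singular_data f gamma eta).
Context (tr : null_transverse gamma eta).

Let sgamma : smooth_at 0 gamma.
Proof. exact: singular_data_smooth sd. Qed.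
Let gamma0 : gamma 0 = 0. Proof. by case: sd => -[r r0 []]. Qed.
Let seta : smooth_at 0 eta. Proof. by case: sd => _ []. Qed.
Let snu : smooth_at 0 nu. Proof. by case: nuf. Qed.

(** Coordinates straightening the singular curve to the axis and the null field along it to the
    second direction; transversality of the two makes the differential at 0 invertible. *)
Definition tube (p : 'rV[R]_2) : 'rV[R]_2 := gamma (p 0 0) + p 0 1 *: eta (p 0 0).

Let sgc : smooth_at 0 (fun p : 'rV[R]_2 => gamma (p 0 0)).
Proof. by apply: smooth_at_comp_curve; [exact: smooth_at_coord|rewrite rowvec0]. Qed.
Let sec : smooth_at 0 (fun p : 'rV[R]_2 => eta (p 0 0)).
Proof. by apply: smooth_at_comp_curve; [exact: smooth_at_coord|rewrite rowvec0]. Qed.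
Let stube : smooth_at 0 tube.
Proof. by apply: smooth_atD => //; apply: smooth_atZ => //; exact: smooth_at_coord. Qed.
Let tube0 : tube 0 = 0. Proof. by rewrite /tube !rowvec0 scale0r addr0. Qed.
Let tube_axis u : tube (row2 u 0) = gamma u. Proof. by rewrite /tube !rcE scale0r addr0. Qed.

Let d_tube : \forall u \near (0 : R), forall v,
  'd tube (row2 u 0) v = v 0 0 *: derive1 gamma u + v 0 1 *: eta u.
Proof.
near=> u => v.
have sgu : smooth_at u gamma by near: u; exact: (smooth_at_near sgamma).
have seu : smooth_at u eta by near: u; exact: (smooth_at_near seta).
have c i := smooth_at_coord i (row2 u 0 : 'rV[R]_2).
have sgr : smooth_at (row2 u 0 0 0) gamma by rewrite rcE.
have ser : smooth_at (row2 u 0 0 0) eta by rewrite rcE.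
have sg2 := smooth_at_comp_curve (c 0) sgr.
have se2 := smooth_at_comp_curve (c 0) ser.
have sm := smooth_atZ (c 1) se2.
apply: etrans (d_add v (smooth_at_diff sg2) (smooth_at_diff sm)) _.
have E1 : 'd (fun p : 'rV[R]_2 => gamma (p 0 0)) (row2 u 0) v = v 0 0 *: derive1 gamma u.
  apply: etrans (d_comp v (smooth_at_diff (c 0)) (smooth_at_diff sgr)) _.
  apply: etrans (congr1 _ (d_coord 0 _ v)) _.
  apply: etrans (d_derive1 _ (smooth_at_diff sgr)) _.
  by rewrite rcE.
have E2 : 'd (fun p : 'rV[R]_2 => p 0 1 *: eta (p 0 0)) (row2 u 0) v = v 0 1 *: eta u.
  apply/rowP => i; apply: etrans (d_row v i (smooth_at_diff sm)) _.
  have -> : (fun p : 'rV[R]_2 => (p 0 1 *: eta (p 0 0)) 0 i) = (fun p : 'rV[R]_2 => p 0 1 * eta (p 0 0) 0 i).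
    by apply/funext => p; rewrite mxE.
  have sei : smooth_at (row2 u 0) (fun p : 'rV[R]_2 => eta (p 0 0) 0 i).
    by have /smooth_at_rowP := se2; apply.
  apply: etrans (d_mul0 v (c 1) sei (row2_1 u 0)) _.
  apply: etrans (congr1 (fun a => _ * a) (d_coord 1 _ v)) _.
  by rewrite rcE mulrC mxE.
by apply: etrans (f_equal2 (fun a b => a + b) E1 E2) _.
Unshelve. all: by end_near. Qed.

Let d_tube0 v : 'd tube 0 v = v 0 0 *: derive1 gamma 0 + v 0 1 *: eta 0.
Proof. by have := nbhs_singleton d_tube v; rewrite row20. Qed.

Let d_tube0_inj v : 'd tube 0 v = 0 -> v = 0.
Proof.
move=> /(etrans (esym (d_tube0 v))) E.
have /row_full2P D := tr; move: E; move: (derive1 gamma 0) (eta 0) D => a b.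
rewrite det2E => D E.
have E0 := congr1 (fun w : 'rV[R]_2 => w 0 0) E; have E1 := congr1 (fun w : 'rV[R]_2 => w 0 1) E.
rewrite /= !mxE in E0 E1.
apply/rowP; apply: ord2P; rewrite [RHS]mxE; apply: (mulfI D); rewrite mulr0.
  have -> : (a 0 0 * b 0 1 - a 0 1 * b 0 0) * v 0 0 =
    b 0 1 * (v 0 0 * a 0 0 + v 0 1 * b 0 0) - b 0 0 * (v 0 0 * a 0 1 + v 0 1 * b 0 1) by ring.
  by rewrite E0 E1 !mulr0 subrr.
have -> : (a 0 0 * b 0 1 - a 0 1 * b 0 0) * v 0 1 =
  a 0 0 * (v 0 0 * a 0 1 + v 0 1 * b 0 1) - a 0 1 * (v 0 0 * a 0 0 + v 0 1 * b 0 0) by ring.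
by rewrite E0 E1 !mulr0 subrr.
Qed.

Let diffeo_tube : diffeo_germ tube.
Proof. exact: inverse_function. Qed.

Let f1 (p : 'rV[R]_2) : 'rV[R]_3 := f (tube p).
Let sft : smooth_at (tube 0) f. Proof. by rewrite tube0. Qed.
Let sf1 : smooth_at 0 f1. Proof. exact: smooth_at_comp. Qed.

Let sr : smooth_at 0 (fun x : R => row2 x 0).
Proof. exact: smooth_axis. Qed.

Let d_f1 : \forall p \near (0 : 'rV[R]_2), forall v, 'd f1 p v = 'd f (tube p) ('d tube p v).
Proof.
near=> p => v.
have s1 : smooth_at p tube by near: p; exact: (smooth_at_near stube).
have s2 : smooth_at (tube p) f.
  by near: p; exact: (smooth_at_near_val stube tube0 (smooth_at_near sf)).
exact: (d_comp v (smooth_at_diff s1) (smooth_at_diff s2)).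
Unshelve. all: by end_near. Qed.

Let flat_f1 : \forall u \near (0 : R), 'd f1 (row2 u 0) (delta_mx 0 1) = 0.
Proof.
have A1 := smooth_at_near_val sr row20 d_f1; case: sd => _ [_ _ nul].
near=> u.
have E1 : forall v, 'd f1 (row2 u 0) v = 'd f (tube (row2 u 0)) ('d tube (row2 u 0) v) by near: u.
have E2 : forall v, 'd tube (row2 u 0) v = v 0 0 *: derive1 gamma u + v 0 1 *: eta u by near: u.
have N : forall X, 'd f (gamma u) X = 0 <-> exists r, X = r *: eta u by near: u.
apply: etrans (E1 _) _; apply: etrans (congr1 _ (E2 _)) _.
rewrite tube_axis; apply/N; exists 1.
by rewrite delta2_1 !rcE scale0r add0r.
Unshelve. all: by end_near. Qed.

Lemma tube_second_order : exists2 k : 'rV[R]_2 -> 'rV[R]_3, smooth_at 0 k &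
  \forall p \near (0 : 'rV[R]_2), forall i,
    f1 p 0 i = f1 (row2 (p 0 0) 0) 0 i + p 0 1 ^+ 2 * k p 0 i.
Proof.
have sfi i : smooth_at 0 (fun p => f1 p 0 i) by have /smooth_at_rowP := sf1; apply.
have flat i : \forall u \near (0 : R), 'd (fun p => f1 p 0 i) (row2 u 0) (delta_mx 0 1) = 0.
  apply: filterS2 flat_f1 (smooth_at_near_val sr row20 (smooth_at_near sf1)) => u E su.
  apply: etrans (esym (d_row _ i (smooth_at_diff su))) _.
  by apply: etrans (congr1 (fun w : 'rV[R]_3 => w 0 i) E) _; rewrite mxE.
have [k0 sk0 k0E] := Hadamard2 (sfi 0) (flat 0).
have [k1 sk1 k1E] := Hadamard2 (sfi 1) (flat 1).
have [k2 sk2 k2E] := Hadamard2 (sfi 2) (flat 2).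
exists (fun p => row3 (k0 p) (k1 p) (k2 p)); first exact: smooth_at_row3.
by near=> p; apply: ord3P; rewrite rcE; near: p.
Unshelve. all: by end_near. Qed.

Context (k : 'rV[R]_2 -> 'rV[R]_3) (sk : smooth_at 0 k).
Context (kE : \forall p \near (0 : 'rV[R]_2), forall i,
    f1 p 0 i = f1 (row2 (p 0 0) 0) 0 i + p 0 1 ^+ 2 * k p 0 i).

(* In the coordinates [tube] the signed area density is, up to a unit and terms
   of order two, [2 * p 0 1] times this determinant. *)
Let frame_neq0 : det3 ('d f1 0 (delta_mx 0 0)) (k 0) (nu 0) != 0.
Proof.
pose lam := signed_area_density f nu.
have slam : smooth_at 0 lam by apply: smooth_at_det3 => //; exact: smooth_at_d.
have slamt : smooth_at (tube 0) lam by rewrite tube0.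
(* The derivative across the axis is [p 0 1] times [W], by differentiating the second-order
   expansion; at 0 it is twice [k]. *)
pose W p := 2 *: k p + p 0 1 *: 'd k p (delta_mx 0 1).
have sW : smooth_at 0 W.
  apply: smooth_atD; first by apply: smooth_atZ => //; exact: smooth_at_cst.
  by apply: smooth_atZ; [exact: smooth_at_coord|exact: smooth_at_d].
have dW : \forall p \near (0 : 'rV[R]_2), 'd f1 p (delta_mx 0 1) = p 0 1 *: W p.
  have E i : \forall p \near (0 : 'rV[R]_2), ('d f1 p (delta_mx 0 1)) 0 i = p 0 1 * W p 0 i.
    have sfi : smooth_at 0 (fun p => f1 p 0 i) by have /smooth_at_rowP := sf1; apply.
    have ski : smooth_at 0 (fun p => k p 0 i) by have /smooth_at_rowP := sk; apply.
    have kEi : \forall p \near (0 : 'rV[R]_2),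
      f1 p 0 i = f1 (row2 (p 0 0) 0) 0 i + p 0 1 ^+ 2 * k p 0 i by apply: filterS kE => p; apply.
    have D := d_Hadamard2 sfi ski kEi.
    apply: filterS3 D (smooth_at_near sf1) (smooth_at_near sk) => p D s1 s2.
    apply: etrans (d_row _ i (smooth_at_diff s1)) _; apply: etrans D _.
    rewrite /W 3!mxE; congr (_ * (_ + _ * _)).
    exact: (esym (d_row _ i (smooth_at_diff s2))).
  apply: filterS3 (E 0) (E 1) (E 2) => p E0 E1 E2.
  by apply/rowP; apply: ord3P; rewrite [RHS]mxE.
pose c p := det2 ('d tube p (delta_mx 0 0)) ('d tube p (delta_mx 0 1)).
pose D p := det3 ('d f1 p (delta_mx 0 0)) (W p) (nu (tube p)).
have snt : smooth_at (tube 0) nu by rewrite tube0.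
have sD : smooth_at 0 D.
  apply: smooth_at_det3 => //; first exact: smooth_at_d.
  exact: smooth_at_comp stube snt.
have sc : smooth_at 0 c by apply: smooth_at_det2; exact: smooth_at_d.
have slt := smooth_at_comp_scalar stube slamt.
have DE : \forall p \near (0 : 'rV[R]_2), (p : 'rV[R]_2) 0 1 * D p = c p * lam (tube p).
  near=> p.
  have E1 : forall v, 'd f1 p v = 'd f (tube p) ('d tube p v) by near: p; exact: d_f1.
  have E2 : 'd f1 p (delta_mx 0 1) = p 0 1 *: W p by near: p.
  have dfE v : 'd f (tube p) v = v 0 0 *: 'd f (tube p) (delta_mx 0 0) +
    v 0 1 *: 'd f (tube p) (delta_mx 0 1) := etrans (d_sum_basis _ _ _) (sum2E _).
  have -> : p 0 1 * D p = det3 ('d f1 p (delta_mx 0 0)) (p 0 1 *: W p) (nu (tube p)).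
    rewrite /D; move: ('d f1 p _) (p 0 1) (W p) (nu _) => u y w n.
    by rewrite !det3E !mxE; ring.
  have G0 := etrans (E1 (delta_mx 0 0)) (dfE ('d tube p (delta_mx 0 0))).
  have G1 := etrans (esym E2) (etrans (E1 (delta_mx 0 1)) (dfE ('d tube p (delta_mx 0 1)))).
  apply: etrans (f_equal2 (fun a b : 'rV[R]_3 => det3 a b (nu (tube p))) G0 G1) _.
  apply: etrans (det3_combine _ _ _ _ _ _ _) _; congr (_ * _).
  exact: esym (det2E _ _).
have c0 : c 0 != 0.
  rewrite /c det2_d mulf_neq0 ?det_jacobian //.
  by rewrite delta2_0 delta2_1 det2E !rcE mulr1 mul0r subr0 oner_eq0.
have lam0 : lam (tube 0) = 0.
  have /eqP := nbhs_singleton DE; rewrite rowvec0 mul0r eq_sym mulf_eq0 (negbTE c0).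
  by move/eqP.
(* Choosing [v] over a direction [X] in which the density varies and differentiating
   [y * D = c * lam] at 0 gives [D 0 * v 0 1 = c 0 * 'd lam 0 X], which is nonzero. *)
have [X X0] := nd.2; have [v vX] := d_surjective X d_tube0_inj.
have s1 := smooth_at_coord 1 (0 : 'rV[R]_2).
have E1 := d_near v DE (smooth_at_diff (smooth_atM s1 sD)).
have E2 := etrans (esym (d_mul0 v s1 sD (rowvec0 1))) E1.
have E3 := etrans E2 (d_mul v (smooth_at_diff sc) (smooth_at_diff slt)).
have E4 := d_comp v (smooth_at_diff stube) (smooth_at_diff slamt).
have {}E4 : 'd (fun p => lam (tube p)) 0 v = 'd lam 0 X.
  by apply: etrans E4 _; rewrite vX tube0.
have E5 := etrans E3 (f_equal2 (fun a b => c 0 * a + b * 'd c 0 v) E4 lam0).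
rewrite mul0r addr0 in E5.
apply: contra_neq X0 => F.
have D0 : D 0 = 0.
  rewrite /D tube0 /W rowvec0 scale0r addr0.
  have alg (u w n : 'rV[R]_3) : det3 u (2 *: w) n = 2 * det3 u w n.
    by rewrite !det3E !mxE; ring.
  by rewrite alg F mulr0.
apply: (mulfI c0); rewrite mulr0; apply: etrans (esym E5) _.
by rewrite D0 mul0r.
Unshelve. all: by end_near. Qed.

(** A linear change of the target sends the velocity of the singular curve and the second-order
    coefficient [k 0] to the first two basis vectors; [nu 0] completes the frame. *)
Lemma prenormal_of_tube : f 0 = 0 ->
  exists B Phi phi, [/\ smooth_at 0 B, diffeo_germ Phi, diffeo_germ phi &
    \forall p \near (0 : 'rV[R]_2), f p = Phi (prenormal B (phi p))].
Proof.
move=> f0; pose M : 'M[R]_3 := \matrix_(i < 3) [:: 'd f1 0 (delta_mx 0 0); k 0; nu 0]`_i.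
have U : M \in unitmx by rewrite unitmxE unitfE; exact: frame_neq0.
have rM i : delta_mx 0 i *m M = ([:: 'd f1 0 (delta_mx 0 0); k 0; nu 0]`_i : 'rV[R]_3).
  by rewrite -rowE rowK.
have d1 : 'd f1 0 (delta_mx 0 0) *m invmx M = delta_mx 0 0.
  by rewrite -[RHS](mulmxK U) (rM 0).
have d2 : k 0 *m invmx M = delta_mx 0 1 by rewrite -[RHS](mulmxK U) (rM 1).
have dM p v : smooth_at p f1 -> 'd (fun p => f1 p *m invmx M) p v = 'd f1 p v *m invmx M.
  by move=> s; exact: (d_mulmx (invmx M) v (smooth_at_diff s)).
have [B [Phi [phi [sB dPhi dphi E]]]] : exists B Phi phi,
    [/\ smooth_at 0 B, diffeo_germ Phi, diffeo_germ phi &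
    \forall p \near (0 : 'rV[R]_2), f1 p *m invmx M = Phi (prenormal B (phi p))].
  apply: (@prenormal_of_graph _ _ (fun p => k p *m invmx M)).
  - exact: smooth_at_mulmx.
  - exact: smooth_at_mulmx.
  - by rewrite /f1 tube0 f0 mul0mx.
  - exact: etrans (dM 0 _ sf1) d1.
  - exact: d2.
  - apply: filterS2 flat_f1 (smooth_at_near_val sr row20 (smooth_at_near sf1)) => u F su.
    apply: etrans (dM (row2 u 0) _ su) _.
    by apply: etrans (congr1 (fun w => w *m invmx M) F) _; exact: mul0mx.
  - apply: filterS kE => p F; rewrite scalemxAl -mulmxDl; congr (_ *m _).
    by apply/rowP => i; rewrite F 2!mxE.
have [e [_ se _ e0 [eK Ke]]] := diffeo_tube.
exists B, (fun P => Phi P *m M), (fun p => phi (e p)); split => //.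
- exact: (diffeo_germ_comp dPhi (diffeo_germ_mulmx U)).
- by apply: diffeo_germ_comp => //; exists tube; split.
have N := smooth_at_near_val se e0 E.
near=> p.
have -> : Phi (prenormal B (phi (e p))) = f1 (e p) *m invmx M by apply: esym; near: p.
rewrite mulmxKV // /f1; congr f; apply: esym; near: p; exact: Ke.
Unshelve. all: by end_near. Qed.

End FrontalReduction.

Theorem prenormal_of_frontal (R : realType) (f nu : 'rV[R]_2 -> 'rV[R]_3)
    (gamma eta : R -> 'rV[R]_2) : smooth_at 0 f -> f 0 = 0 -> normal_vector f nu ->
  nondegenerate_singular f nu -> singular_data f gamma eta ->
  null_transverse gamma eta ->
  exists B Phi phi, [/\ smooth_at 0 B, diffeo_germ Phi, diffeo_germ phi &
    \forall p \near (0 : 'rV[R]_2), f p = Phi (prenormal B (phi p))].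
Proof.
move=> sf f0 nuf nd sd tr.
have [k sk kE] := tube_second_order sf sd.
have H := prenormal_of_tube sf nuf nd sd tr sk kE f0.
exact: H.
Qed.

(** * The characterization *)

Section Orientation.
Context {R : realType}.

(** [J] cancels, [e] occurs to the power 8 and [g'] to the power [k + 2], which is even. *)
Lemma sign_identity (r e g' w J K b : R) k : 0 < r -> 0 < K -> J != 0 -> g' != 0 ->
  e != 0 -> ~~ odd k ->
  Num.sg (720 * (r * e) ^+ 7 * g' * w * J * (g' * e * K / J * g' ^+ k * b)) =
  Num.sg (b * w).
Proof.
move=> r0 K0 J0 g'0 e0 ek.
have -> : 720 * (r * e) ^+ 7 * g' * w * J * (g' * e * K / J * g' ^+ k * b) =
  (720 * r ^+ 7 * K * (e ^+ 2) ^+ 4 * g' ^+ 2 * (g' ^+ k./2) ^+ 2) * (b * w).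
  rewrite -{1}[k]odd_double_half (negbTE ek) add0n -muln2 exprM.
  by field.
have sq (x : R) : x != 0 -> 0 < x ^+ 2 by move=> x0; rewrite exprn_even_gt0.
rewrite sgrM gtr0_sg; first by rewrite mul1r.
apply: mulr_gt0; last by apply: sq; exact: expf_neq0.
apply: mulr_gt0; last exact: sq.
apply: mulr_gt0; last by apply: exprn_gt0; exact: sq.
apply: mulr_gt0; last exact: K0.
by apply: mulr_gt0; [exact: ltr0n|exact: exprn_gt0].
Qed.

Lemma prenormal_sign (B : 'rV[R]_2 -> R) (Phi : 'rV[R]_3 -> 'rV[R]_3)
    (phi : 'rV[R]_2 -> 'rV[R]_2) (f nu : 'rV[R]_2 -> 'rV[R]_3)
    (gamma eta c : R -> 'rV[R]_2) (l r : R) k :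
  smooth_at 0 B -> diffeo_germ Phi -> diffeo_germ phi ->
  (\forall p \near (0 : 'rV[R]_2), f p = Phi (prenormal B (phi p))) ->
  normal_vector f nu -> singular_data f gamma eta ->
  smooth_at 0 c -> c 0 = 0 -> 0 < r -> derive1 c 0 = r *: eta 0 ->
  derive1n 3 (f \o c) 0 = l *: derive1n 2 (f \o c) 0 ->
  B 0 = 0 -> 'd B 0 (delta_mx 0 0) = 0 ->
  (forall j, (j < k)%N -> derive1n j (fun x : R => B (row2 x 0)) 0 = 0) -> ~~ odd k ->
  Num.sg (det_a f gamma c l * derive1n k (psi f nu gamma eta) 0) =
  Num.sg (derive1n k (fun x : R => B (row2 x 0)) 0 * 'd B 0 (delta_mx 0 1)).
Proof.
move=> sB dPhi dphi fE nuf sd sc c0 r0 dc d3 B0 B1 b0 ek.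
have [[_ _ g'0 e0] _] := prenormal_coordinates sB dPhi dphi fE sd.
have dA := prenormal_det_a sB dPhi dphi fE sd sc c0 dc d3 B0 B1.
have [K K0 [_ dP]] := prenormal_derive_psi sB dPhi dphi fE nuf sd b0.
have J0 : \det ('J Phi 0) != 0.
  by apply: det_jacobian; exact: (nbhs_singleton (diffeo_germ_d_inj dPhi)).
have E2 := f_equal2 (fun a b : R => Num.sg (a * b)) dA dP.
apply: etrans E2 _.
move: g'0 e0; set g' := derive1 _ 0; rewrite -/g'; cbv beta.
set e := ('d phi _ _) 0 1; rewrite -/e.
move: g' e J0; move: (\det _) (derive1n k _ 0) ('d B 0 _) => J b w g' e J0 g'0 e0.
exact: sign_identity.
Qed.

Lemma derive1_scale (V : normedModType R) (tau : R) (g : R -> V) t :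
  smooth_at (tau * t) g -> derive1 (fun t => g (tau * t)) t = tau *: derive1 g (tau * t).
Proof.
move=> sg; have sl : smooth_at t (fun t : R => tau * t).
  by apply: smooth_atM; [exact: smooth_at_cst|exact: smooth_at_id].
have dl : derive1 (fun t : R => tau * t) t = tau.
  apply: etrans (derive1_mul (smooth_at_cst t tau) (smooth_at_id t)) _.
  by rewrite derive1_cst derive1_id mul0r mulr1 add0r.
have dgl : differentiable (fun t => g (tau * t)) t.
  exact: differentiable_comp (smooth_at_diff sl) (smooth_at_diff sg).
apply: etrans (derive1_d_comp sl sg dgl) _.
apply: etrans (d_derive1 _ (smooth_at_diff sg)) _.
by rewrite dl.
Qed.

(** Reversing the parameter and rescaling the null field are the two changes needed to meet the
    orientation conventions. *)
Lemma singular_data_flip (f : 'rV[R]_2 -> 'rV[R]_3) (gamma eta : R -> 'rV[R]_2) (s tau : R) :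
  s != 0 -> `|tau| = 1 -> singular_data f gamma eta ->
  singular_data f (fun t => gamma (tau * t)) (fun t => s *: eta (tau * t)).
Proof.
move=> s0 tau1 [[e e0 [sg g0 dg [U U0 img]]] [se eta0 nul]].
have tau0 : tau != 0 by rewrite -normr_gt0 tau1 ltr01.
have sl t : smooth_at t (fun t : R => tau * t).
  by apply: smooth_atM; [exact: smooth_at_cst|exact: smooth_at_id].
have l0 : tau * 0 = 0 by rewrite mulr0.
have itv t : `]-e, e[%classic (tau * t) <-> `]-e, e[%classic t.
  by rewrite /= !in_itv /= -!ltr_norml normrM tau1 mul1r.
have sgt t : `]-e, e[%classic t -> smooth_at (tau * t) gamma.
  by move=> /itv te; exists `]-e, e[%classic; split.
split.
  exists e => //; split.
  - apply: smooth_on_local => t te; exact: (smooth_at_comp_curve (sl t) (sgt t te)).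
  - by rewrite mulr0.
  - move=> t te; rewrite (derive1_scale (sgt t te)) scaler_eq0 negb_or tau0 /=.
    by apply: dg; apply/itv.
  - exists U => //; rewrite -img; apply/seteqP; split => [_ [t te <-]|_ [t te <-]] /=.
      by exists (tau * t) => //; apply/itv.
    exists (tau * t); first by apply/itv.
    by rewrite mulrA -expr2 -[tau ^+ 2]real_normK ?num_real // tau1 expr1n mul1r.
have near_l (P : set R) : (\forall t \near (0 : R), P t) -> \forall t \near (0 : R), P (tau * t).
  exact: (smooth_at_near_val (sl 0) l0).
split.
- have se0 : smooth_at (tau * 0) eta by rewrite l0.
  by apply: smooth_atZ; [exact: smooth_at_cst|exact: (smooth_at_comp_curve (sl 0) se0)].
- by apply: filterS (near_l _ eta0) => t h; rewrite scaler_eq0 negb_or s0.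
- apply: filterS (near_l _ nul) => t h X; split.
    by move=> /h[a ->]; exists (a / s); rewrite scalerA divfK.
  by move=> [a ->]; apply/h; exists (a * s); rewrite scalerA.
Qed.

End Orientation.

Section Characterization.
Context {R : realType}.

(** Once all derivatives of [B] on the axis below order [n] vanish, those of order [n] of [psi] and
    of [B] differ by a nonzero factor. The order of vanishing is therefore transferred one
    derivative at a time. *)
Lemma prenormal_order (B : 'rV[R]_2 -> R) (Phi : 'rV[R]_3 -> 'rV[R]_3)
    (phi : 'rV[R]_2 -> 'rV[R]_2) (f nu : 'rV[R]_2 -> 'rV[R]_3)
    (gamma eta : R -> 'rV[R]_2) k :
  smooth_at 0 B -> diffeo_germ Phi -> diffeo_germ phi ->
  (\forall p \near (0 : 'rV[R]_2), f p = Phi (prenormal B (phi p))) ->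
  normal_vector f nu -> singular_data f gamma eta ->
  condition_c k f nu gamma eta <->
  (forall j, (j < k)%N -> derive1n j (fun x : R => B (row2 x 0)) 0 = 0) /\
  derive1n k (fun x : R => B (row2 x 0)) 0 != 0.
Proof.
move=> sB dPhi dphi fE nuf sd.
have [[_ _ g'0 e0] _] := prenormal_coordinates sB dPhi dphi fE sd.
have J0 : \det ('J Phi 0) != 0.
  by apply: det_jacobian; exact: (nbhs_singleton (diffeo_germ_d_inj dPhi)).
have step n : (forall j, (j < n)%N -> derive1n j (fun x : R => B (row2 x 0)) 0 = 0) ->
    exists2 U : R, U != 0 &
    (forall j, (j < n)%N -> derive1n j (psi f nu gamma eta) 0 = 0) /\
    derive1n n (psi f nu gamma eta) 0 = U * derive1n n (fun x : R => B (row2 x 0)) 0.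
  move=> b0; have [K K0 [lo hi]] := prenormal_derive_psi sB dPhi dphi fE nuf sd b0.
  eexists; last by split; [exact: lo|exact: hi].
  apply: mulf_neq0; last exact: expf_neq0.
  apply: mulf_neq0; last by rewrite invr_eq0.
  by apply: mulf_neq0; [exact: mulf_neq0|rewrite gt_eqF].
split=> [[lo hi]|[lo hi]].
  have b0 n : (n <= k)%N -> forall j, (j < n)%N -> derive1n j (fun x : R => B (row2 x 0)) 0 = 0.
    elim: n => [//|n IH] nk j; rewrite ltnS leq_eqVlt => /orP[/eqP ->|]; last exact: IH (ltnW nk) j.
    have [U U0 [_ E]] := step n (IH (ltnW nk)).
    by apply: (mulfI U0); rewrite -E mulr0; exact: lo.
  have lob := b0 k (leqnn k); split=> //.
  have [U U0 [_ E]] := step k lob.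
  by apply: contra_neq hi => hi; rewrite E hi mulr0.
have [U U0 [lo' E]] := step k lo; split=> //.
by apply: contra_neq hi => hi; apply: (mulfI U0); rewrite -E hi mulr0.
Qed.

Lemma oriented_data (f : 'rV[R]_2 -> 'rV[R]_3) (gamma eta : R -> 'rV[R]_2) (r : R)
    (w : 'rV[R]_2) :
  singular_data f gamma eta -> null_transverse gamma eta -> r != 0 -> w = r *: eta 0 ->
  exists gamma' eta', [/\ singular_data f gamma' eta',
    exists2 r', 0 < r' & w = r' *: eta' 0 & 0 < det2 (derive1 gamma' 0) (eta' 0)].
Proof.
(* The sign [s] makes the null vector point along [w]; [tau], chosen afterwards, corrects the
   orientation by reversing the curve. *)
move=> sd /row_full2P D r0 wE; pose s : R := Num.sg r.
pose tau : R := Num.sg (s * det2 (derive1 gamma 0) (eta 0)).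
have s0 : s != 0 by rewrite sgr_eq0.
have sD : s * det2 (derive1 gamma 0) (eta 0) != 0 by rewrite mulf_neq0.
have tau1 : `|tau| = 1 by rewrite normr_sg sD.
have sg0 : smooth_at (tau * 0) gamma.
  by rewrite mulr0; exact: singular_data_smooth sd.
exists (fun t => gamma (tau * t)), (fun t => s *: eta (tau * t)); split.
- exact: singular_data_flip.
- exists `|r|; first by rewrite normr_gt0.
  by rewrite mulr0 wE scalerA mulrC -numEsg.
- rewrite (derive1_scale sg0) mulr0.
  have -> : det2 (tau *: derive1 gamma 0) (s *: eta 0) = tau * (s * det2 (derive1 gamma 0) (eta 0)).
    by rewrite !det2E !mxE; ring.
  by rewrite -normrEsg normr_gt0.
Qed.

Context (k : nat) (sigma : bool) (f nu : 'rV[R]_2 -> 'rV[R]_3)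
  (gamma eta : R -> 'rV[R]_2).
Context (hk : (2 <= k)%N) (hf : frontal f) (hnu : normal_vector f nu).
Context (hdata : nondegenerate_singular f nu -> singular_data f gamma eta).

Let k0 : (0 < k)%N. Proof. exact: ltn_trans hk. Qed.
Let sf : smooth_at 0 f. Proof. by case: hf. Qed.
Let f0 : f 0 = 0. Proof. by case: hf. Qed.

Lemma conditions_sufficient :
  condition_a f nu gamma eta ->
  (exists (c : R -> 'rV[R]_2) (l : R), [/\ condition_b f gamma eta c l,
     condition_c k f nu gamma eta & condition_d k sigma f nu c l]) ->
  A_equivalent f (cuspidal_S k.-1 sigma).
Proof.
move=> [nd tr] [c [l [[[sc c0] [r r0 dc] [_ _] d3 a0] cc cd]]].
have sd := hdata nd.
have [B [Phi [phi [sB dPhi dphi fE]]]] := prenormal_of_frontal sf f0 hnu nd sd tr.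
have /(prenormal_order k sB dPhi dphi fE hnu sd)[b0 bk] := cc.
have B0 : B 0 = 0 by have := b0 0%N k0; rewrite derive1n0 row20.
have B1 : 'd B 0 (delta_mx 0 0) = 0.
  by apply: etrans (esym (derive1_axis0 sB)) _; exact: (b0 1%N hk).
have dA := prenormal_det_a sB dPhi dphi fE sd sc c0 dc d3 B0 B1.
have w0 : 'd B 0 (delta_mx 0 1) != 0.
  by apply: contra_neq a0 => w0; apply: etrans dA _; rewrite w0 mulr0 mul0r.
have sgn : ~~ odd k -> Num.sg (derive1n k (fun x : R => B (row2 x 0)) 0 * 'd B 0 (delta_mx 0 1)) =
    signR sigma.
  (* The given curve and null field need not be oriented as (d) requires, so they are replaced by an
     oriented pair, for which [prenormal_sign] computes the same sign. *)
  move=> ek; have [gamma' [eta' [sd' [r' r'0 dc'] D']]] := oriented_data sd tr r0 dc.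
  have P := prenormal_sign sB dPhi dphi fE hnu sd' sc c0 r'0 dc' d3 B0 B1 b0 ek.
  apply: etrans (esym P) _; apply: cd => //.
  by exists r'.
have [T [s [dT ds E]]] := prenormal_normal_form k0 sB b0 bk w0 sgn.
have [Psi [sPhi sPsi Phi0 Psi0 [PsiK KPsi]]] := dPhi.
exists (fun p => s (phi p)), (fun P => T (Psi P)); split.
- exact: diffeo_germ_comp.
- by apply: diffeo_germ_comp => //; exists Phi.
have [_ [sphi _ phi0 _ _]] := dphi.
have sB' : smooth_at (phi 0) (even_lift B) by rewrite phi0; exact: even_lift_smooth.
have sq : smooth_at 0 (fun p => prenormal B (phi p)).
  exact: smooth_at_comp sphi (prenormal_smooth_near sB').
have q0 : prenormal B (phi 0) = 0 by rewrite phi0 prenormal0.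
have N1 := smooth_at_near_val sq q0 PsiK.
have N2 := smooth_at_near_val sphi phi0 E.
near=> p.
have -> : f p = Phi (prenormal B (phi p)) by near: p.
have -> : Psi (Phi (prenormal B (phi p))) = prenormal B (phi p) by near: p.
by near: p.
Unshelve. all: by end_near. Qed.

Definition standard_lift (z : 'rV[R]_2) : R := z 0 0 ^+ k + signR sigma * z 0 1.

Lemma standard_lift_smooth : smooth_at 0 standard_lift.
Proof.
apply: smooth_atD; first by apply: smooth_atX; exact: smooth_at_coord.
by apply: smooth_atM; [exact: smooth_at_cst|exact: smooth_at_coord].
Qed.

Lemma standard_lift_cuspidal p : prenormal standard_lift p = cuspidal_S k.-1 sigma p.
Proof. by rewrite cuspidal_SE // /prenormal /even_lift /standard_lift !rcE. Qed.

Lemma standard_lift_axis : (fun x : R => standard_lift (row2 x 0)) = (fun x => x ^+ k * 1).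
Proof. by apply/funext => x; rewrite /standard_lift !rcE mulr0 addr0 mulr1. Qed.

Lemma standard_lift_order j : (j <= k)%N ->
  derive1n j (fun x : R => standard_lift (row2 x 0)) 0 = if (j < k)%N then 0 else k`!%:R.
Proof.
move=> jk; rewrite standard_lift_axis.
apply: etrans (derive1n_monomial (smooth_at_cst 0 (1 : R)) jk) _.
by rewrite mulr1.
Qed.

Lemma standard_lift0 : standard_lift 0 = 0.
Proof. by rewrite /standard_lift !rowvec0 mulr0 addr0 expr0n gtn_eqF. Qed.

Lemma standard_lift_d0 : 'd standard_lift 0 (delta_mx 0 0) = 0.
Proof.
apply: etrans (esym (derive1_axis0 standard_lift_smooth)) _.
by apply: etrans (standard_lift_order (ltnW hk)) _; rewrite hk.
Qed.

Lemma standard_lift_d1 : 'd standard_lift 0 (delta_mx 0 1) = signR sigma.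
Proof.
apply: (@Hadamard_d _ standard_lift (fun=> signR sigma) 0 (rowvec0 1) standard_lift_smooth).
  exact: smooth_at_cst.
have := smooth_at_near standard_lift_smooth.
apply: filterS => p _; rewrite /standard_lift !rcE mulr0 addr0.
by rewrite [p 0 1 * _]mulrC.
Qed.

Lemma conditions_necessary : A_equivalent f (cuspidal_S k.-1 sigma) ->
  condition_a f nu gamma eta /\
  (exists (c : R -> 'rV[R]_2) (l : R), [/\ condition_b f gamma eta c l,
     condition_c k f nu gamma eta & condition_d k sigma f nu c l]).
Proof.
move=> [ds [dt [dds ddt E]]].
have [Phi [sdt sPhi dt0 Phi0 [PhiK KPhi]]] := ddt.
have dPhi : diffeo_germ Phi by exists dt.
have [chi [sds schi ds0 chi0 [chiK Kchi]]] := dds.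
have fE : \forall p \near (0 : 'rV[R]_2), f p = Phi (prenormal standard_lift (ds p)).
  have N := smooth_at_near_val sf f0 PhiK; near=> p.
  rewrite standard_lift_cuspidal.
  have <- : dt (f p) = cuspidal_S k.-1 sigma (ds p) by near: p.
  by apply: esym; near: p.
have sB := standard_lift_smooth.
have nd := prenormal_nondegenerate sB dPhi dds fE hnu; have sd := hdata nd.
split; first by split=> //; exact: (prenormal_transverse sB dPhi dds fE sd).
have [[_ _ g'0 e0] [_ de]] := prenormal_coordinates sB dPhi dds fE sd.
(* The curve is the preimage under the source diffeomorphism of the second axis of the normal
   form. *)
pose c (s : R) := chi (row2 0 s).
have srow : smooth_at 0 (fun s : R => row2 0 s).
  by apply: smooth_at_row2; [exact: smooth_at_cst|exact: smooth_at_id].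
have schi2 : smooth_at (row2 0 0) chi by rewrite row20.
have sc : smooth_at 0 c := smooth_at_comp srow schi2.
have c0 : c 0 = 0 by rewrite /c row20.
have inj_ds : forall v, 'd ds 0 v = 0 -> v = 0 := nbhs_singleton (diffeo_germ_d_inj dds).
have inj_Phi : forall v : 'rV[R]_3, 'd Phi 0 v = 0 -> v = 0 := nbhs_singleton (diffeo_germ_d_inj dPhi).
set e := ('d ds _ _) 0 1 in e0 de.
have dsc : \forall s \near (0 : R), ds (c s) = row2 0 s.
  exact: (smooth_at_near_val srow row20 Kchi).
clearbody c.
have ddsc : 'd ds 0 (derive1 c 0) = row2 0 1.
  have sdsc : smooth_at (c 0) ds by rewrite c0.
  have D := derive1_d_comp sc sdsc (smooth_at_diff (smooth_at_comp sc sdsc)).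
  have D2 : derive1 (fun s => ds (c s)) 0 = row2 0 1.
    apply: etrans (eq_derive1n 1 dsc) _.
    apply: etrans (derive1_d (smooth_at_diff srow)) _.
    apply: etrans (d_row2 (1 : R) (smooth_at_cst (0 : R) (0 : R)) (smooth_at_id (0 : R))) _.
    by congr row2; [exact: d_cst|exact: d_id].
  by rewrite c0 in D; exact: etrans (esym D) D2.
(* In the adapted coordinates [c] has velocity [(0, 1)] and the null vector is [(0, e)]. *)
have dc : derive1 c 0 = e^-1 *: eta 0.
  apply/eqP; rewrite -subr_eq0; apply/eqP; apply: inj_ds.
  apply: etrans (linearB ('d ds 0) _ _) _.
  apply: etrans (f_equal2 (fun a b => a - b) ddsc (etrans (linearZZ ('d ds 0) _ _) (congr1 _ de))) _.
  move: e e0 {de} => e e0.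
  apply/rowP; apply: ord2P; rewrite !mxE /=; first by rewrite mulr0 subrr.
  by rewrite mulVf // subrr.
(* The normal form along its second axis. Each component is a power of [s] times a constant, the
   shape expected by [derive1n_monomial]. *)
pose q (s : R) := row3 0 (s ^+ 2 * 1) (s ^+ 5 * signR sigma).
have mono n (a : R) : smooth_at 0 (fun s : R => s ^+ n * a).
  by apply: smooth_atM; [apply: smooth_atX; exact: smooth_at_id|exact: smooth_at_cst].
have sq : smooth_at 0 q.
  by apply: smooth_at_row3; [exact: smooth_at_cst|exact: mono|exact: mono].
have q0 : q 0 = 0 by rewrite /q !expr0n !mul0r row30.
have fcE : \forall s \near (0 : R), (f \o c) s = Phi (q s).
  have N := smooth_at_near_val sc c0 fE; near=> s.
  rewrite /comp; have -> : f (c s) = Phi (prenormal standard_lift (ds (c s))) by near: s.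
  have -> : ds (c s) = row2 0 s by near: s.
  rewrite standard_lift_cuspidal cuspidal_SE // !rcE expr0n gtn_eqF // add0r.
  by congr Phi; rewrite /q; congr row3; ring.
have D0 n : (derive1n n q 0) 0 0 = 0.
  apply: etrans (derive1n_coord n 0 sq) _.
  have -> : (fun s => q s 0 0) = cst 0 by apply/funext => s; rewrite rcE.
  elim: n => [//|n IH]; rewrite derive1Sn.
  by have -> : derive1 (cst 0 : R -> R) = cst 0 by apply/funext => s; exact: derive1_cst.
have D1 n : (n <= 2)%N -> (derive1n n q 0) 0 1 = if (n < 2)%N then 0 else 2`!%:R * 1.
  move=> n2; apply: etrans (derive1n_coord n 1 sq) _.
  have -> : (fun s => q s 0 1) = (fun s => s ^+ 2 * 1) by apply/funext => s; rewrite rcE.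
  exact: (derive1n_monomial (smooth_at_cst 0 (1 : R)) n2).
have D2 n : (n < 5)%N -> (derive1n n q 0) 0 2 = 0.
  move=> n5; apply: etrans (derive1n_coord n 2 sq) _.
  have -> : (fun s => q s 0 2) = (fun s => s ^+ 5 * signR sigma) by apply/funext => s; rewrite rcE.
  by apply: etrans (derive1n_monomial (smooth_at_cst 0 (signR sigma)) (ltnW n5)) _; rewrite n5.
have dq0 : derive1 q 0 = 0.
  apply/rowP; apply: ord3P; rewrite [RHS]mxE.
  - exact: (D0 1%N).
  - exact: (D1 1%N).
  - exact: (D2 1%N).
(* The order three exceeds the exponent two, so [derive1n_monomial] does not cover it and the square
   is expanded by the Leibniz rule. *)
have D13 : (derive1n 3 q 0) 0 1 = 0.
  apply: etrans (derive1n_coord 3 1 sq) _.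
  have -> : (fun s => q s 0 1) = (fun s => s * s) by apply/funext => s; rewrite rcE mulr1 expr2.
  have d2 : derive1n 2 (fun s : R => s) 0 = 0.
    rewrite derive1Sn derive1n1.
    have -> : derive1 (fun s : R => s) = (fun=> 1 : R).
      by apply/funext => s; exact: derive1_id.
    exact: derive1_cst.
  apply: etrans (Leibniz3 (smooth_at_id (0 : R)) (smooth_at_id (0 : R))) _.
  by rewrite d2 !(mulr0, mul0r) !addr0.
have f1 : derive1 (f \o c) 0 = 0.
  have sPq : smooth_at (q 0) Phi by rewrite q0.
  apply: etrans (eq_derive1n 1 fcE) _.
  apply: etrans (derive1_d_comp sq sPq (smooth_at_diff (smooth_at_comp sq sPq))) _.
  by rewrite dq0; exact: linear0.
have f2 : derive1n 2 (f \o c) 0 = 'd Phi 0 (derive1n 2 q 0) :=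
  etrans (eq_derive1n 2 fcE) (chain2_row sq q0 dq0 sPhi).
have f3 : derive1n 3 (f \o c) 0 = 'd Phi 0 (derive1n 3 q 0) :=
  etrans (eq_derive1n 3 fcE) (chain3_row sq q0 dq0 sPhi).
have q3 : derive1n 3 q 0 = 0.
  apply/rowP; apply: ord3P; rewrite [RHS]mxE.
  - exact: (D0 3%N).
  - exact: D13.
  - exact: (D2 3%N).
(* The third derivative vanishes, which is why [l = 0] is the witness. *)
have d3 : derive1n 3 (f \o c) 0 = 0 *: derive1n 2 (f \o c) 0.
  by apply: etrans f3 _; rewrite q3 scale0r; exact: linear0.
have J0 : \det ('J Phi 0) != 0 by exact: det_jacobian.
have B0 := standard_lift0; have B1 := standard_lift_d0.
have b0 j : (j < k)%N -> derive1n j (fun x : R => standard_lift (row2 x 0)) 0 = 0.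
  by move=> jk; rewrite standard_lift_order ?jk // ltnW.
have bk : derive1n k (fun x : R => standard_lift (row2 x 0)) 0 = k`!%:R.
  by rewrite standard_lift_order // ltnn.
have kf : 0 < k`!%:R :> R by rewrite ltr0n fact_gt0.
have cc : condition_c k f nu gamma eta.
  by apply/(prenormal_order k sB dPhi dds fE hnu sd); split=> //; rewrite bk gt_eqF.
exists c, 0; split; [split; [by split| | split; [exact: f1|]| exact: d3|] | exact: cc|].
- by exists e^-1 => //; rewrite invr_eq0.
- apply/eqP => /(etrans (esym f2))/inj_Phi q2.
  have := congr1 (fun v : 'rV[R]_3 => v 0 1) q2; rewrite (D1 2%N) // rowvec0 mulr1 => /eqP.
  by rewrite pnatr_eq0.
- apply/eqP => /(etrans (esym (prenormal_det_a sB dPhi dds fE sd sc c0 dc d3 B0 B1))) /eqP.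
  rewrite -/e mulVf // expr1n mulr1 standard_lift_d1 !mulf_eq0 pnatr_eq0 (negbTE J0).
  by rewrite (negbTE (signR_neq0 _)) (negbTE g'0).
- move=> ek gamma' eta' sd' [r r0 dc'] _.
  apply: etrans (prenormal_sign sB dPhi dds fE hnu sd' sc c0 r0 dc' d3 B0 B1 b0 ek) _.
  rewrite bk standard_lift_d1 sgrM (gtr0_sg kf) mul1r.
  by case: sigma; rewrite /signR ?sgr1 ?sgrN1.
Unshelve. all: by end_near. Qed.

End Characterization.

Theorem theorem3p2 (R : realType) (k : nat) (sigma : bool)
    (f nu : 'rV[R]_2 -> 'rV[R]_3) (gamma eta : R -> 'rV[R]_2)
    (hk : (2 <= k)%N) (hf : frontal f) (hnu : normal_vector f nu)
    (hdata : nondegenerate_singular f nu -> singular_data f gamma eta) :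
  A_equivalent f (cuspidal_S k.-1 sigma) <->
  condition_a f nu gamma eta /\
  exists (c : R -> 'rV[R]_2) (l : R),
    [/\ condition_b f gamma eta c l,
        condition_c k f nu gamma eta &
        condition_d k sigma f nu c l].
Proof.
split; first exact: conditions_necessary.
by move=> [ha hbcd]; exact: (conditions_sufficient hk hf hnu hdata ha hbcd).
Qed.
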